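(* Let $n\geqslant1$. For every $\varpi\in S_n$, $$\mathfrak{B}_\varpi(X,Y)=\mathfrak{S}_{\varpi^*}(\omega_0X,-Y),$$ where $\varpi^*=\omega_0\varpi\omega_0$. In particular, $\mathfrak{B}_\varpi(X,Y)$ has nonnegative integer coefficients.
   Context: $X=(x_1,\ldots,x_n)$, $Y=(y_1,\ldots,y_n)$ are commuting independent variables. $\omega_0=(n,n-1,\ldots,1)$ is the longest element of $S_n$, and $f(\omega_0X,-Y)$ denotes $f(x_n,\ldots,x_1,-y_1,\ldots,-y_n)$. Weyl group and type $B$ divided differences. $W_n$ is the hyperoctahedral group of signed permutations (a bar denotes a negative entry), generated by simple transpositions $s_i$ ($1\leqslant i\leqslant n-1$), generating $S_n\subset W_n$, and $s_0$; right multiplication by $s_i$ interchanges the entries in positions $i,i+1$, and $(u_1,\ldots,u_n)s_0=(\overline{u}_1,u_2,\ldots,u_n)$; $w_0=(\overline1,\ldots,\overline n)$ is the longest element. $W_n$ acts on $\mathbb{Z}[1/2][Y][X]$: $s_i$ interchanges $x_i,x_{i+1}$, and $s_0$ sends $x_1$ to $-x_1$. $\partial_i(f)=(f-s_if)/(x_i-x_{i+1})$ for $1\leqslant i\leqslant n-1$, $\partial_0(f)=(f-s_0f)/x_1$; $\partial'_i=-\partial_i$ for $1\leqslant i\leqslant n-1$, $\partial'_0=\partial_0$. For a reduced word $w=s_{a_1}\cdots s_{a_r}$, $\partial_w=\partial_{a_1}\circ\cdots\circ\partial_{a_r}$ and $\partial'_w=\partial'_{a_1}\circ\cdots\circ\partial'_{a_r}$.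 Type $A$ double Schubert polynomials: $\Delta(X,Y)=\prod_{i+j\leqslant n}(x_i-y_j)$ and $\mathfrak{S}_\varpi(X,Y)=\partial_{\varpi^{-1}\omega_0}(\Delta(X,Y))$ for $\varpi\in S_n$. $\widetilde P$-polynomials: $\widetilde Q_i(X)=e_i(X)$ (elementary symmetric), $\widetilde Q_{i,j}=\widetilde Q_i\widetilde Q_j+2\sum_{k=1}^j(-1)^k\widetilde Q_{i+k}\widetilde Q_{j-k}$, and for $\lambda=(\lambda_1\geqslant\cdots\geqslant\lambda_r\geqslant0)$ with $r$ even (put $\lambda_r=0$ if necessary), $\widetilde Q_\lambda=\mathrm{Pfaffian}[\widetilde Q_{\lambda_i,\lambda_j}]_{1\leqslant i<j\leqslant r}$; $\widetilde P_\lambda=2^{-\ell(\lambda)}\widetilde Q_\lambda$, with $\ell(\lambda)$ the number of nonzero parts. $\mathcal{D}_n$ is the set of strict partitions (distinct nonzero parts, possibly none) with all parts at most $n$; $\lambda'$ is the strict partition whose parts are the complement of those of $\lambda$ in $\{1,\ldots,n\}$; $\widetilde P_n(X,Y)=\sum_{\lambda\in\mathcal{D}_n}\widetilde P_\lambda(X)\widetilde P_{\lambda'}(Y)$. Type $B$ double Schubert polynomials: $\mathfrak{B}_w(X,Y)=(-1)^{n(n-1)/2}\,\partial'_{w^{-1}w_0}\bigl(\Delta(X,Y)\widetilde P_n(X,Y)\bigr)$ for $w\in W_n$. *)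

(* Defs.v *)
From mathcomp Require Import all_boot all_order all_algebra all_fingroup.
From mathcomp.multinomials Require Import mpoly.

Set Implicit Arguments.
Unset Strict Implicit.
Unset Printing Implicit Defensive.

Import Order.TTheory GRing.Theory Num.Theory.
Local Open Scope ring_scope.

(* (false, i) is the letter i+1 and (true, i) is the barred letter -(i+1). *)
Notation letter n := (bool * 'I_n)%type.

Definition bar n (x : letter n) : letter n := (~~ x.1, x.2).

(* A signed permutation w has one-line notation
   (w (false, 0), ..., w (false, n-1)). *)
Definition is_signed n (w : {perm letter n}) : Prop :=
  forall x, w (bar x) = bar (w x).

(* MathComp's product of permutations composes from left to right; wmul is the
   usual one: wmul u v x = u (v x). *)
Definition wmul n (u v : {perm letter n}) : {perm letter n} := (v * u)%g.

Definition opred n (i : 'I_n) : 'I_n :=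
  Ordinal (leq_ltn_trans (leq_pred i) (ltn_ord i)).

(* The generators s_0, ..., s_{n-1} are indexed by 'I_n. As positions and
   variables are numbered from 0 here, s_i (i > 0) exchanges i-1 and i. *)
Definition simple n (i : 'I_n) : {perm letter n} :=
  if val i == 0%N then tperm (false, i) (true, i)
  else (tperm (false, opred i) (false, i) * tperm (true, opred i) (true, i))%g.

Definition word_prod n (a : seq 'I_n) : {perm letter n} :=
  foldr (fun i w => wmul (simple i) w) 1%g a.

(* Words in all of s_0, ..., s_{n-1}; the reduced words of an element of the
   parabolic subgroup S_n do not contain s_0, so they are its reduced words in S_n. *)
Definition reduced n (w : {perm letter n}) (a : seq 'I_n) : Prop :=
  word_prod a = w /\ forall b, word_prod b = w -> (size a <= size b)%N.

Definition reduced_word n (w : {perm letter n}) : Type :=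
  {a : seq 'I_n | reduced w a}.

Lemma embed_inj n (p : 'S_n) : injective (fun x : letter n => (x.1, p x.2)).
Proof. by move=> [b i] [c j] /= [-> /perm_inj ->]. Qed.

Definition embed n (p : 'S_n) : {perm letter n} := perm (@embed_inj n p).

Lemma bar_inj n : injective (@bar n).
Proof. by move=> [b i] [c j] [/negb_inj -> ->]. Qed.

Definition w0 n : {perm letter n} := perm (@bar_inj n).

Definition omega0 n : 'S_n := perm (@rev_ord_inj n).

Definition pstar n (p : 'S_n) : 'S_n := (omega0 n * p * omega0 n)%g.

(* Polynomials in x_1, ..., x_n, y_1, ..., y_n; the coefficients, which are in
   Z[1/2], are taken in rat. *)
Notation XYpoly n := {mpoly rat[n + n]}.

Definition varX n (i : 'I_n) : XYpoly n := 'X_(lshift n i).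
Definition varY n (j : 'I_n) : XYpoly n := 'X_(rshift n j).

Definition substXY n (gx gy : 'I_n -> XYpoly n) (f : XYpoly n) : XYpoly n :=
  f \mPo [tuple match split k with inl i => gx i | inr j => gy j end | k < n + n].

Definition letterX n (x : letter n) : XYpoly n := (-1) ^+ x.1 * varX x.2.

Definition wact n (w : {perm letter n}) (f : XYpoly n) : XYpoly n :=
  substXY (fun i => letterX (w (false, i))) (@varY n) f.

Definition sroot n (i : 'I_n) : XYpoly n :=
  if val i == 0%N then varX i else varX (opred i) - varX i.

Lemma substXY_X n gx gy (i : 'I_n) : substXY gx gy (varX i) = gx i.
Proof.
rewrite /substXY /varX comp_mpolyXU -tnth_nth tnth_mktuple.
by rewrite (unsplitK (inl i)).
Qed.

Lemma substXY_Y n gx gy (j : 'I_n) : substXY gx gy (varY j) = gy j.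
Proof.
rewrite /substXY /varY comp_mpolyXU -tnth_nth tnth_mktuple.
by rewrite (unsplitK (inr j)).
Qed.

Lemma sroot_neq0 n (i : 'I_n) : sroot i != 0.
Proof.
have Xinj (k l : 'I_(n + n)) : 'X_k = 'X_l :> XYpoly n -> k = l.
  move/(congr1 (fun p : XYpoly n => p@_U_(k)%MM)); rewrite !mcoeffX eqxx.
  by case: eqP => [/eqP|_ /eqP]; rewrite ?eqr_nat // eq_mnm1 => /eqP ->.
rewrite /sroot; case: ifPn => i0.
  apply/eqP => /(congr1 (fun p : XYpoly n => p@_U_(lshift n i)%MM)).
  by rewrite /varX mcoeffX eqxx mcoeff0 => /eqP; rewrite oner_eq0.
rewrite subr_eq0; apply/eqP => /Xinj /(congr1 val) /= /eqP.
by rewrite -lt0n in i0; rewrite -{2}(prednK i0) -[_ == _]negbK neq_ltn ltnSn.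
Qed.

Lemma divdiff_subproof n (i : 'I_n) (f : XYpoly n) :
  exists g, g * sroot i == f - wact (simple i) f.
Proof.
pose D (h : XYpoly n) := exists g, g * sroot i = h - wact (simple i) h.
suff [g dg] : D f by exists g; apply/eqP.
have DC c : D c%:MP.
  by exists 0; rewrite mul0r /wact /substXY comp_mpolyC subrr.
have DD u v : D u -> D v -> D (u + v).
  case=> [g dg] [h dh]; exists (g + h).
  by rewrite mulrDl dg dh /wact /substXY comp_mpolyD opprD addrACA.
have DM u v : D u -> D v -> D (u * v).
  case=> [g dg] [h dh]; exists (g * v + wact (simple i) u * h).
  rewrite mulrDl mulrAC dg -mulrA dh /wact /substXY rmorphM /=.
  by rewrite mulrBl mulrBr addrA subrK.
have D1 : D 1 by rewrite -mpolyC1.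
have DX (j : 'I_n) : D (varX j).
  rewrite /D /wact substXY_X /sroot /simple.
  case: ifPn => i0.
    case: (eqVneq j i) => [->|ji].
      exists 2%:R; rewrite tpermL /letterX /= expr1.
      by rewrite mulN1r opprK mulr_natl mulr2n.
    exists 0; rewrite mul0r tpermD ?/letterX /= ?mul1r ?subrr //.
    by rewrite xpair_eqE /= eq_sym.
  have ppi : opred i != i.
    by rewrite -val_eqE /= -lt0n in i0 *; rewrite neq_ltn prednK ?leqnn.
  case: (eqVneq j i) => [->|ji].
    exists (-1); rewrite permM tpermR tpermD ?xpair_eqE //=.
    by rewrite /letterX /= mul1r mulN1r opprB.
  case: (eqVneq j (opred i)) => [->|jpi].
    exists 1; rewrite permM tpermL tpermD ?xpair_eqE //=.
    by rewrite /letterX /= !mul1r.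
  exists 0; rewrite mul0r permM !tpermD ?xpair_eqE //= 1?eq_sym //.
  by rewrite /letterX /= mul1r subrr.
have DXk (k : 'I_(n + n)) : D 'X_k.
  rewrite -(splitK k); case: (split k) => j; first exact: DX.
  by exists 0; rewrite mul0r /wact substXY_Y subrr.
elim/mpolyind: f => [|c m p _ _ Dp]; first by rewrite -mpolyC0.
apply: DD => //; rewrite -mul_mpolyC; apply: (DM) => //.
rewrite mpolyXE_id; apply: (big_ind D) => // k _.
by elim: (m k) => [|e IH]; rewrite ?expr0 // exprS; apply: DM.
Qed.

Definition divdiff n (i : 'I_n) (f : XYpoly n) : XYpoly n :=
  xchoose (divdiff_subproof i f).

Lemma divdiffE n (i : 'I_n) (f : XYpoly n) :
  divdiff i f * sroot i = f - wact (simple i) f.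
Proof. exact/eqP/(xchooseP (divdiff_subproof i f)). Qed.

Definition divdiff' n (i : 'I_n) (f : XYpoly n) : XYpoly n :=
  if val i == 0%N then divdiff i f else - divdiff i f.

(* These depend on the chosen reduced word a, so a statement quantified over a
   also covers the independence of the choice. *)
Definition divdiff_perm n (w : {perm letter n}) (a : reduced_word w)
  (f : XYpoly n) : XYpoly n := foldr (@divdiff n) f (sval a).

Definition divdiff'_perm n (w : {perm letter n}) (a : reduced_word w)
  (f : XYpoly n) : XYpoly n := foldr (@divdiff' n) f (sval a).

Definition Delta n : XYpoly n :=
  \prod_(i < n) \prod_(j < n | (i.+1 + j.+1 <= n)%N) (varX i - varY j).

Definition schubA_perm n (p : 'S_n) : {perm letter n} :=
  wmul (embed p)^-1%g (embed (omega0 n)).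

Definition schubA n (p : 'S_n) (a : reduced_word (schubA_perm p)) : XYpoly n :=
  divdiff_perm a (Delta n).

Definition even_pos m (i : 'I_m) : 'I_m.*2 :=
  Ordinal (etrans (ltn_double i m) (ltn_ord i)).
Definition odd_pos m (i : 'I_m) : 'I_m.*2 :=
  Ordinal (etrans (ltn_Sdouble i m) (ltn_ord i)).

(* The permutations s with s 0 < s 1, s 2 < s 3, ... and s 0 < s 2 < s 4 < ...:
   one for each perfect matching of 'I_m.*2. *)
Definition matching m (s : 'S_m.*2) : bool :=
  [forall i : 'I_m, (s (even_pos i) < s (odd_pos i))%N] &&
  [forall i : 'I_m, forall j : 'I_m,
     (i < j)%N ==> (s (even_pos i) < s (even_pos j))%N].

(* Only the entries A i j with i < j are used. *)
Definition pfaffian (R : comNzRingType) m (A : 'I_m.*2 -> 'I_m.*2 -> R) : R :=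
  \sum_(s : 'S_m.*2 | matching s)
    (-1) ^+ (s : bool) * \prod_(i < m) A (s (even_pos i)) (s (odd_pos i)).

Definition Qt2 n (i j : nat) : {mpoly rat[n]} :=
  mesym n rat i * mesym n rat j
  + 2%:R * \sum_(1 <= k < j.+1)
      (-1) ^+ k * (mesym n rat (i + k) * mesym n rat (j - k)).

(* A partition of odd length is extended by one zero part. *)
Definition Qt n (la : seq nat) : {mpoly rat[n]} :=
  pfaffian (fun i j : 'I_(uphalf (size la)).*2 =>
    Qt2 n (nth 0%N la i) (nth 0%N la j)).

Definition Pt n (la : seq nat) : {mpoly rat[n]} :=
  (2%:R ^- count (fun k => k != 0%N) la) *: Qt n la.

(* Strict partitions with parts at most n are given by their sets of parts,
   where i : 'I_n stands for the part i+1. *)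
Definition strict_part n (A : {set 'I_n}) : seq nat :=
  sort geq [seq (val i).+1 | i in A].

Definition PtXY n : XYpoly n :=
  \sum_(A : {set 'I_n})
    (Pt n (strict_part A) \mPo [tuple varX i | i < n]) *
    (Pt n (strict_part (~: A)) \mPo [tuple varY j | j < n]).

Definition schubB_perm n (w : {perm letter n}) : {perm letter n} :=
  wmul w^-1%g (w0 n).

Definition schubB n (w : {perm letter n}) (a : reduced_word (schubB_perm w)) :
    XYpoly n :=
  (-1) ^+ (n * n.-1)./2 * divdiff'_perm a (Delta n * PtXY n).

Definition subst_omega0X_negY n (f : XYpoly n) : XYpoly n :=
  substXY (fun i => varX (omega0 n i)) (fun j => - varY j) f.

Lemma reduced_word_exists n (w : {perm letter n}) :
  is_signed w -> exists a, reduced w a.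
Proof.
move=> sgn_w; pose G (u : {perm letter n}) := exists a, word_prod a = u.
suff [a da] : G w.
  have exP : exists k, [exists b : k.-tuple 'I_n, word_prod b == w].
    by exists (size a); apply/existsP; exists (in_tuple a); apply/eqP.
  case: (ex_minnP exP) => k /existsP[b /eqP db] kmin.
  exists b; split=> // c dc; rewrite size_tuple; apply: kmin.
  by apply/existsP; exists (in_tuple c); apply/eqP.
have G1 : G 1%g by exists [::].
have Gs i : G (simple i) by exists [:: i]; rewrite /= /wmul mul1g.
have GM u v : G u -> G v -> G (u * v)%g.
  case=> [a <-] [b <-]; exists (b ++ a).
  by elim: b => [|i b IH] /=; rewrite ?mulg1 // IH /wmul mulgA.
have embE (p : 'S_n) b k : embed p (b, k) = (b, p k) by rewrite permE.
have embM (p q : 'S_n) : embed (p * q)%g = (embed p * embed q)%g.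
  by apply/permP => x; rewrite permM !permE /= ?permM.
have embT (i j : 'I_n) : i != j -> embed (tperm i j)
    = (tperm (false, i) (false, j) * tperm (true, i) (true, j))%g.
  move=> ij; apply/permP => [[b k]]; rewrite permM permE /=.
  case: (tpermP i j k) => [->|->|/eqP ki /eqP kj]; case: b.
  - by rewrite (tpermD (x := (false, i))) ?tpermL.
  - by rewrite tpermL tpermD.
  - by rewrite (tpermD (x := (false, i))) ?tpermR.
  - by rewrite tpermR tpermD.
  - by rewrite !tpermD ?xpair_eqE //= 1?eq_sym.
  - by rewrite !tpermD ?xpair_eqE //= 1?eq_sym.
have predN (i : 'I_n) : val i != 0%N -> opred i != i.
  by rewrite -val_eqE /= -lt0n => i0; rewrite neq_ltn prednK ?leqnn.
have simpleE (i : 'I_n) : val i != 0%N -> simple i = embed (tperm (opred i) i).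
  by move=> i0; rewrite embT ?predN // /simple (negPf i0).
have simpleV (i : 'I_n) : ((simple i)^-1 = simple i)%g.
  case: (eqVneq (val i) 0%N) => [i0|i0]; first by rewrite /simple i0 tpermV.
  apply/eqP; rewrite eq_invg_mul simpleE // -embM tperm2; apply/eqP.
  by apply/permP => [[b k]]; rewrite permE /= !perm1.
have GT (i j : 'I_n) : (i < j)%N -> G (embed (tperm i j)).
  have [k] := ubnP (val j); elim: k j => // k IH j /=; rewrite ltnS => jk ij.
  have j0 : val j != 0%N by rewrite -lt0n (leq_trans _ ij).
  case: (eqVneq (opred j) i) => [<-|pji]; first by rewrite -simpleE.
  have ipj : (i < opred j)%N.
    by rewrite ltn_neqAle eq_sym val_eqE pji /= -ltnS prednK // lt0n.
  have -> : tperm i j = (tperm (opred j) j * (tperm i (opred j)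
      * tperm (opred j) j))%g.
    rewrite -{1}(tpermV (opred j) j) -[RHS]/((_ ^ _)%g) tpermJ tpermL tpermD //.
    by rewrite eq_sym -val_eqE neq_ltn ij.
  rewrite !embM -simpleE //; do 2!apply: (GM) => //.
  by apply: IH => //=; rewrite -ltnS prednK ?lt0n // ltnS.
have GE (p : 'S_n) : G (embed p).
  case: (prod_tpermP p) => ts -> _.
  have emb1 : embed (1 : 'S_n)%g = 1%g.
    by apply/permP => [[b k]]; rewrite permE /= !perm1.
  elim: ts => [|[i j] ts IH]; first by rewrite big_nil emb1.
  rewrite big_cons embM; apply: GM => //=.
  case: (ltngtP i j) => [/GT //|/GT|/val_inj ->]; first by rewrite tpermC.
  by rewrite tperm1 emb1.
have GF (j : 'I_n) : G (tperm (false, j) (true, j)).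
  have [k] := ubnP (val j); elim: k j => // k IH j /=; rewrite ltnS => jk.
  case: (eqVneq (val j) 0%N) => [j0|j0].
    by have := Gs j; rewrite /simple j0.
  have pj := predN _ j0.
  have -> : tperm (false, j) (true, j)
      = (simple j * (tperm (false, opred j) (true, opred j) * simple j))%g.
    rewrite -{1}simpleV -[RHS]/((_ ^ _)%g) tpermJ simpleE //.
    by rewrite !embE tpermL.
  do 2!apply: (GM) => //; apply: IH => /=.
  by rewrite (leq_trans _ jk) // prednK // lt0n.
have [k] := ubnP #|[set i | (w (false, i)).1]|.
elim: k w sgn_w => // k IH w sgn_w; rewrite ltnS => wk.
case: (set_0Vmem [set i | (w (false, i)).1]) => [w0|[i]]; last first.
  rewrite inE => wi; pose t := tperm (false, i) (true, i).
  suff: G (t * w)%g by move/(GM _ _ (GF i)); rewrite mulgA tperm2 mul1g.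
  have tF j : j != i -> t (false, j) = (false, j).
    by move=> ji; rewrite tpermD ?xpair_eqE //= eq_sym.
  apply: IH => [[b j]|]; last first.
    apply: leq_trans wk; apply/proper_card/properP; split; last first.
      exists i; rewrite ?inE // permM tpermL.
      by rewrite -[(true, i)]/(bar (false, i)) sgn_w /= wi.
    apply/subsetP => j; rewrite !inE permM.
    by case: (eqVneq j i) => [->|/tF ->].
  rewrite !permM -sgn_w; congr (w _); rewrite /bar /=.
  case: (eqVneq j i) => [->|ji]; first by case: b; rewrite ?tpermL ?tpermR.
  by rewrite !tpermD ?xpair_eqE //= (eq_sym i) (negPf ji) andbF.
have wF j : (w (false, j)).1 = false.
  by have := in_set0 j; rewrite -w0 inE.
have pinj : injective (fun j => (w (false, j)).2).
  move=> j l /= jl; have /perm_inj[//] : w (false, j) = w (false, l).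
  by rewrite [LHS]surjective_pairing [RHS]surjective_pairing !wF jl.
suff -> : w = embed (perm pinj) by [].
apply/permP => [[b j]]; rewrite embE permE.
case: b; last by rewrite {1}[w _]surjective_pairing wF.
by rewrite -[(true, j)]/(bar (false, j)) sgn_w /bar wF.
Qed.

Lemma is_signed_embed n (p : 'S_n) : is_signed (embed p).
Proof. by move=> [b i]; rewrite !permE. Qed.

Lemma is_signed_divl n (p : 'S_n) (w : {perm letter n}) :
  is_signed w -> is_signed (wmul (embed p)^-1%g w).
Proof.
move=> sgn_w x; apply: (@perm_inj _ (embed p)).
by rewrite is_signed_embed /wmul !permM !permKV.
Qed.

Lemma schubB_word_exists n (p : 'S_n) :
  exists a, reduced (schubB_perm (embed p)) a.
Proof.
by apply/reduced_word_exists/is_signed_divl => x; rewrite ![w0 n _]permE.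
Qed.

Lemma schubA_word_exists n (p : 'S_n) : exists a, reduced (schubA_perm p) a.
Proof. exact/reduced_word_exists/is_signed_divl/is_signed_embed. Qed.

(* Main.v *)
Require Import Defs.
From HB Require Import structures.
From mathcomp Require Import all_boot all_order all_algebra all_fingroup.
From mathcomp.multinomials Require Import mpoly.
From mathcomp Require Import zify ring.

(** Let [v] be the element of [W_n] with one-line notation (-n, ..., -1), so that
[w_0 = omega_0 v] and, for an unsigned [p], [p^-1 w_0 = (p^-1 omega_0) v] with
lengths adding up.  The operator of a word depends only on the element when
the word is reduced (the word property together with the braid relations), so
the B-polynomial of [p] is obtained by applying the unsigned element
[p^-1 omega_0] to [d_v (Delta * P_n)].  The heart of the matter is the identity
[[
   d_v (Delta(X, Y) * P_n(X, Y)) = prod_(j < k) (x_k + y_j),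
]]
whose right-hand side is Delta with X reversed and Y negated ([phi_PtXY]).
The reversal of X turns [d_i] into [- d_(n-i)], which cancels the signs in
[divdiff'] and turns [p^-1 omega_0] into its conjugate, so the equality of the
two Schubert polynomials follows.

For the identity, one expands [P_n] and studies the functional
[phi f = d_v (Delta f)] on symmetric [f]; it is linear over the polynomials in
X that are invariant under all of [W_n], and over all polynomials in Y.

- If [f] is a product of at most n - 1 elementary symmetric polynomials, then
  [Delta f] has degree at most 2n - 1 - i in [x_i], and a bound on the degrees in
  the separate variables shows [phi f = 0] ([phi_few]).  This disposes of all
  terms of [P_n] but the one whose partition in X is the full staircase.
- As [e_k^2 + 2 sum_i (-1)^i e_(k+i) e_(k-i)] is invariant under [W_n], equal
  factors [e_k e_k] may be spread apart, which increases the sum of the squares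
  of the indices.  Hence [phi] vanishes on products of n factors whose degree is
  below that of [e_1 ... e_n], or whose sum of squared indices is above that of
  [e_1 ... e_n] ([phi_zero]).
- Consequently only the main term of each factor of the Pfaffian of the
  staircase counts; every perfect matching contributes its sign times
  [phi (e_1 ... e_n)], and these signs add up to 1 ([matching_sign],
  [phi_Qt_rho]).
- [phi (e_1 ... e_n)] is computed by induction on n ([phi_rho]).  By the
  vanishing above, [e_n] may be replaced by [prod_i (x_i + y_1)]; then
  [prod_(i < n) (x_i - y_1)], a factor of Delta, combines with it to a polynomial
  that the operator of the smaller element lets through, and what remains is
  the type A computation [chain_shift].

For positivity, the double Schubert polynomials of type A are constructed as
coefficients of a product of factors [1 + (x_i - y_j) u_k] in the nilCoxeter
algebra; the Yang-Baxter relation shows that divided differences act on these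
coefficients in the expected way ([dword_FK]), and after the substitution all
factors become [1 + (x + y) u_k], so the coefficients are visibly natural
numbers. *)

Set Implicit Arguments.
Unset Strict Implicit.
Unset Printing Implicit Defensive.
Import Order.TTheory GRing.Theory Num.Theory.
Local Open Scope ring_scope.

(** * Signed permutations as integer words *)

(** Exchanges the entries in positions [k] and [k + 1] of a word. *)
Fixpoint swp (T : Type) (k : nat) (s : seq T) : seq T :=
  match k, s with
  | 0%N, x :: y :: t => y :: x :: t
  | k'.+1, x :: t => x :: swp k' t
  | _, _ => s
  end.

Definition neg1 (s : seq int) : seq int := if s is x :: t then - x :: t else s.

(** A signed permutation [w] is represented by the integer word listing the values
of [w^-1] at 1, ..., n; left multiplication of [w] by the generator [s_k] then
acts on positions: it exchanges two neighbours, or negates the first entry. *)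
Definition act (k : nat) (s : seq int) : seq int :=
  if k is j.+1 then swp j s else neg1 s.

(** [des k s] says that [s_k] is a left descent of the element represented by [s]. *)
Definition des (k : nat) (s : seq int) : bool :=
  if k is j.+1 then nth (0 : int) s j.+1 < nth (0 : int) s j else head 0 s < 0.

(** The Coxeter length of type B: the inversions [i < j, s_i > s_j], the pairs
[i < j] with [s_i + s_j < 0], and the negative entries. *)
Fixpoint invs (s : seq int) : nat :=
  if s is x :: t then
    (count (fun y => (y < x)%R) t + count (fun y => (x + y < 0)%R) t
     + (x < 0)%R + invs t)%N
  else 0%N.

(** The one-line notations of the elements of [W_n]. *)
Definition signed_word (n : nat) (s : seq int) : bool :=
  perm_eq [seq absz x | x <- s] (iota 1 n).

Lemma size_swp T k (s : seq T) : size (swp k s) = size s.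
Proof. by elim: k s => [|k IH] [|x [|y t]] //=; rewrite IH. Qed.

Lemma size_act k s : size (act k s) = size s.
Proof. by case: k => [|k] /=; [case: s | rewrite size_swp]. Qed.

Lemma swpK T k : involutive (@swp T k).
Proof. by elim: k => [|k IH] [|x [|y t]] //=; rewrite ?IH //; rewrite -[in RHS](IH (y :: t)). Qed.

Lemma actK k : involutive (act k).
Proof. by case: k => [|k] s /=; [case: s => //= x t; rewrite opprK | rewrite swpK]. Qed.

Lemma perm_swp (T : eqType) k (s : seq T) : perm_eq (swp k s) s.
Proof.
elim: k s => [|k IH] [|x t] //=; last by rewrite perm_cons.
by case: t => // y t; rewrite (perm_catCA [:: y] [:: x] t).
Qed.

Lemma map_swp (T U : Type) (f : T -> U) k s : map f (swp k s) = swp k (map f s).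
Proof. by elim: k s => [|k IH] [|x [|y t]] //=; rewrite IH. Qed.

Lemma nth_swp T (x0 : T) k s j : (k.+1 < size s)%N ->
  nth x0 (swp k s) j =
  if j == k then nth x0 s k.+1 else if j == k.+1 then nth x0 s k else nth x0 s j.
Proof.
elim: k s j => [|k IH] [|x [|y t]] [|[|j]] //= h.
- by rewrite (IH (y :: t) 0%N).
- by rewrite (IH (y :: t) j.+1).
Qed.

Lemma swpC T j k (s : seq T) : (j.+1 < k)%N -> swp j (swp k s) = swp k (swp j s).
Proof.
elim: j k s => [|j IH] [|k] // [|x t] //= h; last by rewrite IH.
by case: k t h => [|k] // [|y t].
Qed.

Lemma swp_braid T k (s : seq T) : (k.+2 < size s)%N ->
  swp k (swp k.+1 (swp k s)) = swp k.+1 (swp k (swp k.+1 s)).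
Proof.
elim: k s => [|k IH] [|x [|y [|z t]]] //= h.
by have /= -> := IH [:: y, z & t] h.
Qed.

Lemma signed_size n s : signed_word n s -> size s = n.
Proof. by move/perm_size; rewrite size_map size_iota. Qed.

Lemma signed_act n k s : signed_word n s -> signed_word n (act k s).
Proof.
rewrite /signed_word; apply: perm_trans; case: k => [|k] /=.
  by case: s => //= x t; rewrite abszN.
by rewrite map_swp perm_swp.
Qed.

Lemma signed_foldr n (a : seq nat) s :
  signed_word n s -> signed_word n (foldr act s a).
Proof. by move=> h; elim: a => //= k a IH; apply: signed_act. Qed.

Lemma invs_swp k s : (k.+1 < size s)%N -> nth (0 : int) s k != nth (0 : int) s k.+1 ->
  (invs (swp k s) + des k.+1 s = invs s + ~~ des k.+1 s)%N.
Proof.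
elim: k s => [|k IH] [|x [|y t]] //=.
  move=> _ ne.
  have -> : (y + x < 0) = (x + y < 0) by rewrite addrC.
  by have := lt_total ne; case: ltgtP => //= _ _; lia.
move=> h ne; have /= := IH (y :: t) h ne.
have /seq.permP pe := perm_swp k (y :: t).
rewrite !pe /=; lia.
Qed.

Lemma signed_neq n s i j : signed_word n s -> (i < n)%N -> (j < n)%N -> i != j ->
  absz (nth (0 : int) s i) != absz (nth (0 : int) s j).
Proof.
move=> h hi hj ne; have sz := signed_size h.
rewrite -!(nth_map (0 : int) 0%N) ?sz // nth_uniq ?size_map ?sz //.
by rewrite (perm_uniq h) iota_uniq.
Qed.

Lemma signed_neq0 n s i : signed_word n s -> (i < n)%N -> nth (0 : int) s i != 0.
Proof.
move=> h hi; have sz := signed_size h.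
rewrite -absz_eq0 -(nth_map (0 : int) 0%N absz) ?sz //.
have: nth 0%N [seq absz x | x <- s] i \in [seq absz x | x <- s].
  by rewrite mem_nth // size_map sz.
by rewrite (perm_mem h) mem_iota; case: eqP => // ->.
Qed.

Lemma invs_act n k s : signed_word n s -> (k < n)%N ->
  (invs (act k s) + des k s = invs s + ~~ des k s)%N.
Proof.
move=> h kn; case: k kn => [|k] kn.
  have := signed_neq0 h kn; case: s h => [|x t] //= _ x0.
  have -> : count (fun y => y < - x) t = count (fun y => x + y < 0) t.
    by apply: eq_count => y; rewrite ltrNr -subr_gt0 -oppr_lt0; congr (_ < 0); lia.
  have -> : count (fun y => - x + y < 0) t = count (fun y => y < x) t.
    by apply: eq_count => y; rewrite addrC subr_lt0.
  by rewrite oppr_lt0; case: ltgtP x0 => //= _ _; lia.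
apply: invs_swp; first by rewrite (signed_size h).
have ne : k != k.+1 by rewrite neq_ltn ltnSn.
by apply: contraNneq (signed_neq h (ltnW kn) kn ne) => ->.
Qed.

Lemma des_act n k s : signed_word n s -> (k < n)%N -> des k (act k s) = ~~ des k s.
Proof.
move=> h kn; have := invs_act h kn.
have := invs_act (signed_act k h) kn; rewrite actK.
by case: (des k s); case: (des k _) => //=; lia.
Qed.

Lemma invs_des n k s : signed_word n s -> (k < n)%N -> des k s ->
  invs s = (invs (act k s)).+1.
Proof. by move=> h kn d; have := invs_act h kn; rewrite d /=; lia. Qed.

Lemma invs_ndes n k s : signed_word n s -> (k < n)%N -> ~~ des k s ->
  invs (act k s) = (invs s).+1.
Proof. by move=> h kn d; have := invs_act h kn; rewrite d (negPf d) /=; lia. Qed.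

(** The one-line notation of the identity. *)
Definition idarr (n : nat) : seq int := [seq Posz k | k <- iota 1 n].

Lemma signed_id n : signed_word n (idarr n).
Proof. by rewrite /signed_word /idarr -map_comp map_id_in. Qed.

Lemma size_idarr n : size (idarr n) = n.
Proof. by rewrite size_map size_iota. Qed.

Lemma invs_id n : invs (idarr n) = 0%N.
Proof.
rewrite /idarr; elim: n 1%N => [|n IH] m //=.
rewrite IH !(@eq_in_count _ _ pred0) ?count_pred0 // => y /mapP[k];
  by rewrite mem_iota => hk -> /=; lia.
Qed.

Lemma ndes_id n s : signed_word n s ->
  (forall k, (k < n)%N -> ~~ des k s) -> s = idarr n.
Proof.
move=> h nd; have sz := signed_size h.
have step i : (i.+1 < n)%N -> nth (0 : int) s i < nth (0 : int) s i.+1.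
  move=> hi; have /= := nd i.+1 hi.
  have ne : i != i.+1 by rewrite neq_ltn ltnSn.
  have /eqP := signed_neq h (ltnW hi) hi ne. lia.
have pos i : (i < n)%N -> 0 < nth (0 : int) s i.
  elim: i => [|i IH] hi; last by apply: lt_trans (IH (ltnW hi)) (step _ hi).
  have /= := nd 0%N hi; have := signed_neq0 h hi.
  by case: (s) => //= x t; lia.
have sabs : s = [seq Posz k | k <- [seq absz x | x <- s]].
  rewrite -map_comp -[LHS]map_id; apply/eq_in_map => x /(nthP (0 : int))[i hi <-] /=.
  by have := pos i; rewrite -sz => /(_ hi); lia.
rewrite sabs; congr (map Posz _).
apply: (@irr_sorted_eq _ ltn ltn_trans ltnn); first last.
- exact: perm_mem h.
- exact: iota_ltn_sorted.
apply/(sortedP 0%N) => i; rewrite size_map sz => hi.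
rewrite !(nth_map (0 : int)) ?sz ?(ltnW hi) //=.
by have := step i hi; have := pos i (ltnW hi); lia.
Qed.

Lemma signed_word_exists n s : signed_word n s ->
  exists a, [/\ all (ltn^~ n) a, foldr act (idarr n) a = s & size a = invs s].
Proof.
have [k] := ubnP (invs s); elim: k s => // k IH s hk h.
have [/existsP[i d]|/existsPn nd] := boolP [exists i : 'I_n, des i s].
  have e := invs_des h (ltn_ord i) d.
  have [|a [al ea sz]] := IH (act i s) _ (signed_act i h); first by lia.
  by exists (val i :: a); rewrite /= ltn_ord ea actK sz e.
exists [::]; rewrite -(ndes_id h) ?invs_id; last first.
  by move=> i hi; have := nd (Ordinal hi).
by split=> //; rewrite (ndes_id h) ?invs_id // => i hi; have := nd (Ordinal hi).
Qed.

(** * Reduced words and the word property *)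

(** The one-line notation of the inverse of the product of a word in the generators. *)
Definition arr_of (n : nat) (a : seq nat) : seq int := foldr act (idarr n) a.

Definition letters (n : nat) (a : seq nat) : bool := all (ltn^~ n) a.

(** Reducedness, by the length function; words of minimal size have this property by
[reduced_redword]. *)
Definition redword (n : nat) (a : seq nat) : bool :=
  letters n a && (size a == invs (arr_of n a)).

Lemma signed_arr n a : signed_word n (arr_of n a).
Proof. exact/signed_foldr/signed_id. Qed.

Lemma invs_foldr_le n (s : seq int) a : signed_word n s -> letters n a ->
  (invs (foldr act s a) <= size a + invs s)%N.
Proof.
move=> h; elim: a => //= k a IH /andP[kn /IH le].
have := invs_act (signed_foldr a h) kn; case: (des k _) => /=; lia.
Qed.

Lemma invs_arr_le n a : letters n a -> (invs (arr_of n a) <= size a)%N.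
Proof. by move=> /(invs_foldr_le (signed_id n)); rewrite invs_id addn0. Qed.

(** A reduced word grows to the left exactly by the letters that are not descents. *)
Lemma redword_cons n k a : redword n (k :: a) =
  [&& (k < n)%N, redword n a & ~~ des k (arr_of n a)].
Proof.
rewrite /redword /=; case: ltnP => //= kn.
case al : (letters n a) => //=.
have := invs_act (signed_arr n a) kn; have := invs_arr_le al.
rewrite -/(arr_of n a); case: (des k _) => /=; lia.
Qed.

(** Following the letters of [p] from [s], each step goes down in length. *)
Fixpoint downs (p : seq nat) (s : seq int) : bool :=
  if p is k :: p' then des k s && downs p' (act k s) else true.

Lemma downs_invs n p s : signed_word n s -> letters n p -> downs p s ->
  invs s = (size p + invs (foldl (fun s k => act k s) s p))%N.
Proof.
elim: p s => //= k p IH s h /andP[kn pn] /andP[d dp].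
by rewrite (invs_des h kn d) (IH _ (signed_act k h)).
Qed.

Lemma signed_foldl n p s : signed_word n s ->
  signed_word n (foldl (fun s k => act k s) s p).
Proof. by elim: p s => //= k p IH s h; apply/IH/signed_act. Qed.

Lemma foldr_foldl_act p s : foldr act (foldl (fun s k => act k s) s p) p = s.
Proof. by elim: p s => //= k p IH s; rewrite IH actK. Qed.

Section Matsumoto.
Variables (T : Type) (n : nat) (op : nat -> T -> T).
Hypothesis op_comm : forall i j t, (i.+1 < j)%N -> (j < n)%N ->
  op i (op j t) = op j (op i t).
Hypothesis op_braid3 : forall i t, (0 < i)%N -> (i.+1 < n)%N ->
  op i (op i.+1 (op i t)) = op i.+1 (op i (op i.+1 t)).
Hypothesis op_braid4 : forall t, (1 < n)%N ->
  op 0 (op 1 (op 0 (op 1 t))) = op 1 (op 0 (op 1 (op 0 t))).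

(** The word property: operators satisfying the braid relations of type B take the
same value on reduced words of the same element.  If the first letters [i] and
[j] differ, both are descents, hence so is the whole braid on [i] and [j], and
the two words are compared with words beginning with the two sides of it. *)
Theorem matsumoto a b t : redword n a -> redword n b ->
  arr_of n a = arr_of n b -> foldr op t a = foldr op t b.
Proof.
have [m] := ubnP (size a); elim: m a b t => // m IH a b t ma ra rb eab.
have eqsz : size a = size b.
  by move: ra rb; rewrite /redword eab => /andP[_ /eqP->] /andP[_ /eqP->].
case: a b ma ra rb eab eqsz => [|i a] [|j b] // ma ra rb eab [eqsz].
have am : (size a < m)%N by rewrite -ltnS.
have bm : (size b < m)%N by rewrite -eqsz.
wlog ij : i j a b ma ra rb eab eqsz am bm / (i <= j)%N.
  move=> wl; case: (leqP i j) => [|/ltnW] h; first exact: wl.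
  by symmetry; apply: wl => //; rewrite -?eqsz.
move: (ra) (rb); rewrite !redword_cons => /and3P[iN ra' nda] /and3P[jN rb' ndb].
move: ij; rewrite leq_eqVlt => /orP[/eqP e|ij].
  subst j; rewrite /= (IH a b) //; apply: (can_inj (actK i)); exact: eab.
set s := arr_of n (i :: a); have hs : signed_word n s := signed_arr _ _.
have di : des i s by rewrite (des_act (signed_arr n a) iN).
have dj : des j s by rewrite /s eab (des_act (signed_arr n b) jN).
(* p and q complete i and j to the two sides of the braid *)
have key p q : letters n p -> letters n q -> size p = size q ->
    downs (i :: p) s ->
    foldl (fun s k => act k s) s (i :: p) = foldl (fun s k => act k s) s (j :: q) ->
    (forall t, foldr op t (i :: p) = foldr op t (j :: q)) ->
    foldr op t (i :: a) = foldr op t (j :: b).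
  move=> pn qn szpq dp eu eop.
  set u := foldl _ s (i :: p) in eu.
  have hu : signed_word n u.
    exact: signed_foldl.
  have [c [cl ec szc]] := signed_word_exists hu.
  have szs : size (i :: a) = (size (i :: p) + size c)%N.
    rewrite szc -(downs_invs hs) //=; last by rewrite /letters /= iN.
    by case/andP: ra => _ /eqP.
  have e1 : arr_of n ((i :: p) ++ c) = s.
    by rewrite /arr_of foldr_cat ec foldr_foldl_act.
  have e2 : arr_of n ((j :: q) ++ c) = s.
    by rewrite /arr_of foldr_cat ec eu foldr_foldl_act.
  have r1 : redword n (i :: (p ++ c)).
    apply/andP; split; first by rewrite /letters /= all_cat iN [all _ p]pn [all _ c]cl.
    rewrite -cat_cons e1 size_cat -szs; by case/andP: ra.
  have r2 : redword n (j :: (q ++ c)).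
    apply/andP; split; first by rewrite /letters /= all_cat jN [all _ q]qn [all _ c]cl.
    rewrite -cat_cons e2 size_cat /= -szpq -[_.+1]/(size (i :: p)) -szs.
    by case/andP: ra.
  move: (r1) (r2); rewrite !redword_cons => /and3P[_ r1' _] /and3P[_ r2' _].
  have -> : foldr op t (i :: a) = foldr op t ((i :: p) ++ c).
    rewrite /=; congr op; apply: IH => //; apply: (can_inj (actK i)); exact/esym/e1.
  have -> : foldr op t (j :: b) = foldr op t ((j :: q) ++ c).
    rewrite /=; congr op; apply: IH => //; apply: (can_inj (actK j)).
    by rewrite -[LHS]/(arr_of n (j :: b)) -eab -/s -e2.
  by rewrite !foldr_cat eop.
have sz := signed_size hs; clearbody s.
move: ij; rewrite leq_eqVlt => /orP[/eqP e|ij].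
  subst j; case: (posnP i) => [i0|i0].
    subst i; apply: (key [:: 1; 0; 1]%N [:: 0; 1; 0]%N) => //=.
    - by rewrite /letters /= iN jN.
    - by rewrite /letters /= iN jN.
    - clear -di dj sz jN; case: s sz di dj => [|x [|y r]] /=; lia.
    - by clear -sz jN; case: s sz => [|x [|y r]] //=; lia.
    - by move=> u; apply: op_braid4.
  apply: (key [:: i.+1; i]%N [:: i; i.+1]%N) => //=.
  - by rewrite /letters /= iN jN.
  - by rewrite /letters /= iN jN.
  - rewrite di /=; case: i i0 iN jN di dj {key ra eab nda ndb ma rb} sz => //= k _ iN jN di dj sz.
    have z1 : (k.+1 < size s)%N by lia.
    have z2 : (k.+2 < size s)%N by lia.
    rewrite -/(swp k.+1 (swp k s)) !nth_swp ?size_swp //.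
    by do ! (case: eqP => /=; try lia).
  - case: i i0 iN jN {key ra eab nda ndb ma rb di dj} => //= k _ iN jN.
    by rewrite swp_braid // sz.
  - by move=> u; apply: op_braid3.
apply: (key [:: j] [:: i]) => //=.
- by rewrite /letters /= jN.
- by rewrite /letters /= iN.
- rewrite di /= andbT; case: j jN ij dj {key rb eab ndb} => //= j jN ij dj.
  case: i iN ij di {ra ma nda} => [|i] iN ij di /=.
    by case: (s) di dj => [|z r] /=; case: (j) ij => // l _; lia.
  have z1 : (i.+1 < size s)%N by lia.
  by rewrite !nth_swp //; do ! (case: eqP => /=; try lia).
- case: j jN ij {key rb eab ndb dj} => //= j jN ij.
  case: i iN ij di {ra ma nda} => [|i] iN ij di /=.
    by case: (s) => [|z r]; case: (j) ij.
  by rewrite [RHS]swpC.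
- by move=> u; apply: op_comm.
Qed.
End Matsumoto.

(** * Abstract divided differences of type B *)

(** The simple roots, for variables numbered from 0. *)
Definition root_of (P : nzRingType) (x : nat -> P) (k : nat) : P :=
  if k is j.+1 then x j - x j.+1 else x 0%N.

(** Divided differences of type B on the first [n] of the elements [x 0, x 1, ...] of
a domain: [s] are the generators of [W_n] acting by ring morphisms, [d] the
operators [f |-> (f - s f) / root]. *)
Record divdiff_system (P : idomainType) (n : nat) (x : nat -> P)
    (s : nat -> {rmorphism P -> P}) (d : nat -> P -> P) : Prop := DivdiffSystem {
  ds_dE : forall k f, (k < n)%N -> d k f * root_of x k = f - s k f;
  ds_root : forall k, (k < n)%N -> root_of x k != 0;
  ds_sK : forall k f, (k < n)%N -> s k (s k f) = f;
  ds_s0 : s 0%N (x 0%N) = - x 0%N;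
  ds_sl : forall k, (k.+1 < n)%N -> s k.+1 (x k) = x k.+1;
  ds_sr : forall k, (k.+1 < n)%N -> s k.+1 (x k.+1) = x k;
  ds_sx : forall k j, (k < n)%N -> (j < n)%N -> j != k -> j.+1 != k -> s k (x j) = x j;
  ds_sC : forall i j f, (i.+1 < j)%N -> (j < n)%N -> s i (s j f) = s j (s i f);
  ds_s3 : forall i f, (0 < i)%N -> (i.+1 < n)%N ->
    s i (s i.+1 (s i f)) = s i.+1 (s i (s i.+1 f));
  ds_s4 : forall f, (1 < n)%N ->
    s 0%N (s 1%N (s 0%N (s 1%N f))) = s 1%N (s 0%N (s 1%N (s 0%N f)))
}.

Section Divdiff.
Variables (P : idomainType) (n : nat) (x : nat -> P).
Variables (s : nat -> {rmorphism P -> P}) (d : nat -> P -> P).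
Hypothesis ds : divdiff_system n x s d.
Local Notation root := (root_of x).

(** Divided differences are determined by their defining equation. *)
Lemma d_uniq k f g : (k < n)%N -> g * root k = f - s k f -> d k f = g.
Proof. by move=> kn; rewrite -(ds_dE ds) // => /(mulIf (ds_root ds kn)). Qed.

Lemma dD k f g : (k < n)%N -> d k (f + g) = d k f + d k g.
Proof.
by move=> kn; apply: d_uniq => //; rewrite mulrDl !(ds_dE ds) // rmorphD; ring.
Qed.

Lemma dN k f : (k < n)%N -> d k (- f) = - d k f.
Proof.
by move=> kn; apply: d_uniq => //; rewrite mulNr !(ds_dE ds) // rmorphN; ring.
Qed.

(** The twisted Leibniz rule. *)
Lemma dM k f g : (k < n)%N -> d k (f * g) = d k f * g + s k f * d k g.
Proof.
move=> kn; apply: d_uniq => //.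
by rewrite mulrDl mulrAC -[X in _ + X]mulrA !(ds_dE ds) // rmorphM; ring.
Qed.

Lemma d_const k f : (k < n)%N -> s k f = f -> d k f = 0.
Proof. by move=> kn e; apply: d_uniq; rewrite // e mul0r subrr. Qed.

Lemma d0 k : (k < n)%N -> d k 0 = 0.
Proof. by move=> kn; apply: d_const; rewrite ?rmorph0. Qed.

Lemma dZ k c f : (k < n)%N -> s k c = c -> d k (c * f) = c * d k f.
Proof. by move=> kn e; rewrite dM // e d_const // mul0r add0r. Qed.

Lemma dC i j f : (i.+1 < j)%N -> (j < n)%N -> d i (d j f) = d j (d i f).
Proof.
move=> ij jn; have iN : (i < n)%N by lia.
have sjr : s j (root i) = root i.
  case: i ij iN => [|i] /= ij iN; first by rewrite (ds_sx ds) //; lia.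
  by rewrite rmorphB !(ds_sx ds) //; lia.
have sir : s i (root j) = root j.
  by case: j ij jn {sjr} => //= j ij jn; rewrite rmorphB !(ds_sx ds) //; lia.
apply: d_uniq => //; apply: (mulIf (ds_root ds jn)).
have e1 : d i f * root i = f - s i f by apply: ds_dE ds _ _ _.
have e2 : d j (d i f) * root j = d i f - s j (d i f) by apply: ds_dE ds _ _ _.
have e3 : s j (d i f) * root i = s j f - s j (s i f).
  by rewrite -[in LHS]sjr -rmorphM e1 rmorphB.
have e4 : d j f * root j = f - s j f by apply: ds_dE ds _ _ _.
have e5 : s i (d j f) * root j = s i f - s j (s i f).
  by rewrite -[in LHS]sir -rmorphM e4 rmorphB -(ds_sC ds).
rewrite mulrAC e2 mulrBl e1 e3 mulrBl e4 e5; ring.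
Qed.

(** Both sides, multiplied by the three roots involved, are the alternating sum of
[f] over the dihedral group of order 6. *)
Lemma d_braid3 i f : (0 < i)%N -> (i.+1 < n)%N ->
  d i (d i.+1 (d i f)) = d i.+1 (d i (d i.+1 f)).
Proof.
case: i => // i _ iN; have iN' : (i.+1 < n)%N by lia.
set k := i.+1; set l := k.+1.
pose a := x i; pose b := x i.+1; pose c := x i.+2.
have ka : s k a = b by apply: ds_sl ds _ _.
have kb : s k b = a by apply: ds_sr ds _ _.
have kc : s k c = c by rewrite (ds_sx ds) //; lia.
have la : s l a = a by rewrite (ds_sx ds) //; lia.
have lb : s l b = c by apply: ds_sl ds _ _.
have lc : s l c = b by apply: ds_sr ds _ _.
have dk g : d k g * (a - b) = g - s k g by rewrite -(ds_dE ds).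
have dl g : d l g * (b - c) = g - s l g by rewrite -(ds_dE ds).
have ab : a - b != 0 by exact: (ds_root ds iN').
have bc : b - c != 0 by exact: (ds_root ds iN).
have ac : a - c != 0.
  apply: contra_neq ab => ac0.
  by rewrite -(ds_sK ds (a - b) iN) -/l rmorphB la lb ac0 rmorph0.
have H1 : d k (d l (d k f)) * ((a - b) * (b - c) * (a - c))
    = f - s k f - s l f + s k (s l f) + s l (s k f) - s k (s l (s k f)).
  apply: (mulIf ab).
  have e1 := dk f.
  have e2 : s l (d k f) * (a - c) = s l f - s l (s k f).
    by rewrite -[in X in _ * X]la -lb -!rmorphB -rmorphM e1.
  have e3 : d l (d k f) * ((a - b) * (b - c) * (a - c))
      = (f - s k f) * (a - c) - (a - b) * (s l f - s l (s k f)).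
    by rewrite -e1 -e2; rewrite [LHS](_ : _ = d l (d k f) * (b - c) * ((a - b) * (a - c))); [rewrite dl|]; ring.
  have e4 : s k (d l (d k f)) * ((b - a) * (a - c) * (b - c))
      = (s k f - f) * (b - c) - (b - a) * (s k (s l f) - s k (s l (s k f))).
    have := congr1 (s k) e3; rewrite !(rmorphM, rmorphB) ka kb kc => ->.
    by rewrite (ds_sK ds).
  rewrite [LHS](_ : _ = d k (d l (d k f)) * (a - b) * ((a - b) * (b - c) * (a - c))); last by ring.
  rewrite dk mulrBl e3.
  rewrite [X in _ - X = _](_ : _ = - (s k (d l (d k f)) * ((b - a) * (a - c) * (b - c)))); last by ring.
  by rewrite e4; ring.
have H2 : d l (d k (d l f)) * ((a - b) * (b - c) * (a - c))
    = f - s k f - s l f + s k (s l f) + s l (s k f) - s l (s k (s l f)).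
  apply: (mulIf bc).
  have e1 := dl f.
  have e2 : s k (d l f) * (a - c) = s k f - s k (s l f).
    by rewrite -[in X in _ * X]kc -kb -!rmorphB -rmorphM e1.
  have e3 : d k (d l f) * ((a - b) * (b - c) * (a - c))
      = (f - s l f) * (a - c) - (b - c) * (s k f - s k (s l f)).
    by rewrite -e1 -e2; rewrite [LHS](_ : _ = d k (d l f) * (a - b) * ((b - c) * (a - c))); [rewrite dk|]; ring.
  have e4 : s l (d k (d l f)) * ((a - c) * (c - b) * (a - b))
      = (s l f - f) * (a - b) - (c - b) * (s l (s k f) - s l (s k (s l f))).
    have := congr1 (s l) e3; rewrite !(rmorphM, rmorphB) la lb lc => ->.
    by rewrite (ds_sK ds).
  rewrite [LHS](_ : _ = d l (d k (d l f)) * (b - c) * ((a - b) * (b - c) * (a - c))); last by ring.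
  rewrite dl mulrBl e3.
  rewrite [X in _ - X = _](_ : _ = - (s l (d k (d l f)) * ((a - c) * (c - b) * (a - b)))); last by ring.
  by rewrite e4; ring.
apply: (mulIf (mulf_neq0 (mulf_neq0 ab bc) ac)).
by rewrite H1 H2 (ds_s3 ds).
Qed.

(** Both sides, multiplied by the four roots involved, are the same signed sum of
[f] over the dihedral group of order 8. *)
Lemma d_braid4 f : (1 < n)%N ->
  d 0%N (d 1%N (d 0%N (d 1%N f))) = d 1%N (d 0%N (d 1%N (d 0%N f))).
Proof.
move=> n1; have n0 : (0 < n)%N by lia.
pose a := x 0%N; pose b := x 1%N.
have ma : s 0%N a = - a by apply: ds_s0 ds.
have mb : s 0%N b = b by rewrite (ds_sx ds).
have pa : s 1%N a = b by apply: ds_sl ds _ _.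
have pb : s 1%N b = a by apply: ds_sr ds _ _.
have dm g : d 0%N g * a = g - s 0%N g by rewrite -(ds_dE ds).
have dp g : d 1%N g * (a - b) = g - s 1%N g by rewrite -(ds_dE ds).
have a0 : a != 0 by exact: (ds_root ds n0).
have ab : a - b != 0 by exact: (ds_root ds n1).
have b0 : b != 0.
  by apply: contra_neq a0 => b0; rewrite -pb b0 rmorph0.
have apb : a + b != 0.
  apply: contra_neq ab => ab0.
  by rewrite -(ds_sK ds (a - b) n0) rmorphB ma mb -opprD ab0 oppr0 rmorph0.
have s0K g : s 0%N (s 0%N g) = g by apply: ds_sK ds _ _ _.
have s1K g : s 1%N (s 1%N g) = g by apply: ds_sK ds _ _ _.
set p := s 1%N in pa pb dp s1K *; set m := s 0%N in ma mb dm s0K *.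
have H1 : d 0%N (d 1%N (d 0%N (d 1%N f))) * (a * b * (a - b) * (a + b))
  = - f + p f + m f - m (p f) - p (m f) + p (m (p f)) + m (p (m f)) - m (p (m (p f))).
  have e1 := dp f; set g1 := d 1%N f in e1 *.
  have e1' : m g1 * (- a - b) = m f - m (p f) by rewrite -ma -mb -rmorphB -rmorphM e1 rmorphB.
  have e2 := dm g1; set g2 := d 0%N g1 in e2 *.
  have e2a : g2 * (a * (a - b) * (a + b)) = (f - p f) * (a + b) + (a - b) * (m f - m (p f)).
    rewrite [LHS](_ : _ = g2 * a * ((a - b) * (a + b))); last by ring.
    by rewrite e2 -e1 -e1'; ring.
  have e2' : p g2 * (b * (b - a) * (b + a)) = (p f - f) * (b + a) + (b - a) * (p (m f) - p (m (p f))).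
    by have := congr1 p e2a; rewrite !(rmorphM, rmorphB, rmorphD, rmorphN) pa pb s1K.
  have e3 := dp g2; set g3 := d 1%N g2 in e3 *.
  have e3a : g3 * (a * b * (a - b) * (a + b)) =
      - (f - p f) * (a + b) + b * (m f - m (p f)) - a * (p (m f) - p (m (p f))).
    apply: (mulIf ab).
    rewrite [LHS](_ : _ = g3 * (a - b) * (a * b * (a - b) * (a + b))); last by ring.
    rewrite e3 [LHS](_ : _ = g2 * (a * (a - b) * (a + b)) * b
      + p g2 * (b * (b - a) * (b + a)) * a); last by ring.
    by rewrite e2a e2'; ring.
  have e3' : m g3 * (- a * b * (- a - b) * (- a + b)) =
      - (m f - m (p f)) * (- a + b) + b * (f - p f) + a * (m (p (m f)) - m (p (m (p f)))).
    have := congr1 m e3a; rewrite !(rmorphM, rmorphB, rmorphD, rmorphN) ma mb !s0K => ->.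
    by ring.
  have e4 := dm g3; set g4 := d 0%N g3 in e4 *.
  apply: (mulIf a0).
  rewrite [LHS](_ : _ = g4 * a * (a * b * (a - b) * (a + b))); last by ring.
  rewrite e4 [LHS](_ : _ = g3 * (a * b * (a - b) * (a + b))
     + m g3 * (- a * b * (- a - b) * (- a + b))); last by ring.
  by rewrite e3a e3'; ring.
have H2 : d 1%N (d 0%N (d 1%N (d 0%N f))) * (a * b * (a - b) * (a + b))
  = - f + p f + m f - m (p f) - p (m f) + p (m (p f)) + m (p (m f)) - p (m (p (m f))).
  have e1 := dm f; set g1 := d 0%N f in e1 *.
  have e1' : p g1 * b = p f - p (m f) by rewrite -pa -rmorphM e1 rmorphB.
  have e2 := dp g1; set g2 := d 1%N g1 in e2 *.
  have e2a : g2 * (a * b * (a - b)) = b * (f - m f) - a * (p f - p (m f)).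
    rewrite [LHS](_ : _ = g2 * (a - b) * (a * b)); last by ring.
    by rewrite e2 -e1 -e1'; ring.
  have e2' : m g2 * (- a * b * (- a - b)) = b * (m f - f) + a * (m (p f) - m (p (m f))).
    have := congr1 m e2a; rewrite !(rmorphM, rmorphB, rmorphD, rmorphN) ma mb !s0K => ->.
    by ring.
  have e3 := dm g2; set g3 := d 0%N g2 in e3 *.
  have e3a : g3 * (a * b * (a - b) * (a + b)) =
      2%:R * b * (f - m f) - (a + b) * (p f - p (m f)) - (a - b) * (m (p f) - m (p (m f))).
    apply: (mulIf a0).
    rewrite [LHS](_ : _ = g3 * a * (a * b * (a - b) * (a + b))); last by ring.
    rewrite e3 [LHS](_ : _ = g2 * (a * b * (a - b)) * (a + b)
      - m g2 * (- a * b * (- a - b)) * (a - b)); last by ring.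
    by rewrite e2a e2'; ring.
  have e3' : p g3 * (b * a * (b - a) * (b + a)) =
      2%:R * a * (p f - p (m f)) - (b + a) * (f - m f) - (b - a) * (p (m (p f)) - p (m (p (m f)))).
    have := congr1 p e3a; rewrite !(rmorphM, rmorphB, rmorphD, rmorphN, rmorph_nat) pa pb !s1K => ->.
    by ring.
  have e4 := dp g3; set g4 := d 1%N g3 in e4 *.
  apply: (mulIf ab).
  rewrite [LHS](_ : _ = g4 * (a - b) * (a * b * (a - b) * (a + b))); last by ring.
  rewrite e4 [LHS](_ : _ = g3 * (a * b * (a - b) * (a + b))
     + p g3 * (b * a * (b - a) * (b + a))); last by ring.
  by rewrite e3a e3'; ring.
apply: (mulIf (mulf_neq0 (mulf_neq0 (mulf_neq0 a0 b0) ab) apb)).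
by rewrite H1 H2 /p /m (ds_s4 ds).
Qed.
End Divdiff.

(** * Degree bounds in each variable *)

Section Bounded.
Variables (P : idomainType) (n : nat) (x : nat -> P).
Variables (s : nat -> {rmorphism P -> P}) (d : nat -> P -> P).
Hypothesis ds : divdiff_system n x s d.
Local Notation root := (root_of x).

(** Invariance under the subgroup generated by the first [m] generators. *)
Definition fixed_upto (m : nat) (c : P) : Prop := forall k, (k < m)%N -> s k c = c.

(** The elements of degree at most [beta i] in each [x i], as the sums of monomials
satisfying these bounds, with coefficients invariant under the whole group. *)
Inductive bdeg (beta : nat -> nat) : P -> Prop :=
| Bdeg_mon c b : fixed_upto n c -> (forall i, (i < n)%N -> (b i <= beta i)%N) ->
    bdeg beta (c * \prod_(i < n) x i ^+ b i)
| Bdeg_add f g : bdeg beta f -> bdeg beta g -> bdeg beta (f + g).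

Lemma fixed_upto1 m : fixed_upto m 1. Proof. by move=> k _; rewrite rmorph1. Qed.
Lemma fixed_upto0 m : fixed_upto m 0. Proof. by move=> k _; rewrite rmorph0. Qed.
Lemma fixed_uptoN m c : fixed_upto m c -> fixed_upto m (- c).
Proof. by move=> h k km; rewrite rmorphN h. Qed.
Lemma fixed_uptoM m c c' : fixed_upto m c -> fixed_upto m c' -> fixed_upto m (c * c').
Proof. by move=> h h' k km; rewrite rmorphM h // h'. Qed.
Lemma fixed_uptoX m c r : fixed_upto m c -> fixed_upto m (c ^+ r).
Proof. by move=> h k km; rewrite rmorphXn /= h. Qed.
Lemma fixed_upto_le m m' c : (m' <= m)%N -> fixed_upto m c -> fixed_upto m' c.
Proof. by move=> le h k km; apply: h; lia. Qed.

Lemma bdeg_const beta c : fixed_upto n c -> bdeg beta c.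
Proof.
move=> h; rewrite -[c]mulr1.
rewrite [X in _ * X](_ : 1 = \prod_(i < n) x i ^+ (fun=> 0%N) i).
  by apply: (Bdeg_mon (b := fun=> 0%N)).
by rewrite big1 // => i _; rewrite expr0.
Qed.

Lemma bdeg0 beta : bdeg beta 0.
Proof. exact/bdeg_const/fixed_upto0. Qed.

Lemma bdeg_sum beta (I : Type) (r : seq I) (Q : pred I) (F : I -> P) :
  (forall i, Q i -> bdeg beta (F i)) -> bdeg beta (\sum_(i <- r | Q i) F i).
Proof.
by move=> h; apply: (big_ind (bdeg beta)) => //; [apply: bdeg0 | apply: Bdeg_add].
Qed.

Lemma bdeg_le beta gamma f : (forall i, (i < n)%N -> (beta i <= gamma i)%N) ->
  bdeg beta f -> bdeg gamma f.
Proof.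
move=> le; elim=> [c b h hb|g h _ IHg _ IHh]; last exact: Bdeg_add.
by apply: Bdeg_mon => // i iN; apply: leq_trans (hb i iN) (le i iN).
Qed.

Lemma bdegM beta gamma f g : bdeg beta f -> bdeg gamma g ->
  bdeg (fun i => beta i + gamma i)%N (f * g).
Proof.
elim=> [c b h hb|u v _ IHu _ IHv] hg; last by rewrite mulrDl; apply: Bdeg_add; auto.
elim: hg => [c' b' h' hb'|u v _ IHu _ IHv]; last by rewrite mulrDr; apply: Bdeg_add.
rewrite mulrACA -big_split /=.
under eq_bigr do rewrite -exprD.
apply: (Bdeg_mon (b := fun i => (b i + b' i)%N)); first exact: fixed_uptoM.
by move=> i iN; apply: leq_add; auto.
Qed.

Lemma bdegN beta f : bdeg beta f -> bdeg beta (- f).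
Proof.
move=> h; rewrite -mulN1r; apply: (@bdeg_le (fun i => 0 + beta i)%N) => //.
by apply: bdegM => //; apply/bdeg_const/fixed_uptoN/fixed_upto1.
Qed.

Lemma bdegX beta f r : bdeg beta f -> bdeg (fun i => r * beta i)%N (f ^+ r).
Proof.
move=> h; elim: r => [|r IH]; first by rewrite expr0; apply/bdeg_const/fixed_upto1.
by rewrite exprS; apply: bdeg_le (bdegM h IH) => i _; rewrite mulSn.
Qed.

Lemma bdeg_x i : (i < n)%N -> bdeg (fun j => j == i) (x i).
Proof.
move=> iN; rewrite -[x i]mul1r.
rewrite [X in _ * X](_ : _ = \prod_(j < n) x j ^+ ((j : nat) == i)).
  by apply: (Bdeg_mon (b := fun j => j == i)) => // k _; rewrite rmorph1.
rewrite (bigD1 (Ordinal iN)) //= eqxx expr1 big1 ?mulr1 // => j.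
by rewrite -val_eqE /= => /negPf ->.
Qed.

Lemma bdeg_prod m (F : nat -> P) (B : nat -> nat -> nat) :
  (forall k, (k < m)%N -> bdeg (B k) (F k)) ->
  bdeg (fun i => \sum_(k < m) B k i)%N (\prod_(k < m) F k).
Proof.
elim: m => [|m IH] h; first by rewrite big_ord0; apply/bdeg_const/fixed_upto1.
rewrite big_ord_recr; apply: bdeg_le (bdegM (IH _) (h m _)) => //.
  by move=> i _; rewrite big_ord_recr.
by move=> k km; apply: h; lia.
Qed.

(** A monomial isolates the two variables exchanged by [s_(k+1)]. *)
Lemma mon_split c (b : nat -> nat) k : (k.+1 < n)%N -> fixed_upto n c ->
  exists M, [/\ c * \prod_(i < n) x i ^+ b i = M * (x k ^+ b k * x k.+1 ^+ b k.+1),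
    s k.+1 M = M &
    forall beta, (forall i, (i < n)%N -> (b i <= beta i)%N) ->
     bdeg (fun i => if (i == k) || (i == k.+1) then 0%N else beta i) M].
Proof.
move=> kN hc; have kN' : (k < n)%N by lia.
pose b' i := if (i == k) || (i == k.+1) then 0%N else b i.
exists (c * \prod_(i < n) x i ^+ b' i); split.
- rewrite -mulrA; congr (c * _).
  rewrite (bigD1 (Ordinal kN')) //= (bigD1 (Ordinal kN)) /=; last by rewrite -val_eqE /=; lia.
  rewrite [in RHS](bigD1 (Ordinal kN')) //= [in RHS](bigD1 (Ordinal kN)) /=; last by rewrite -val_eqE /=; lia.
  rewrite /b' !eqxx orbT !expr0 !mul1r mulrA mulrC; congr (_ * _).
  apply: eq_bigr => i /andP[]; rewrite -!val_eqE /= => h1 h2.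
  by rewrite (negPf h1) (negPf h2).
- rewrite rmorphM hc // rmorph_prod; congr (_ * _); apply: eq_bigr => i _.
  rewrite rmorphXn /b' /=; case: eqP => [_|i1] /=; first by rewrite !expr0.
  case: eqP => [_|i2] /=; first by rewrite !expr0.
  by rewrite (ds_sx ds) //; lia.
- by move=> beta hb; apply: (Bdeg_mon (b := b')) => // i iN; rewrite /b'; case: ifP => // _; apply: hb.
Qed.

(** A divided difference of [x_k^p x_(k+1)^q] has lower degree in both variables. *)
Lemma d_pow k p q : (k.+1 < n)%N -> forall B, (p <= B.+1)%N -> (q <= B.+1)%N ->
  bdeg (fun i => if (i == k) || (i == k.+1) then B else 0%N)
    (d k.+1 (x k ^+ p * x k.+1 ^+ q)).
Proof.
move=> kN B; have kN' : (k < n)%N by lia.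
have mon a b : (a <= B)%N -> (b <= B)%N ->
    bdeg (fun i => if (i == k) || (i == k.+1) then B else 0%N) (x k ^+ a * x k.+1 ^+ b).
  move=> ha hb; apply: bdeg_le (bdegM (bdegX a (bdeg_x kN')) (bdegX b (bdeg_x kN))).
  by move=> i _; do 2?case: eqP => /=; lia.
have skl := ds_sl ds kN; have skr := ds_sr ds kN.
have sumB r c : (r + c <= B.+1)%N -> bdeg (fun i => if (i == k) || (i == k.+1) then B else 0%N)
    ((x k ^+ c * x k.+1 ^+ c) * \sum_(i < r) x k ^+ (r.-1 - i) * x k.+1 ^+ i).
  move=> rc; rewrite big_distrr /=; apply: bdeg_sum => i _.
  rewrite mulrACA -!exprD; apply: mon; have := ltn_ord i; lia.
pose S r := \sum_(i < r) x k ^+ (r.-1 - i) * x k.+1 ^+ i.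
have powB r : x k ^+ r - x k.+1 ^+ r = (x k - x k.+1) * S r by rewrite subrXX.
have splt r c : (c <= r)%N -> (x k ^+ r = x k ^+ c * x k ^+ (r - c)) *
    (x k.+1 ^+ r = x k.+1 ^+ c * x k.+1 ^+ (r - c)).
  by move=> le; split; rewrite -exprD subnKC.
move=> hp hq; case: (leqP p q) => pq.
  have -> : d k.+1 (x k ^+ p * x k.+1 ^+ q) =
     - ((x k ^+ p * x k.+1 ^+ p) * S (q - p)%N).
    apply: (d_uniq ds) => //=.
    rewrite [LHS](_ : _ = - (x k ^+ p * x k.+1 ^+ p) * ((x k - x k.+1) * S (q - p)%N)); last by ring.
    by rewrite -powB rmorphM !rmorphXn /= skl skr !(splt q p) //; ring.
  by apply/bdegN/sumB; lia.
have -> : d k.+1 (x k ^+ p * x k.+1 ^+ q) =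
     (x k ^+ q * x k.+1 ^+ q) * S (p - q)%N.
  apply: (d_uniq ds) => //=.
  rewrite [LHS](_ : _ = (x k ^+ q * x k.+1 ^+ q) * ((x k - x k.+1) * S (p - q)%N)); last by ring.
  by rewrite -powB rmorphM !rmorphXn /= skl skr !(splt p q (ltnW pq)) //; ring.
by apply: sumB; lia.
Qed.

Lemma bdeg_d k beta f B : (k.+1 < n)%N -> bdeg beta f ->
  (beta k <= B.+1)%N -> (beta k.+1 <= B.+1)%N ->
  bdeg (fun i => if (i == k) || (i == k.+1) then B else beta i) (d k.+1 f).
Proof.
move=> kN h hk hk1; elim: h => [c b hc hb|g g' _ IH _ IH']; last first.
  by rewrite (dD ds) //; apply: Bdeg_add.
have [M [-> sM bM]] := mon_split b kN hc.
rewrite (dZ ds) //.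
apply: bdeg_le (bdegM (bM _ hb) (d_pow (B := B) kN _ _)).
- by move=> i _; case: ifP => // _; rewrite addn0.
- by apply: leq_trans (hb _ _) hk; lia.
- by apply: leq_trans (hb _ _) hk1.
Qed.

Lemma d_bdeg0 k beta f : (k.+1 < n)%N -> bdeg beta f ->
  beta k = 0%N -> beta k.+1 = 0%N -> d k.+1 f = 0.
Proof.
move=> kN h hk hk1; elim: h => [c b hc hb|g g' _ IH _ IH']; last first.
  by rewrite (dD ds) // IH IH' addr0.
have [M [-> sM bM]] := mon_split b kN hc.
have := hb k; rewrite hk leqn0 => /(_ ltac:(lia)) /eqP ->.
have := hb k.+1; rewrite hk1 leqn0 => /(_ kN) /eqP ->.
by rewrite !expr0 !mulr1 (d_const ds).
Qed.

Lemma bdeg_s k beta f : (k.+1 < n)%N -> bdeg beta f ->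
  bdeg (fun i => if i == k then beta k.+1 else if i == k.+1 then beta k else beta i) (s k.+1 f).
Proof.
move=> kN h; elim: h => [c b hc hb|g g' _ IH _ IH']; last first.
  by rewrite rmorphD; apply: Bdeg_add.
have kN' : (k < n)%N by lia.
have [M [-> sM bM]] := mon_split b kN hc.
rewrite !rmorphM !rmorphXn /= sM (ds_sl ds) // (ds_sr ds) //.
apply: bdeg_le (bdegM (bM _ hb) (bdegM (bdegX (b k) (bdeg_x kN)) (bdegX (b k.+1) (bdeg_x kN')))).
have := hb k kN'; have := hb _ kN => h1 h2 i _; do 2?case: eqP => /=; lia.
Qed.

(** A monomial isolates the variable negated by [s_0]. *)
Lemma mon_split0 c (b : nat -> nat) : (0 < n)%N -> fixed_upto n c ->
  exists M, [/\ c * \prod_(i < n) x i ^+ b i = M * x 0%N ^+ b 0%N,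
    s 0%N M = M &
    forall beta, (forall i, (i < n)%N -> (b i <= beta i)%N) ->
     bdeg (fun i => if i == 0%N then 0%N else beta i) M].
Proof.
move=> n0 hc.
pose b' i := if i == 0%N then 0%N else b i.
exists (c * \prod_(i < n) x i ^+ b' i); split.
- rewrite -mulrA; congr (c * _).
  rewrite (bigD1 (Ordinal n0)) //= [in RHS](bigD1 (Ordinal n0)) //=.
  rewrite /b' expr0 mul1r mulrC; congr (_ * _).
  by apply: eq_bigr => i; rewrite -!val_eqE /= => /negPf ->.
- rewrite rmorphM hc // rmorph_prod; congr (_ * _); apply: eq_bigr => i _.
  rewrite rmorphXn /b' /=; case: eqP => [_|i1] /=; first by rewrite !expr0.
  by rewrite (ds_sx ds) //; lia.
- by move=> beta hb; apply: (Bdeg_mon (b := b')) => // i iN; rewrite /b'; case: ifP => // _; apply: hb.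
Qed.

Lemma bdeg_d0 beta f B : (0 < n)%N -> bdeg beta f -> (beta 0%N <= B.+1)%N ->
  bdeg (fun i => if i == 0%N then B else beta i) (d 0%N f).
Proof.
move=> n0 h h0; elim: h => [c b hc hb|g g' _ IH _ IH']; last first.
  by rewrite (dD ds) //; apply: Bdeg_add.
have [M [-> sM bM]] := mon_split0 b n0 hc.
rewrite (dZ ds) //.
have le : (b 0%N <= B.+1)%N by apply: leq_trans (hb _ n0) h0.
case: (b 0%N) le => [|p] le.
  by rewrite expr0 (d_const ds) ?rmorph1 // mulr0; apply: bdeg0.
have -> : d 0%N (x 0%N ^+ p.+1) = (1 - (-1) ^+ p.+1) * x 0%N ^+ p.
  apply: (d_uniq ds) => //=; rewrite -mulrA -exprSr mulrBl mul1r rmorphXn /= (ds_s0 ds).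
  by rewrite -exprNn.
rewrite mulrA.
have fx : fixed_upto n (1 - (-1) ^+ p.+1 : P).
  by move=> k _; rewrite rmorphB rmorph1 rmorph_sign.
apply: bdeg_le (bdegM (bdegM (bM _ hb) (bdeg_const (fun=> 0%N) fx)) (bdegX p (bdeg_x n0))).
by move=> i _ /=; case: eqP => /=; lia.
Qed.

(** [d_0] kills the polynomials that do not involve [x_0]. *)
Lemma d0_bdeg0 beta f : (0 < n)%N -> bdeg beta f -> beta 0%N = 0%N -> d 0%N f = 0.
Proof.
move=> n0 h h0; elim: h => [c b hc hb|g g' _ IH _ IH']; last first.
  by rewrite (dD ds) // IH IH' addr0.
have [M [-> sM bM]] := mon_split0 b n0 hc.
have := hb 0%N n0; rewrite h0 leqn0 => /eqP ->.
by rewrite expr0 mulr1 (d_const ds).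
Qed.
End Bounded.

(** * The element v and elementary symmetric polynomials *)

(** A word for the element of [W_m] with one-line notation (-m, ..., -1): the
coset representative [s_0 ... s_(m-1)] followed by the word for [m - 1]. *)
Fixpoint vword (m : nat) : seq nat :=
  if m is k.+1 then iota 0 m ++ vword k else [::].

Section LongElement.
Variables (P : idomainType) (n : nat) (x : nat -> P).
Variables (s : nat -> {rmorphism P -> P}) (d : nat -> P -> P).
Hypothesis ds : divdiff_system n x s d.
Local Notation bdeg := (bdeg n x s).
Local Notation fixed_upto := (fixed_upto s).

(** The operator of a word; the last letter acts first. *)
Definition dword (a : seq nat) (f : P) : P := foldr d f a.

Lemma letters_vword m : all (ltn^~ m) (vword m).
Proof.
elim: m => //= m IH; rewrite all_cat; apply/andP; split.
  by apply/allP => k; rewrite mem_iota; lia.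
by apply: sub_all IH => k /=; lia.
Qed.

Lemma letters_le m m' a : (m <= m')%N -> all (ltn^~ m) a -> all (ltn^~ m') a.
Proof. by move=> le; apply: sub_all => k /=; lia. Qed.

Lemma dword_vwordS m f :
  dword (vword m.+1) f = d 0%N (dword (iota 1 m) (dword (vword m) f)).
Proof. by rewrite /dword /= foldr_cat. Qed.

Lemma dwordD a f g : all (ltn^~ n) a -> dword a (f + g) = dword a f + dword a g.
Proof. by elim: a => //= k a IH /andP[kn /IH ->]; rewrite (dD ds). Qed.

Lemma dword0 a : all (ltn^~ n) a -> dword a 0 = 0.
Proof. by elim: a => //= k a IH /andP[kn /IH ->]; rewrite (d0 ds). Qed.

Lemma dword_sum a (I : Type) (r : seq I) (Q : pred I) (F : I -> P) :
  all (ltn^~ n) a ->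
  dword a (\sum_(i <- r | Q i) F i) = \sum_(i <- r | Q i) dword a (F i).
Proof.
move=> an; apply: (big_morph (dword a)); last exact: dword0.
by move=> f g; apply: dwordD.
Qed.

Lemma dwordZ a c f : all (ltn^~ n) a -> (forall k, k \in a -> s k c = c) ->
  dword a (c * f) = c * dword a f.
Proof.
elim: a => //= k a IH /andP[kn an] h.
rewrite IH // ?(dZ ds) //; first by apply: h; rewrite mem_head.
by move=> j ja; apply: h; rewrite in_cons ja orbT.
Qed.

Lemma dword_vZ m c f : (m <= n)%N -> fixed_upto m c ->
  dword (vword m) (c * f) = c * dword (vword m) f.
Proof.
move=> mn h; apply: dwordZ; first exact: letters_le (letters_vword m).
by move=> k /(allP (letters_vword m)); apply: h.
Qed.

Lemma iota1S m : iota 1 m.+1 = rcons (iota 1 m) m.+1.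
Proof. by rewrite -cats1 -[in LHS](addn1 m) iotaD add1n. Qed.

Lemma dword_rcons a k f : dword (rcons a k) f = dword a (d k f).
Proof. by rewrite /dword foldr_rcons. Qed.

Lemma letters_iota1 m : (m < n)%N -> all (ltn^~ n) (iota 1 m).
Proof. by move=> mn; apply/allP => k; rewrite mem_iota /= => h; apply: leq_trans mn; lia. Qed.

(** The degree bounds travel through [d_1 ... d_m]: each operator levels two
neighbouring bounds and lowers them by one. *)
Lemma chain_bdeg m E beta f : (m < n)%N -> bdeg beta f ->
  (forall i, (i < m)%N -> (beta i <= i + E.+1)%N) -> (beta m <= m + E)%N ->
  bdeg (fun i => if i == 0%N then E else if (i <= m)%N then (i + E).-1 else beta i)
    (dword (iota 1 m) f).
Proof.
elim: m beta f => [|m IH] beta f mn h hi hm.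
  by apply: bdeg_le h => i _; case: eqP => [->|] //; case: i hm.
rewrite iota1S dword_rcons.
have b1 : bdeg (fun i => if (i == m) || (i == m.+1) then (m + E)%N else beta i) (d m.+1 f).
  apply: (bdeg_d ds) => //.
  by have := hi m; lia.
apply: bdeg_le (IH _ _ _ b1 _ _); try lia.
- move=> i _ /=; case: (i == 0)%N => //; case: (leqP i m) => im; first by rewrite leqW.
  case: (eqVneq i m.+1) => [->|ne]; first by rewrite orbT leqnn; lia.
  have -> : (i <= m.+1)%N = false by lia.
  by have -> : (i == m) = false by lia.
- by move=> i im; have := hi i; do 2?case: eqP => //=; lia.
- by rewrite eqxx.
Qed.

(** The case of [chain_bdeg] where the bounds reach zero before the last operator. *)
Lemma chain_zero m beta f : (0 < m < n)%N -> bdeg beta f ->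
  (forall i, (i < m)%N -> (beta i <= i)%N) -> (beta m <= m.-1)%N ->
  dword (iota 1 m) f = 0.
Proof.
elim: m beta f => // m IH beta f /andP[_ mn] h hi hm.
have an : all (ltn^~ n) (iota 1 m) by apply: letters_iota1; lia.
rewrite iota1S dword_rcons; case: m IH mn hi hm an => [|m] IH mn hi hm an.
  rewrite (d_bdeg0 ds mn h) ?dword0 //; last by move: hm; rewrite leqn0 => /eqP.
  by have := hi 0%N isT; rewrite leqn0 => /eqP.
have b1 : bdeg (fun i => if (i == m.+1) || (i == m.+2) then m else beta i) (d m.+2 f).
  by apply: (bdeg_d ds) => //; apply: hi.
apply: IH b1 _ _ => //=; [lia | | by rewrite eqxx].
by move=> i im; have := hi i; do 2?case: eqP => //=; lia.
Qed.

(** The bound goes down from [2 m - i - 1 + c] to [i + c] in the variable [x_i], for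
[i < m]; the induction on [m] uses it for [m - 1] and [c + 2]. *)
Lemma dword_vword_bdeg m c beta f : (m <= n)%N -> bdeg beta f ->
  (forall i, (i < m)%N -> (beta i <= 2 * m - i.+1 + c)%N) ->
  bdeg (fun i => if (i < m)%N then (i + c)%N else beta i) (dword (vword m) f).
Proof.
elim: m c beta f => [|m IH] c beta f mn h hi; first by apply: bdeg_le h.
rewrite dword_vwordS.
have b1 := IH c.+2 _ _ (ltnW mn) h ltac:(move=> i im; have := hi i; lia).
have b2 := chain_bdeg (E := c.+1) mn b1 _ _.
have n0 : (0 < n)%N by lia.
apply: bdeg_le (bdeg_d0 ds (B := c) n0 (b2 _ _) _) => //=.
- move=> [|i] _ //=; rewrite ltnS; case: (ltnP i m) => im; first by lia.
  by have -> : (i.+1 < m)%N = false by lia.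
- by move=> i im; rewrite im; lia.
- by rewrite ltnn; have := hi m; lia.
Qed.

(** The degrees are one below those of [dword_vword_bdeg] with [c = 0], and the result vanishes. *)
Lemma dword_vword_zero m beta f : (0 < m <= n)%N -> bdeg beta f ->
  (forall i, (i < m)%N -> (beta i <= 2 * m - i.+2)%N) -> dword (vword m) f = 0.
Proof.
case: m => // m /andP[_ mn] h hi.
rewrite dword_vwordS.
have b1 := dword_vword_bdeg (c := 1) (ltnW mn) h ltac:(move=> i im; have := hi i; lia).
have b2 := chain_bdeg (E := 0) mn b1 _ _.
apply: (d0_bdeg0 ds) (b2 _ _) _ => //; first lia.
- by move=> i im; rewrite im; lia.
- by rewrite ltnn; have := hi m; lia.
Qed.

(** [s_k] permutes [x_0, ..., x_(m-1)] up to the sign of one variable. *)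
Lemma prod_s (Q : comNzRingType) (G : P -> Q) k m : (k < m)%N -> (m <= n)%N ->
  (k = 0%N -> G (- x 0%N) = G (x 0%N)) ->
  \prod_(i < m) G (s k (x i)) = \prod_(i < m) G (x i).
Proof.
elim: m => // m IH km mn h0.
rewrite !big_ord_recr /=; move: km; rewrite ltnS leq_eqVlt => /orP[/eqP km|km].
  subst m; case: k IH mn h0 => [|k] IH mn h0.
    by rewrite !big_ord0 (ds_s0 ds) h0.
  rewrite !big_ord_recr /= (ds_sl ds) // (ds_sr ds) // mulrAC.
  congr (_ * _ * _); apply: eq_bigr => i _.
  by rewrite (ds_sx ds) //; have := ltn_ord i; lia.
rewrite IH //; last exact: ltnW.
by rewrite (ds_sx ds) //; lia.
Qed.

(** The elementary symmetric polynomial of degree [k] in [x_0, ..., x_(m-1)]. *)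
Fixpoint elem (m k : nat) : P :=
  match m, k with
  | _, 0%N => 1
  | 0%N, _.+1 => 0
  | m'.+1, k'.+1 => elem m' k + x m' * elem m' k'
  end.

Arguments elem : simpl never.

Lemma elem0 m : elem m 0 = 1. Proof. by case: m. Qed.

Lemma elemS m k : elem m.+1 k.+1 = elem m k.+1 + x m * elem m k.
Proof. by []. Qed.

Lemma elem_gt m k : (m < k)%N -> elem m k = 0.
Proof.
elim: m k => [|m IH] [|k] // mk; rewrite elemS !IH ?mulr0 ?addr0 //; lia.
Qed.

Lemma elem_bdeg m k : (m <= n)%N -> bdeg (fun i => (i < m) && (k != 0))%N (elem m k).
Proof.
elim: m k => [|m IH] [|k] mn; rewrite ?elem0; try exact/bdeg_const/fixed_upto1.
  exact/bdeg_const/fixed_upto0.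
have bx : bdeg (fun j => j == m) (x m) by apply: bdeg_x.
rewrite elemS; apply: Bdeg_add.
  apply: bdeg_le (IH k.+1 (ltnW mn)) => i _ /=.
  by rewrite ltnS !andbT; case: ltngtP.
apply: bdeg_le (bdegM bx (IH k (ltnW mn))) => i _ /=.
by rewrite ltnS andbT; case: ltngtP => //= _; case: (k != 0)%N.
Qed.

(** The generating function of the [elem m k], homogeneous form. *)
Lemma elem_gen m (y : P) :
  \prod_(i < m) (x i + y) = \sum_(k < m.+1) y ^+ (m - k) * elem m k.
Proof.
elim: m => [|m IH]; first by rewrite big_ord0 big_ord1 mulr1.
rewrite big_ord_recr [LHS]/= mulrDr [in RHS]big_ord_recl elem0 subn0 mulr1.
have -> : \sum_(i < m.+1) y ^+ (m.+1 - lift ord0 i) * elem m.+1 (lift ord0 i)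
    = \sum_(i < m.+1) y ^+ (m - i) * elem m i.+1
      + (\sum_(i < m.+1) y ^+ (m - i) * elem m i) * x m.
  rewrite mulr_suml -big_split; apply: eq_bigr => i _ /=.
  by rewrite /bump add1n subSS elemS; ring.
rewrite -IH addrA [LHS]addrC; congr (_ + _).
rewrite IH [in LHS]big_ord_recl subn0 elem0 mulr1 mulrDl -exprSr; congr (_ + _).
rewrite [in RHS]big_ord_recr /= elem_gt // mulr0 addr0 mulr_suml.
apply: eq_bigr => i _; rewrite /bump /= add1n.
have -> : (m - i = (m - i.+1).+1)%N by have := ltn_ord i; lia.
by rewrite exprSr; ring.
Qed.

(** The generating function of the [elem m k] in one variable, scaled by [u]. *)
Lemma elem_poly (u : P) m :
  \prod_(i < m) (1 + (u * x i)%:P * 'X) = \poly_(k < m.+1) (u ^+ k * elem m k) :> {poly P}.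
Proof.
elim: m => [|m IH].
  by rewrite big_ord0; apply/polyP => k; rewrite coef1 coef_poly; case: k => //=; rewrite mulr1.
rewrite big_ord_recr /= IH; apply/polyP => k.
rewrite mulrDr mulr1 coefD mulrA coefMX coef_poly [RHS]coef_poly.
case: k => [|k]; first by rewrite !elem0 /= addr0.
rewrite [in X in _ + X]mulrC coefCM coef_poly elemS ltnS /=.
rewrite [(k.+1 < m.+2)%N]ltnS; case: (ltnP k m.+1) => km; last first.
  by rewrite ltnNge ltnW // mulr0 addr0.
rewrite exprS mulrDr; congr (_ + _); last by ring.
by case: (ltnP k m) => km' //; rewrite elem_gt // mulr0.
Qed.

(** Straightening: up to an invariant of the group, the square of [e_k] is a
combination of the products [e_(k+i) e_(k-i)].  The invariant is a coefficient
of [prod_i (1 - x_i^2 t^2)], the product of the generating functions at [t]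
and [- t]. *)
Lemma elem_sqr m k : (m <= n)%N -> exists c, fixed_upto m c /\
  elem m k ^+ 2 = c - 2%:R * \sum_(i < k) (-1) ^+ i.+1 * (elem m (k + i.+1) * elem m (k - i.+1)).
Proof.
move=> mn; pose F := \prod_(i < m) (1 - (x i ^+ 2)%:P * 'X^2) : {poly P}.
have fixF j : (j < m)%N -> map_poly (s j) F = F.
  move=> jm; rewrite rmorph_prod /= -[RHS](@prod_s _ (fun a => 1 - (a ^+ 2)%:P * 'X^2) j) //.
    apply: eq_bigr => i _.
    by rewrite rmorphB rmorphM rmorph1 /= map_polyC map_polyXn -rmorphXn.
  by move=> _; rewrite sqrrN.
have FE : F = (\poly_(k < m.+1) ((-1) ^+ k * elem m k)) * (\poly_(k < m.+1) (1 ^+ k * elem m k)).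
  rewrite -!elem_poly -big_split; apply: eq_bigr => i _ /=.
  rewrite mul1r mulN1r rmorphN rmorphXn /=; ring.
pose t i := (-1) ^+ i * (elem m i * elem m (2 * k - i)).
have cF : F`_(2 * k) = \sum_(i < (2 * k).+1) t i.
  rewrite FE coefM; apply: eq_bigr => i _; rewrite !coef_poly /t expr1n mul1r.
  case: (ltnP i m.+1) => im; last by rewrite [elem m i]elem_gt // !mul0r mulr0.
  case: (ltnP _ m.+1) => im'; last by rewrite [elem m (2 * k - i)]elem_gt // !mulr0.
  by rewrite mulrA.
have sumt : \sum_(i < (2 * k).+1) t i = (-1) ^+ k * (elem m k ^+ 2 +
    2%:R * \sum_(i < k) (-1) ^+ i.+1 * (elem m (k + i.+1) * elem m (k - i.+1))).
  have -> : (2 * k).+1 = (k + k.+1)%N by lia.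
  rewrite big_split_ord big_ord_recl /= addn0.
  have -> : \sum_(i < k) t i = \sum_(i < k) t (k + i.+1)%N.
    rewrite (reindex_inj rev_ord_inj); apply: eq_bigr => i _ /=.
    have ik := ltn_ord i; rewrite /t.
    have -> : (2 * k - (k - i.+1) = k + i.+1)%N by lia.
    have -> : (2 * k - (k + i.+1) = k - i.+1)%N by lia.
    rewrite [elem m (k - _) * _]mulrC -[in X in _ = X]signr_odd -[in LHS]signr_odd.
    by congr ((-1) ^+ (nat_of_bool _) * _); lia.
  rewrite /t (_ : 2 * k - k = k)%N; last by lia.
  under [X in _ + (_ + X)]eq_bigr do rewrite /bump /= add1n.
  rewrite addrCA mulrDr -expr2; congr (_ + _).
  rewrite -mulr2n -[LHS]mulr_natl [in RHS]mulrCA; congr (_ * _); rewrite mulr_sumr.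
  apply: eq_bigr => i _; have -> : (2 * k - (k + i.+1) = k - i.+1)%N by lia.
  by rewrite exprD -mulrA.
exists ((-1) ^+ k * F`_(2 * k)); split.
  move=> j jm; rewrite rmorphM rmorph_sign; congr (_ * _).
  by rewrite -{2}(fixF j jm) coef_map.
by rewrite cF sumt mulrA -exprMn mulrNN mulr1 expr1n mul1r addrK.
Qed.
End LongElement.

Arguments elem : simpl never.

(** * The functional f -> d_v(Delta f) on symmetric polynomials *)

Section Phi.
Variables (P : idomainType) (n : nat) (x : nat -> P).
Variables (s : nat -> {rmorphism P -> P}) (d : nat -> P -> P).
Hypothesis ds : divdiff_system n x s d.
Local Notation bdeg := (bdeg n x s).
Local Notation fixed_upto := (fixed_upto s).
Local Notation elem := (elem x).
Local Notation dword := (dword d).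

(** Delta in [m] variables: the product of [x_i - y_j] for [i + j < m - 1]. *)
Definition stair (y : nat -> P) (m : nat) : P :=
  \prod_(i < m) \prod_(j < m - i.+1) (x i - y j).

(** Its image under the reversal of X and the negation of Y. *)
Definition stairT (y : nat -> P) (m : nat) : P :=
  \prod_(k < m) \prod_(j < k) (x k + y j).

(** The product of the elementary symmetric polynomials of degrees listed in [a]. *)
Definition elems (m : nat) (a : seq nat) : P := \prod_(k <- a) elem m k.

(** The functional [f |-> d_v (Delta f)]. *)
Definition phi (y : nat -> P) (m : nat) (f : P) : P :=
  dword (vword m) (stair y m * f).

(** The number of nonzero entries, that is, of factors [e_k] different from 1. *)
Definition nzc (a : seq nat) : nat := count (fun k => k != 0)%N a.

Lemma elems_cons m k a : elems m (k :: a) = elem m k * elems m a.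
Proof. by rewrite /elems big_cons. Qed.

Lemma elems_perm m a b : perm_eq a b -> elems m a = elems m b.
Proof. exact: perm_big. Qed.

Lemma phiZ y m c f : (m <= n)%N -> fixed_upto m c -> phi y m (c * f) = c * phi y m f.
Proof. by move=> mn h; rewrite /phi mulrCA (dword_vZ ds _ mn h). Qed.

Lemma phiD y m f g : (m <= n)%N -> phi y m (f + g) = phi y m f + phi y m g.
Proof.
move=> mn; rewrite /phi mulrDr (dwordD ds) //.
exact: letters_le (letters_vword m).
Qed.

Lemma phi_sum y m (I : Type) (r : seq I) (Q : pred I) (F : I -> P) : (m <= n)%N ->
  phi y m (\sum_(i <- r | Q i) F i) = \sum_(i <- r | Q i) phi y m (F i).
Proof.
move=> mn; rewrite /phi mulr_sumr (dword_sum ds) //.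
exact: letters_le (letters_vword m).
Qed.

Lemma phi0 y m : (m <= n)%N -> phi y m 0 = 0.
Proof.
move=> mn; rewrite /phi mulr0 (dword0 ds) //; exact: letters_le (letters_vword m).
Qed.

Lemma elems_bdeg m a : (m <= n)%N -> bdeg (fun i => (i < m) * nzc a)%N (elems m a).
Proof.
move=> mn; elim: a => [|k a IH].
  by rewrite /elems big_nil; apply/bdeg_const/fixed_upto1.
rewrite elems_cons; apply: bdeg_le (bdegM (elem_bdeg x s k mn) IH) => i _ /=.
by rewrite /nzc /=; case: (i < m)%N => //=; lia.
Qed.

Lemma stair_bdeg y m : (m <= n)%N -> (forall j, fixed_upto n (y j)) ->
  bdeg (fun i => if (i < m)%N then m - i.+1 else 0)%N (stair y m).
Proof.
move=> mn hy; pose B k i := ((m - k.+1) * (i == k :> nat))%N.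
have H : bdeg (fun i => \sum_(k < m) B k i)%N (stair y m).
  apply: (@bdeg_prod _ _ _ _ _ (fun k => \prod_(j < m - k.+1) (x k - y j))) => k km.
  apply: bdeg_le (@bdeg_prod _ _ _ _ (m - k.+1) (fun j => x k - y j) (fun _ i => (i == k)) _).
    by move=> i _; rewrite sum_nat_const card_ord.
  move=> j _; apply: Bdeg_add; first by apply: bdeg_x; lia.
  exact/bdeg_const/fixed_uptoN.
apply: bdeg_le H => i iN; case: ltnP => im.
  rewrite (bigD1 (Ordinal im)) //= /B eqxx muln1 big1 ?addn0 // => k.
  by rewrite -val_eqE /= eq_sym => /negPf ->; rewrite muln0.
by rewrite big1 // => k _; rewrite /B (_ : (i == k) = false) ?muln0 //; have := ltn_ord k; lia.
Qed.

(** Fewer than [m] factors: the degree bounds of [dword_vword_zero] hold. *)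
Lemma phi_few y m a : (m <= n)%N -> (forall j, fixed_upto n (y j)) ->
  (nzc a < m)%N -> phi y m (elems m a) = 0.
Proof.
move=> mn hy am; apply: (dword_vword_zero ds _ (bdegM (stair_bdeg mn hy) (elems_bdeg a mn))).
  by lia.
by move=> i im; rewrite im; lia.
Qed.

(** The sum of squares, which increases when [elem_sqr] is applied. *)
Definition sqsum (a : seq nat) : nat := sumn [seq k ^ 2 | k <- a]%N.

Lemma nzc_cons k a : nzc (k :: a) = ((k != 0) + nzc a)%N.
Proof. by []. Qed.

Lemma sqsum_cons k a : sqsum (k :: a) = (k ^ 2 + sqsum a)%N.
Proof. by []. Qed.

Lemma sqsum_perm a b : perm_eq a b -> sqsum a = sqsum b.
Proof. by move=> h; apply/perm_sumn/perm_map. Qed.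

Lemma nzc_perm a b : perm_eq a b -> nzc a = nzc b.
Proof. by move/seq.permP; apply. Qed.

Lemma sqsum_le m a : all (fun k => k <= m)%N a -> (sqsum a <= size a * m ^ 2)%N.
Proof.
elim: a => //= k a IH /andP[km /IH le]; rewrite /sqsum /= mulSn leq_add //.
by rewrite leq_exp2r.
Qed.

Lemma nuniq_dup (T : eqType) (a : seq T) : ~~ uniq a ->
  exists k r, perm_eq a [:: k, k & r].
Proof.
elim: a => //= k a IH; rewrite negb_and negbK => /orP[ka|/IH[j [r h]]].
  by exists k, (rem k a); rewrite perm_cons perm_to_rem.
exists j, (k :: r); rewrite (perm_trans (y := [:: k, j, j & r])) ?perm_cons //.
by rewrite -[[:: k, _, _ & _]](cat1s k) -[[:: j, _, _ & _]](cat1s j [:: j, k & r])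
  -[[:: j, k & r]]/([:: j] ++ [:: k] ++ r) catA (perm_catCA [:: k] [:: j; j] r).
Qed.

(** Products of at most [m] factors vanish under the functional when their degree is
lower than that of [e_1 ... e_m], or when the sum of the squares of the indices
is higher.  Repeated indices are straightened, which preserves the hypothesis;
the sum of squares increases until an index exceeds [m] or becomes zero, since
distinct indices would have to be 1, ..., m. *)
Lemma phi_zero y m a : (m <= n)%N -> (forall j, fixed_upto n (y j)) ->
  (nzc a <= m)%N ->
  (sumn a < sumn (iota 1 m))%N \/ (sqsum (iota 1 m) < sqsum a)%N ->
  phi y m (elems m a) = 0.
Proof.
move=> mn hy; have [M] := ubnP ((size a * m ^ 2).+1 - sqsum a)%N.
elim: M a => // M IH a hM am hyp.
have [all_le|/allPn[k ka]] := boolP (all (fun k => k <= m)%N a); last first.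
  rewrite -ltnNge => mk; rewrite (elems_perm _ (perm_to_rem ka)) elems_cons.
  by rewrite elem_gt // mul0r phi0.
move: (am); rewrite leq_eqVlt => /orP[/eqP ame|]; last exact: phi_few.
pose b : seq nat := [seq k <- a | k != 0]%N.
have szb : size b = m by rewrite size_filter.
have [ub|nub] := boolP (uniq b).
  have pb : perm_eq b (iota 1 m).
    apply: uniq_perm => //; first exact: iota_uniq.
    have sub : {subset b <= iota 1 m}.
      move=> k; rewrite mem_filter mem_iota => /andP[k0 /(allP all_le)]; lia.
    by case: (uniq_min_size ub sub) => //; rewrite size_iota szb.
  have sa : sumn a = sumn b by rewrite /b; elim: (a) => //= k r ->; case: k.
  have qa : sqsum a = sqsum b.
    by rewrite /b /sqsum; elim: (a) => //= k r ->; case: k.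
  by move: hyp; rewrite sa qa (perm_sumn pb) (sqsum_perm pb) !ltnn => -[].
have [k [r pkr]] : exists (k : nat) (r : seq nat), perm_eq b [:: k, k & r].
  exact: nuniq_dup nub.
have k0 : (k != 0)%N.
  have : k \in b by rewrite (perm_mem pkr) mem_head.
  by rewrite mem_filter => /andP[].
have [r' pa] : exists r', perm_eq a [:: k, k & r'].
  exists (r ++ [seq k <- a | ~~ (k != 0)%N]).
  have h := perm_filterC (fun k => k != 0)%N a.
  by rewrite -h -!cat_cons perm_cat2r.
have [c [fc ec]] := elem_sqr ds k mn.
have nz := nzc_perm pa; have sz := perm_size pa; have su := perm_sumn pa.
have sq := sqsum_perm pa; rewrite /= in sz su; rewrite !nzc_cons k0 in nz; rewrite !sqsum_cons in sq.
rewrite (elems_perm _ pa) !elems_cons mulrA -expr2 ec mulrBl mulr_sumr mulr_suml -sumrN.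
rewrite (phiD _ _ _ mn) (phiZ _ _ mn fc) phi_few //; last by lia.
rewrite mulr0 add0r (phi_sum _ _ _ _ mn) big1 // => i _.
rewrite [X in phi _ _ X](_ : _ = - (2%:R * (-1) ^+ i.+1) * elems m [:: (k + i.+1)%N, (k - i.+1)%N & r']); last first.
  by rewrite !elems_cons; ring.
rewrite (phiZ _ _ mn); last first.
  by move=> j _; rewrite rmorphN rmorphM rmorph_nat rmorph_sign.
have ik := ltn_ord i.
have sqgt : (k ^ 2 + k ^ 2 < (k + i.+1) ^ 2 + (k - i.+1) ^ 2)%N.
  move: (nat_of_ord i) ik => j jk.
  have [l ->] : exists l, k = (l + j.+1)%N by exists (k - j.+1)%N; lia.
  by rewrite addnK; nia.
have le := sqsum_le all_le.
rewrite IH ?mulr0 //.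
- by rewrite !sqsum_cons /=; lia.
- rewrite !nzc_cons (_ : (k + i.+1 != 0)%N); last by lia.
  by case: (k - i.+1 != 0)%N; lia.
by rewrite !sqsum_cons /=; case: hyp => h; [left | right]; lia.
Qed.

Lemma sumn_iota1 m : sumn (iota 1 m.+1) = (sumn (iota 1 m) + m.+1)%N.
Proof. by rewrite iota1S sumn_rcons. Qed.

(** In [e_k(x_0, ..., x_m) = e_k + x_m e_(k-1)] the second term lowers the degree and does not contribute. *)
Lemma phi_elemS y m r l : (m < n)%N -> (forall j, fixed_upto n (y j)) ->
  (size r + size l <= m)%N -> all (leq 1) l ->
  (sumn r + sumn l <= sumn (iota 1 m))%N ->
  phi y m (elems m r * elems m.+1 l) = phi y m (elems m r * elems m l).
Proof.
move=> mn hy; elim: l r => [|k l IH] r; first by rewrite /elems !big_nil.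
move=> szrl /= /andP[k0 l0] su; case: k szrl k0 su => // k szrl _ su.
have mn' := ltnW mn.
have xm : fixed_upto m (x m) by move=> j jm; rewrite (ds_sx ds) //; lia.
rewrite !elems_cons elemS mulrDl mulrDr (phiD _ _ _ mn').
have -> : elems m r * (elem m k.+1 * elems m.+1 l) = elems m (k.+1 :: r) * elems m.+1 l.
  by rewrite elems_cons; ring.
have -> : elems m r * (x m * elem m k * elems m.+1 l) = x m * (elems m (k :: r) * elems m.+1 l).
  by rewrite elems_cons; ring.
rewrite (phiZ _ _ mn' xm) !IH //=; try (rewrite /= in szrl *; lia).
have -> : elems m (k :: r) * elems m l = elems m ((k :: r) ++ l) by rewrite /elems big_cat.
rewrite phi_zero //; first by rewrite mulr0 addr0 elems_cons; congr phi; ring.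
  by rewrite /nzc; apply: leq_trans (count_size _ _) _; rewrite size_cat /= in szrl *; lia.
by left; rewrite sumn_cat /=; lia.
Qed.

Lemma foldr_s_rmorph a : exists F : {rmorphism P -> P}, forall f, foldr (fun k g => s k g) f a = F f.
Proof.
elim: a => [|k a [F IH]] /=; first by exists idfun.
by exists (s k \o F) => f /=; rewrite IH.
Qed.

Lemma foldr_s_x_gt m k : (k < n)%N -> (m < k)%N ->
  foldr (fun k g => s k g) (x k) (iota 1 m) = x k.
Proof.
move=> kn; elim: m => // m IH mk; rewrite iota1S foldr_rcons (ds_sx ds) //; try lia.
by apply: IH; lia.
Qed.

Lemma foldr_s_x m k : (m < n)%N -> (k < m)%N ->
  foldr (fun k g => s k g) (x k) (iota 1 m) = x k.+1.
Proof.
elim: m => // m IH mn; rewrite ltnS leq_eqVlt => /orP[/eqP->|km].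
  by rewrite iota1S foldr_rcons (ds_sl ds) // foldr_s_x_gt.
rewrite iota1S foldr_rcons (ds_sx ds) //; try lia.
by apply: IH => //; lia.
Qed.

Lemma fixed_prodB m c k : (0 < k < m)%N -> (m <= n)%N -> s k c = c ->
  s k (\prod_(i < m) (x i - c)) = \prod_(i < m) (x i - c).
Proof.
move=> km mn fc; rewrite rmorph_prod -[RHS](@prod_s _ _ _ _ _ ds _ (fun a => a - c) k) //; try lia.
by apply: eq_bigr => i _; rewrite rmorphB fc.
Qed.

Lemma fixed_prodD m c k : (0 < k < m)%N -> (m <= n)%N -> s k c = c ->
  s k (\prod_(i < m) (x i + c)) = \prod_(i < m) (x i + c).
Proof.
move=> km mn fc; rewrite rmorph_prod -[RHS](@prod_s _ _ _ _ _ ds _ (fun a => a + c) k) //; try lia.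
by apply: eq_bigr => i _; rewrite rmorphD fc.
Qed.

(** The Leibniz rule yields two terms at each step; in one of them the remaining
factor is symmetric, and the degree bounds make it vanish. *)
Lemma chain_shift m beta g c : (m < n)%N -> bdeg beta g -> fixed_upto n c ->
  (forall i, (i < m)%N -> (beta i <= i)%N) -> beta m = 0%N ->
  dword (iota 1 m) (g * \prod_(i < m) (x i - c)) = foldr (fun k g => s k g) g (iota 1 m).
Proof.
elim: m beta g => [|m IH] beta g mn h fc hi hm; first by rewrite big_ord0 mulr1.
have an : all (ltn^~ n) (iota 1 m) by apply: letters_iota1; lia.
rewrite iota1S dword_rcons foldr_rcons big_ord_recr /=.
set U := \prod_(i < m) (x i - c).
have sU : s m.+1 U = U.
  rewrite rmorph_prod; apply: eq_bigr => i _.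
  by rewrite rmorphB fc // (ds_sx ds) //; have := ltn_ord i; lia.
have dx : d m.+1 (x m - c) = 1.
  apply: (d_uniq ds) => //=; rewrite rmorphB fc // (ds_sl ds) //; ring.
have -> : g * (U * (x m - c)) = U * (g * (x m - c)) by ring.
rewrite (dZ ds) // (dM ds) // dx mulr1.
have -> : U * (d m.+1 g * (x m - c) + s m.+1 g) = (U * (x m - c)) * d m.+1 g + s m.+1 g * U by ring.
rewrite (dwordD ds) // [X in X + _](_ : _ = 0) ?add0r.
  by apply: (IH _ _ _ (bdeg_s ds mn h)) => //= [|i im|]; rewrite ?eqxx //;
    [lia | have := hi i; do 2?case: eqP => //=; lia].
have -> : U * (x m - c) = \prod_(i < m.+1) (x i - c) by rewrite big_ord_recr.
rewrite (dwordZ ds) //; last first.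
  by move=> k; rewrite mem_iota => km; apply: fixed_prodB; rewrite ?fc //; lia.
rewrite -dword_rcons -iota1S (chain_zero ds _ h) ?mulr0 //.
by rewrite hm.
Qed.

(** Delta factors as a polynomial symmetric in all variables but the last, times Delta for the remaining variables [y]. *)
Lemma stairS y m : stair y m.+1 = \prod_(i < m) (x i - y 0%N) * stair (y \o S) m.
Proof.
rewrite /stair big_ord_recr /= subnn big_ord0 mulr1 -big_split /=; apply: eq_bigr => i _.
have -> : (m.+1 - i.+1 = (m - i.+1).+1)%N by have := ltn_ord i; lia.
by rewrite big_ord_recl.
Qed.

Lemma stairT_bdeg y m : (m <= n)%N -> (forall j, fixed_upto n (y j)) ->
  bdeg (fun i => if (i < m)%N then i else 0%N) (stairT y m).
Proof.
move=> mn hy; pose B k i := (k * (i == k :> nat))%N.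
have H : bdeg (fun i => \sum_(k < m) B k i)%N (stairT y m).
  apply: (@bdeg_prod _ _ _ _ _ (fun k => \prod_(j < k) (x k + y j))) => k km.
  apply: bdeg_le (@bdeg_prod _ _ _ _ k (fun j => x k + y j) (fun _ i => (i == k)) _).
    by move=> i _; rewrite sum_nat_const card_ord.
  move=> j _; apply: Bdeg_add; first by apply: bdeg_x; lia.
  exact/bdeg_const.
apply: bdeg_le H => i iN; case: ltnP => im.
  rewrite (bigD1 (Ordinal im)) //= /B eqxx muln1 big1 ?addn0 // => k.
  by rewrite -val_eqE /= eq_sym => /negPf ->; rewrite muln0.
by rewrite big1 // => k _; rewrite /B (_ : (i == k) = false) ?muln0 //; have := ltn_ord k; lia.
Qed.

(** The value of the functional at [e_1 ... e_m]. *)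
Theorem phi_rho y m : (m <= n)%N -> (forall j, fixed_upto n (y j)) ->
  phi y m (elems m (iota 1 m)) = 2%:R ^+ m * stairT y m.
Proof.
elim: m y => [|m IH] y mn hy.
  by rewrite /phi /stair /stairT /elems !big_ord0 big_nil !mulr1.
have mn' := ltnW mn; have hy' j : fixed_upto n ((y \o S) j) by apply: hy.
set c := y 0%N; have fc : fixed_upto n c := hy 0%N.
(* the terms e_k with k <= m in the expansion of prod_i (x_i + c) have too low a degree to contribute *)
have -> : phi y m.+1 (elems m.+1 (iota 1 m.+1)) =
    phi y m.+1 (\prod_(i < m.+1) (x i + c) * elems m.+1 (iota 1 m)).
  rewrite elem_gen mulr_suml (phi_sum _ _ _ _ mn) big_ord_recr big1.
    rewrite [RHS]add0r subnn expr0 mul1r -elems_cons; congr phi; apply: elems_perm.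
    by rewrite iota1S perm_rcons.
  move=> k _; rewrite -mulrA -elems_cons (phiZ _ _ mn); last first.
    by apply/fixed_uptoX; apply: fixed_upto_le mn _.
  rewrite phi_zero ?mulr0 //.
    by rewrite /nzc; apply: leq_trans (count_size _ _) _; rewrite /= size_iota.
  by left; rewrite sumn_iota1 /=; have := ltn_ord k; lia.
rewrite /phi stairS dword_vwordS.
set C := \prod_(i < m) (x i - c) * \prod_(i < m.+1) (x i + c).
have -> : \prod_(i < m) (x i - c) * stair (y \o S) m *
    (\prod_(i < m.+1) (x i + c) * elems m.+1 (iota 1 m)) =
    C * (stair (y \o S) m * elems m.+1 (iota 1 m)) by rewrite /C; ring.
(* C is the product of x_m + c and of the even functions x_i^2 - c^2 for i < m *)
have fC : fixed_upto m C.
  move=> k km; rewrite /C big_ord_recr /= mulrA -big_split /= rmorphM rmorphD.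
  rewrite fc; last by lia.
  rewrite (ds_sx ds) //; try lia; congr (_ * _).
  rewrite rmorph_prod -[RHS](@prod_s _ _ _ _ _ ds _ (fun a => (a - c) * (a + c)) k) //.
    by apply: eq_bigr => i _; rewrite rmorphM rmorphB rmorphD fc //; lia.
  by move=> _; ring.
rewrite (dword_vZ ds _ mn' fC) -/(phi _ _ _).
have := @phi_elemS (y \o S) m [::] (iota 1 m) mn hy'.
rewrite [elems m [::]]big_nil !mul1r => -> //; first last.
- by apply/allP => k; rewrite mem_iota => /andP[].
- by rewrite /= size_iota.
rewrite IH //.
have an : all (ltn^~ n) (iota 1 m) by apply: letters_iota1.
have f2 : fixed_upto n (2%:R ^+ m : P) by move=> k _; rewrite rmorphXn rmorph_nat.
set T := stairT (y \o S) m.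
have -> : C * (2%:R ^+ m * T) = 2%:R ^+ m * (\prod_(i < m.+1) (x i + c) * (T * \prod_(i < m) (x i - c))).
  by rewrite /C; ring.
rewrite (dwordZ ds) //; last first.
  by move=> k /(allP an) /=; apply: f2.
rewrite (dwordZ ds) //; last first.
  by move=> k; rewrite mem_iota => km; apply: fixed_prodD; rewrite ?fc //; lia.
rewrite (chain_shift mn (stairT_bdeg mn' hy') fc); last 2 first.
- by move=> i im; rewrite im.
- by rewrite ltnn.
have -> : foldr (fun k g => s k g) T (iota 1 m) = \prod_(k < m) \prod_(j < k) (x k.+1 + y j.+1).
  have [F eF] := foldr_s_rmorph (iota 1 m).
  rewrite eF /T /stairT rmorph_prod; apply: eq_bigr => k _.
  rewrite rmorph_prod; apply: eq_bigr => j _.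
  rewrite rmorphD -!eF foldr_s_x //; congr (_ + _).
  rewrite -[RHS]/((y \o S) j); elim: (iota 1 m) an => //= i r IHr /andP[ilt ran].
  by rewrite IHr // hy'.
have -> : \prod_(i < m.+1) (x i + c) * (\prod_(k < m) \prod_(j < k) (x k.+1 + y j.+1)) =
    stairT y m.+1 * (x 0%N + c).
  rewrite /stairT [in LHS]big_ord_recl [in RHS]big_ord_recl big_ord0 mul1r -mulrA mulrC.
  congr (_ * _); rewrite -big_split; apply: eq_bigr => k _ /=.
  by rewrite [in RHS]/bump /= big_ord_recl.
have n0 : (0 < n)%N by lia.
rewrite (dZ ds) //; last exact: f2.
rewrite (dZ ds) //; last first.
  rewrite /stairT rmorph_prod; apply: eq_bigr => k _.
  rewrite rmorph_prod; apply: eq_bigr => j _.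
  by rewrite rmorphD hy // (ds_sx ds) //; have := ltn_ord k; have := ltn_ord j; lia.
have -> : d 0%N (x 0%N + c) = 2%:R.
  by apply: (d_uniq ds) => //=; rewrite rmorphD (ds_s0 ds) fc //; ring.
by rewrite exprSr -!mulrA; congr (_ * _); rewrite mulrC.
Qed.
End Phi.

(** * Explicit reduced words *)

Lemma swp_cat (T : Type) (p : seq T) a b q : swp (size p) (p ++ [:: a, b & q]) = p ++ [:: b, a & q].
Proof. by elim: p => //= c p ->. Qed.

(** Successive exchanges move the entry [z] to the left over the word [mid]. *)
Lemma act_move p mid z q :
  foldr act (p ++ mid ++ z :: q) (iota (size p).+1 (size mid)) = p ++ z :: mid ++ q.
Proof.
elim/last_ind: mid q => // mid m IH q.
rewrite size_rcons -(addn1 (size mid)) iotaD foldr_cat cat_rcons.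
rewrite [foldr _ (p ++ _) _]/= -size_cat catA swp_cat -catA IH.
by rewrite cat_rcons.
Qed.

Lemma invs_move (p mid : seq int) (z : int) (q : seq int) : all (fun y => y < z) mid ->
  invs (p ++ z :: mid ++ q) = (invs (p ++ mid ++ z :: q) + size mid)%N.
Proof.
elim/last_ind: mid q => [|mid m IH] q; first by rewrite addn0.
rewrite all_rcons => /andP[mz all_lt]; rewrite !cat_rcons size_rcons.
rewrite (IH (m :: q)) // addnS -addSn; congr (_ + _)%N.
rewrite !catA; set r := p ++ mid.
have sw := swp_cat r m z q.
have h : ((size r).+1 < size (r ++ [:: m, z & q]))%N by rewrite size_cat /=; lia.
have e1 : nth (0 : int) (r ++ [:: m, z & q]) (size r) = m by rewrite nth_cat ltnn subnn.
have e2 : nth (0 : int) (r ++ [:: m, z & q]) (size r).+1 = z.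
  by rewrite nth_cat ltnNge leqnSn subSnn.
have := @invs_swp (size r) (r ++ [:: m, z & q]) h.
rewrite e1 e2 sw /= e1 e2 => /(_ ltac:(lia)).
have -> : (z < m) = false by lia.
by rewrite addn0 addn1.
Qed.

(** Reversal and negation of a word; on one-line notations of inverses it takes [u] to [(omega_0 u omega_0) v]. *)
Definition negrev (s : seq int) : seq int := [seq - z | z <- rev s].

Lemma idarrS n : idarr n.+1 = rcons (idarr n) n.+1%:Z.
Proof. by rewrite /idarr iota1S map_rcons. Qed.

(** The fixed points [m + 1, ..., n]. *)
Definition tail_arr (n m : nat) : seq int := [seq k%:Z | k <- iota m.+1 (n - m)].

Lemma idarr_split n m : (m <= n)%N -> idarr n = idarr m ++ tail_arr n m.
Proof. by move=> mn; rewrite /idarr /tail_arr -map_cat -iotaD subnKC. Qed.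

Lemma tail_arrS n m : (m < n)%N -> tail_arr n m = m.+1%:Z :: tail_arr n m.+1.
Proof. by move=> mn; rewrite /tail_arr -(subnSK mn). Qed.

Lemma size_negrev s : size (negrev s) = size s.
Proof. by rewrite size_map size_rev. Qed.

(** [vword m] is a reduced word of (-m, ..., -1, m + 1, ..., n). *)
Lemma vword_arr n m : (m <= n)%N ->
  arr_of n (vword m) = negrev (idarr m) ++ tail_arr n m /\
  invs (arr_of n (vword m)) = size (vword m).
Proof.
elim: m => [|m IH] mn.
  by rewrite /arr_of /= invs_id /tail_arr subn0.
have [e1 e2] := IH (ltnW mn).
have e3 : foldr act (arr_of n (vword m)) (iota 1 m) = m.+1%:Z :: negrev (idarr m) ++ tail_arr n m.+1.
  rewrite e1 tail_arrS //; have := act_move [::] (negrev (idarr m)) m.+1%:Z (tail_arr n m.+1).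
  by rewrite /= size_negrev size_idarr.
have e4 : arr_of n (vword m.+1) = negrev (idarr m.+1) ++ tail_arr n m.+1.
  by rewrite /arr_of /= foldr_cat -/(arr_of n _) e3 /= /negrev idarrS rev_rcons.
split=> //; rewrite /= size_cat size_iota.
have h : signed_word n (foldr act (arr_of n (vword m)) (iota 1 m)).
  exact/signed_foldr/signed_arr.
have -> : neg1 (arr_of n (iota 1 m ++ vword m)) = act 0 (foldr act (arr_of n (vword m)) (iota 1 m)).
  by rewrite /arr_of /= foldr_cat.
rewrite (invs_ndes h); [|lia|by rewrite e3].
congr S; rewrite e3 -e2 e1 (@invs_move [::] (negrev (idarr m))).
  by rewrite size_negrev size_idarr (tail_arrS mn) [RHS]addnC.
apply/allP => z /mapP[t]; rewrite mem_rev => /mapP[k _ ->] ->; lia.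
Qed.

Lemma redword_vword n : redword n (vword n) /\ arr_of n (vword n) = negrev (idarr n).
Proof.
have [e1 e2] := vword_arr (leqnn n); split.
  by rewrite /redword /letters letters_vword e2 eqxx.
by rewrite e1 /tail_arr subnn cats0.
Qed.

Lemma swp_rev (T : Type) k (s : seq T) : (k.+1 < size s)%N ->
  swp k (rev s) = rev (swp (size s - k.+2) s).
Proof.
move=> h.
have [p [a [b [q [-> szp]]]]] : exists p a b q, s = p ++ [:: a, b & q] /\ size q = k.
  have sz : size (drop (size s - k.+2) s) = k.+2 by rewrite size_drop; lia.
  move: (cat_take_drop (size s - k.+2) s) sz.
  case: (drop _ _) => [|a [|b q]] // <- [sz].
  by exists (take (size s - k.+2) s), a, b, q.
rewrite size_cat /= szp.
have -> : (size p + k.+2 - k.+2 = size p)%N by lia.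
rewrite swp_cat !rev_cat !rev_cons -!cats1 -!catA -szp -(size_rev q) !catA.
by rewrite -!catA /= swp_cat.
Qed.

Lemma act_negrev n i s : size s = n -> (0 < i < n)%N ->
  act (n - i) (negrev s) = negrev (act i s).
Proof.
move=> sz; case: i => // i /andP[_ iN].
have -> : (n - i.+1 = (n - i.+2).+1)%N by lia.
rewrite /= /negrev -map_swp swp_rev ?sz; last by lia.
by congr (map _ (rev (swp _ s))); lia.
Qed.

Lemma des_negrev n i s : size s = n -> (0 < i < n)%N ->
  des (n - i) (negrev s) = des i s.
Proof.
move=> sz; case: i => // i /andP[_ iN].
have -> : (n - i.+1 = (n - i.+2).+1)%N by lia.
rewrite /= /negrev !(nth_map (0 : int)) ?size_rev ?sz; try lia.
rewrite !nth_rev ?sz; try lia.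
rewrite ltrN2; congr (nth _ s _ < nth _ s _); lia.
Qed.

(** A reduced word of an unsigned permutation does not use the generator [s_0]. *)
Lemma redword_unsigned n a : redword n a -> all (fun z => 0 < z) (arr_of n a) ->
  all (fun k => 0 < k)%N a.
Proof.
elim: a => //= k a IH; rewrite redword_cons => /and3P[kn ra nd] pos.
have k0 : (0 < k)%N.
  case: k kn nd pos => // kn nd pos.
  have := invs_ndes (signed_arr n a) kn nd; have := signed_neq0 (signed_arr n a) kn.
  move: nd pos; rewrite /arr_of /= -/(arr_of n a).
  by case: (arr_of n a) => //= z r; rewrite -leNgt => z0 /andP[]; lia.
rewrite k0 /=; apply: IH => //; case: k k0 kn nd pos => // k _ kn nd.
by rewrite /arr_of /= (perm_all _ (perm_swp _ _)).
Qed.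

(** Conjugation by the reversal, on words in [s_1, ..., s_(n-1)]. *)
Definition flip (n : nat) (a : seq nat) : seq nat := [seq (n - k)%N | k <- a].

(** Lengths add up in products of unsigned elements with [v], because [v] has
increasing one-line notation. *)
Lemma redword_flip_vword n a : redword n a -> all (fun k => 0 < k)%N a ->
  redword n (flip n a ++ vword n) /\
  arr_of n (flip n a ++ vword n) = negrev (arr_of n a).
Proof.
elim: a => [|k a IH]; first by move=> _ _; have [] := redword_vword n.
rewrite redword_cons => /and3P[kn ra nd] /= /andP[k0 pos].
have [r e] := IH ra pos; have sz := signed_size (signed_arr n a).
have kk : (0 < k < n)%N by rewrite k0.
split; last by rewrite /arr_of /= -/(arr_of n _) e (act_negrev sz kk).
by rewrite redword_cons r e (des_negrev sz kk) nd andbT; lia.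
Qed.

Definition row_letters (n i : nat) : seq nat := iota i (n - i).
(** A word for the longest unsigned permutation; the row [i] is [i, ..., n - 1], the highest rows come first. *)
Fixpoint rows_word (n r : nat) : seq nat :=
  if r is r'.+1 then row_letters n r ++ rows_word n r' else [::].

Lemma rows_arr n r : (r <= n)%N ->
  arr_of n (rows_word n r) = rev (tail_arr n (n - r)) ++ idarr (n - r) /\
  invs (arr_of n (rows_word n r)) = size (rows_word n r).
Proof.
elim: r => [|r IH] rn.
  by rewrite /arr_of /= invs_id subn0 /tail_arr subnn.
have [e1 e2] := IH (ltnW rn).
have nr : (n - r = (n - r.+1).+1)%N by lia.
have szp : size (rev (tail_arr n (n - r))) = r.
  by rewrite size_rev size_map size_iota; lia.
have e0 : arr_of n (rows_word n r) =
    rev (tail_arr n (n - r)) ++ idarr (n - r.+1) ++ [:: (n - r)%:Z].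
  by rewrite e1 {2}nr idarrS -cats1 nr.
have e3 : arr_of n (rows_word n r.+1) =
    rev (tail_arr n (n - r)) ++ (n - r)%:Z :: idarr (n - r.+1) ++ [::].
  rewrite {1}/arr_of [rows_word n _]/= foldr_cat -/(arr_of n _) e0.
  have := act_move (rev (tail_arr n (n - r))) (idarr (n - r.+1)) (n - r)%:Z [::].
  by rewrite szp size_idarr.
have e4 : rev (tail_arr n (n - r.+1)) = rcons (rev (tail_arr n (n - r))) (n - r)%:Z.
  rewrite tail_arrS; last by lia.
  by rewrite rev_cons -nr.
split; first by rewrite e3 cats0 e4 cat_rcons.
rewrite e3 invs_move; last first.
  by apply/allP => z /mapP[k]; rewrite mem_iota => hk ->; lia.
rewrite -e0 e2 [rows_word n r.+1]/= size_cat size_iota size_idarr addnC //.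
Qed.

Lemma rows_word_longest n : redword n (rows_word n n) /\
  arr_of n (rows_word n n) = rev (idarr n).
Proof.
have [e1 e2] := rows_arr (leqnn n); split.
  rewrite /redword e2 eqxx andbT.
  have H r : (r <= n)%N -> letters n (rows_word n r).
    elim: r => //= r IH rn; rewrite /letters all_cat; apply/andP; split; last by apply: IH; lia.
    by apply/allP => k; rewrite mem_iota => h; change (k < n)%N; lia.
  exact: H.
by rewrite e1 subnn cats0 -(cat0s (tail_arr n 0)) -[[::]]/(idarr 0) -idarr_split.
Qed.

(** * The Fomin-Kirillov construction of double Schubert polynomials *)

Section Hop.
Variables (P : comNzRingType) (n : nat).
Implicit Types (F G : seq int -> P) (w : seq int).

(** A function on one-line notations stands for an element of the nilCoxeter
algebra; [hop (k, c)] is the multiplication by [1 + c u_k]. *)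
Definition hop (p : nat * P) F : seq int -> P :=
  fun w => F w + (if des p.1 w then p.2 * F (act p.1 w) else 0).

Definition hops (l : seq (nat * P)) F : seq int -> P := foldl (fun G p => hop p G) F l.

(** Equality of functions on the words of length [n]. *)
Definition eq_size F G := forall w, size w = n -> F w = G w.

Lemma eqn_sym F G : eq_size F G -> eq_size G F.
Proof. by move=> h w sw; rewrite h. Qed.

Lemma eqn_trans F G H : eq_size F G -> eq_size G H -> eq_size F H.
Proof. by move=> h h' w sw; rewrite h // h'. Qed.

Lemma hop_eqn p F G : eq_size F G -> eq_size (hop p F) (hop p G).
Proof. by move=> h w sw; rewrite /hop !h // size_act. Qed.

Lemma hops_eqn l F G : eq_size F G -> eq_size (hops l F) (hops l G).
Proof. by elim: l F G => //= p l IH F G h; apply/IH/hop_eqn. Qed.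

Lemma hops_cat l l' F : hops (l ++ l') F = hops l' (hops l F).
Proof. exact: foldl_cat. Qed.

Lemma hops_rcons l p F : hops (rcons l p) F = hop p (hops l F).
Proof. by rewrite -cats1 hops_cat. Qed.

Lemma hopC a b (c c' : P) F : (0 < a)%N -> (a.+1 < b)%N -> (b < n)%N ->
  eq_size (hop (a, c) (hop (b, c') F)) (hop (b, c') (hop (a, c) F)).
Proof.
case: a b => [|a] [|b] // _ ab bn w sw; rewrite /hop /=.
have h1 : (a.+1 < size w)%N by lia.
have h2 : (b.+1 < size w)%N by lia.
rewrite !nth_swp // [swp a (swp b w)]swpC //.
have -> : (b.+1 == a) = false by lia.
have -> : (b.+1 == a.+1) = false by lia.
have -> : (b == a) = false by lia.
have -> : (b == a.+1) = false by lia.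
have -> : (a.+1 == b) = false by lia.
have -> : (a.+1 == b.+1) = false by lia.
have -> : (a == b) = false by lia.
have -> : (a == b.+1) = false by lia.
by case: ifP => _; case: ifP => _; ring.
Qed.

Lemma hop_hops a (c : P) l F : (0 < a)%N ->
  all (fun p => (a.+1 < p.1)%N && (p.1 < n)%N) l ->
  eq_size (hop (a, c) (hops l F)) (hops l (hop (a, c) F)).
Proof.
move=> a0; elim: l F => //= -[b c'] l IH F /andP[/andP[/= ab bn] al].
apply: eqn_trans (IH _ al) _; apply: hops_eqn; exact: hopC.
Qed.

(** This uses [u_a^2 = 0]. *)
Lemma hop_add a (c c' : P) F : (0 < a < n)%N ->
  eq_size (hop (a, c) (hop (a, c') F)) (hop (a, c' + c) F).
Proof.
case: a => // a /= an w sw; rewrite /hop /= swpK.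
have h : (a.+1 < size w)%N by lia.
rewrite !nth_swp // !eqxx.
have -> : (a.+1 == a) = false by lia.
by case: ltrgtP => _; ring.
Qed.

(** The Yang-Baxter relation for the factors [1 + c u_a]. *)
Lemma yang_baxter a (c c' : P) F : (0 < a)%N -> (a.+1 < n)%N ->
  eq_size (hop (a, c') (hop (a.+1, c + c') (hop (a, c) F)))
      (hop (a.+1, c) (hop (a, c + c') (hop (a.+1, c') F))).
Proof.
case: a => // a _ an w sw; rewrite /hop /=.
have h1 : (a.+1 < size w)%N by lia.
have h2 : (a.+2 < size w)%N by lia.
rewrite -/(swp a.+1 w) -/(swp a.+1 (swp a w)) -/(swp a.+1 (swp a.+1 w))
  -/(swp a.+1 (swp a (swp a.+1 w))) !swpK (swp_braid h2).
rewrite !nth_swp ?size_swp // !eqxx.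
have e1 : (a == a.+1) = false by lia.
have e2 : (a == a.+2) = false by lia.
have e3 : (a.+1 == a) = false by lia.
have e4 : (a.+2 == a) = false by lia.
have e5 : (a.+1 == a.+2) = false by lia.
have e6 : (a.+2 == a.+1) = false by lia.
rewrite ?(e1, e2, e3, e4, e5, e6).
move: (nth _ w a) (nth _ w a.+1) (nth _ w a.+2) => u v t.
case: (ltrgtP v u) => uv; case: (ltrgtP t v) => vt; case: (ltrgtP t u) => ut; try ring;
  exfalso; lia.
Qed.
End Hop.

(** Ring morphisms act on nilCoxeter products through the parameters. *)
Lemma rmorph_hops (P Q : comNzRingType) (f : {rmorphism P -> Q}) l F w :
  f (hops l F w) = hops [seq (p.1, f p.2) | p <- l] (fun u => f (F u)) w.
Proof.
elim/last_ind: l w => // l p IH w.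
rewrite map_rcons !hops_rcons /hop /= rmorphD IH; congr (_ + _).
by case: ifP => _; rewrite ?rmorph0 // rmorphM IH.
Qed.

Section FominKirillov.
Variables (P : idomainType) (n : nat) (x : nat -> P).
Variables (s : nat -> {rmorphism P -> P}) (d : nat -> P -> P).
Hypothesis ds : divdiff_system n x s d.
Variable y : nat -> P.
Hypothesis hy : forall j, fixed_upto s n (y j).

(** The factors [1 + (v - y_(j-i)) u_j] of the row [i] for [j = n - 1, ..., a], in the order of multiplication. *)
Definition row_part (i a : nat) (v : P) : seq (nat * P) :=
  [seq (j, v - y (j - i)) | j <- rev (iota a (n - a))].

Lemma row_partS i a v : (a < n)%N -> row_part i a v = rcons (row_part i a.+1 v) (a, v - y (a - i)).
Proof. by move=> an; rewrite /row_part -(subnSK an) /= rev_cons map_rcons. Qed.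

Lemma row_part0 i v a : (n <= a)%N -> row_part i a v = [::].
Proof. by move=> na; rewrite /row_part (eqP na). Qed.

(** A factor [1 + (v' - v) u_a] passes through two neighbouring rows and exchanges
their variables, by [yang_baxter] at each step. *)
Lemma rows_exchange i a v v' F : (0 < i)%N -> (i <= a)%N -> (a < n)%N ->
  eq_size n (hop (a, v' - v) (hops (row_part i.+1 a.+1 v') (hops (row_part i a v) F)))
        (hops (row_part i.+1 a.+1 v) (hops (row_part i a v') F)).
Proof.
move=> i0; have [r] := ubnP (n - a)%N; elim: r a => // r IH a ra ia an.
rewrite (row_partS i v an) (row_partS i v' an) !hops_rcons.
have a0 : (0 < a)%N by lia.
move: an; rewrite leq_eqVlt => /orP[/eqP an|an].
  have e0 j u : row_part j a.+1 u = [::] by apply: row_part0; rewrite an.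
  rewrite !e0 /hops /=.
  apply: eqn_trans (hop_add _ _ _ _) _; first by rewrite a0 -an /=.
  by have -> : v - y (a - i)%N + (v' - v) = v' - y (a - i)%N by ring.
rewrite !(row_partS i.+1 _ an) !hops_rcons subSS.
set z := y (a - i)%N.
have al u : all (fun p : nat * P => (a.+1 < p.1)%N && (p.1 < n)%N) (row_part i.+1 a.+2 u).
  by apply/allP => p /mapP[j]; rewrite mem_rev mem_iota => hj -> /=; lia.
set G := hops (row_part i a.+1 v) F.
set G' := hops (row_part i a.+1 v') F.
have step u H : eq_size n (hops (row_part i.+1 a.+2 u) (hop (a, v - z) H))
    (hop (a, v - z) (hops (row_part i.+1 a.+2 u) H)).
  by apply/eqn_sym/hop_hops.
have step' u H : eq_size n (hops (row_part i.+1 a.+2 u) (hop (a, v' - z) H))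
    (hop (a, v' - z) (hops (row_part i.+1 a.+2 u) H)).
  by apply/eqn_sym/hop_hops.
apply: eqn_trans (hop_eqn _ (hop_eqn _ (step _ _))) _.
have -> : v' - z = v - z + (v' - v) by ring.
apply: eqn_trans (yang_baxter _ _ _ a0 an) _.
have -> : v - z + (v' - v) = v' - z by ring.
apply: hop_eqn; apply: eqn_trans (eqn_sym (step' _ _)).
by apply: hop_eqn; apply: IH => //; lia.
Qed.

(** The factors of the first [m] rows; the variable of the row [i] is the one numbered [i - 1]. *)
Definition all_rows (m : nat) : seq (nat * P) :=
  flatten [seq row_part i i (x i.-1) | i <- iota 1 m].

(** The unit of the nilCoxeter algebra. *)
Definition delta0 (w : seq int) : P := (w == idarr n)%:R.

(** The coefficients of the product of all rows. *)
Definition FK (w : seq int) : P := hops (all_rows n) delta0 w.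

(** The action of [s_k] on the parameters of the factors. *)
Definition smap k (l : seq (nat * P)) := [seq (p.1, s k p.2) | p <- l].

Lemma smap_row k i a v : (k < n)%N -> smap k (row_part i a v) = row_part i a (s k v).
Proof.
move=> kn; rewrite /smap /row_part -map_comp; apply: eq_map => j /=.
by rewrite rmorphB hy.
Qed.

Lemma iota_split k : (0 < k < n)%N ->
  iota 1 n = iota 1 k.-1 ++ [:: k, k.+1 & iota k.+2 (n - k.+1)].
Proof.
move=> kn; have {1}-> : n = (k.-1 + (2 + (n - k.+1)))%N by lia.
rewrite iotaD; congr (_ ++ _); rewrite /= add1n prednK //; lia.
Qed.

(** The exchange of [x_(k-1)] and [x_k] amounts to one more factor. *)
Lemma FK_sym k w : (0 < k < n)%N -> size w = n ->
  FK w + (if des k w then (x k - x k.-1) * FK (act k w) else 0) = s k (FK w).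
Proof.
move=> kn sw; have kn' : (k < n)%N by lia.
have [k' ek] : exists k', k = k'.+1 by exists k.-1; lia.
set pre := flatten [seq row_part i i (x i.-1) | i <- iota 1 k.-1].
set post := flatten [seq row_part i i (x i.-1) | i <- iota k.+2 (n - k.+1)].
have eall : all_rows n = pre ++ row_part k k (x k.-1) ++ row_part k.+1 k.+1 (x k) ++ post.
  by rewrite /all_rows (iota_split kn) map_cat flatten_cat.
have smapf l : (forall i, i \in l -> (0 < i <= n)%N && (i != k) && (i != k.+1)) ->
   smap k (flatten [seq row_part i i (x i.-1) | i <- l]) =
   flatten [seq row_part i i (x i.-1) | i <- l].
  elim: l => //= i l IH h; rewrite /smap map_cat -/(smap _ _) -/(smap _ _) smap_row //.
  have := h i (mem_head _ _) => hi; rewrite (ds_sx ds) //; try lia.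
  by rewrite IH // => j jl; apply: h; rewrite in_cons jl orbT.
rewrite -[LHS]/(hop (k, x k - x k.-1) FK w) /FK rmorph_hops -/(smap k _).
have -> : hops (smap k (all_rows n)) (fun w => s k (delta0 w)) w =
    hops (smap k (all_rows n)) delta0 w.
  apply: (@hops_eqn _ n) => // u _; exact: rmorph_nat.
rewrite eall /smap !map_cat -!/(smap _ _) !smap_row // !smapf; first last.
- by move=> i; rewrite mem_iota; lia.
- by move=> i; rewrite mem_iota; lia.
have -> : s k (x k.-1) = x k by rewrite ek (ds_sl ds) // -ek.
have -> : s k (x k) = x k.-1 by rewrite ek (ds_sr ds) // -ek.
rewrite !hops_cat.
set F := hops pre delta0.
suff H : eq_size n (hop (k, x k - x k.-1) (hops post (hops (row_part k.+1 k.+1 (x k)) (hops (row_part k k (x k.-1)) F))))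
  (hops post (hops (row_part k.+1 k.+1 (x k.-1)) (hops (row_part k k (x k)) F))) by apply: H.
apply: eqn_trans (hop_hops _ _ _ _) _; first by lia.
  apply/allP => p /flatten_mapP[i]; rewrite mem_iota => hi /mapP[j].
  by rewrite mem_rev mem_iota => hj -> /=; lia.
by apply: hops_eqn; apply: rows_exchange => //; lia.
Qed.

(** Divided differences act on the coefficients by going down in length. *)
Lemma d_FK k w : (0 < k < n)%N -> size w = n ->
  d k (FK w) = if des k w then FK (act k w) else 0.
Proof.
move=> kn sw; apply: (d_uniq ds); first by lia.
rewrite -(FK_sym kn sw); case: k kn => // k kn /=.
by case: ifP => _; ring.
Qed.

(** A product of [r] factors has no coefficients at length above [r]; at length [r]
its coefficient at the product of the letters, if these form a reduced word, is
the product of all parameters. *)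
Lemma hops_len l w : all (fun p : nat * P => p.1 < n)%N l -> signed_word n w ->
  ((size l < invs w)%N -> hops l delta0 w = 0) /\ (invs w = size l -> w = foldl (fun u p => act p.1 u) (idarr n) l ->
   hops l delta0 w = \prod_(p <- l) p.2).
Proof.
elim/last_ind: l w => [|l [k c] IH] w.
  move=> _ _; rewrite /hops /= /delta0 big_nil; split; last by move=> _ ->; rewrite eqxx.
  by case: eqP => // ->; rewrite invs_id.
rewrite all_rcons => /andP[/= kn al] sw.
have [h1 _] := IH w al sw; have [h2 h3] := IH (act k w) al (signed_act k sw).
rewrite hops_rcons size_rcons /hop /= big_rcons /=; split=> [lt|e1 e2].
  rewrite h1 ?add0r; last by lia.
  case: ifP => // dk; rewrite h2 ?mulr0 //.
  by have := invs_des sw kn dk; lia.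
rewrite h1 ?add0r; last by lia.
have eact : act k w = foldl (fun u p => act p.1 u) (idarr n) l.
  by rewrite e2 -cats1 foldl_cat /= actK.
have le : (invs (act k w) <= size l)%N.
  rewrite eact -(revK l) foldl_rev size_rev.
  have := @invs_foldr_le n (idarr n) [seq p.1 | p <- rev l] (signed_id n).
  rewrite size_map size_rev invs_id addn0 foldr_map; apply.
  by rewrite /letters all_map all_rev.
have dk : des k w.
  by apply: contraT => nd; have := invs_ndes sw kn nd; lia.
rewrite dk h3 //; last by have := invs_des sw kn dk; lia.
by rewrite mulrC.
Qed.

(** The coefficient at the longest unsigned permutation is Delta. *)
Lemma FK_top : FK (rev (idarr n)) = stair x y n.
Proof.
have [r e] := rows_word_longest n.
have el m : [seq p.1 | p <- all_rows m] = rev (rows_word n m).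
  elim: m => // m IH; rewrite /all_rows iota1S map_rcons flatten_rcons map_cat IH /=.
  rewrite rev_cat; congr (_ ++ _); rewrite /row_part -map_comp /=.
  by rewrite map_id_in.
have al : all (fun p : nat * P => p.1 < n)%N (all_rows n).
  rewrite -(all_map fst (ltn^~ n)) el all_rev.
  by case/andP: r.
have sw : signed_word n (rev (idarr n)) by rewrite -e; apply: signed_arr.
rewrite /FK; have [_ ->] := hops_len al sw; last 2 first.
- rewrite -e; case/andP: r => _ /eqP <-.
  by rewrite -[in RHS](size_map fst) el size_rev.
- rewrite -e /arr_of -[rows_word n n]revK -el -(foldl_rev (fun u k => act k u)) revK.
  elim: (all_rows n) (idarr n) => //= p l IH u; exact: IH.
have pr m : (m <= n)%N -> \prod_(p <- all_rows m) p.2 = \prod_(i < m) \prod_(j < n - i.+1) (x i - y j).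
  elim: m => [|m IH] mn; first by rewrite big_nil big_ord0.
  rewrite /all_rows iota1S map_rcons flatten_rcons big_cat IH ?(ltnW mn) // big_ord_recr /=.
  congr (_ * _); rewrite big_map (perm_big (iota m.+1 (n - m.+1))); last by rewrite perm_rev.
  have -> : iota m.+1 (n - m.+1) = [seq (m.+1 + j)%N | j <- index_iota 0 (n - m.+1)].
    by rewrite /index_iota subn0 -iotaDl addn0.
  by rewrite big_map big_mkord; apply: eq_bigr => j _; rewrite addKn.
by rewrite pr.
Qed.

(** The effect on one-line notations of multiplying by the longest unsigned permutation. *)
Definition comp_arr (u : seq int) : seq int := [seq n.+1%:Z - z | z <- u].

Lemma comp_idarr : comp_arr (idarr n) = rev (idarr n).
Proof.
apply: (@eq_from_nth _ 0); first by rewrite size_rev size_map.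
rewrite size_map size_idarr => i iN.
rewrite nth_rev ?size_idarr // (nth_map 0) ?size_idarr //.
rewrite !(nth_map 0%N) ?size_iota ?nth_iota //; lia.
Qed.

(** The type A double Schubert polynomials are the coefficients [FK]. *)
Lemma dword_FK a : redword n a -> all (fun k => 0 < k)%N a ->
  dword d a (FK (rev (idarr n))) = FK (comp_arr (arr_of n a)).
Proof.
elim: a => [|k a IH]; first by rewrite /= comp_idarr.
rewrite redword_cons => /and3P[kn ra nd] /= /andP[k0 pos].
have sa := signed_arr n a; have sz := signed_size sa.
rewrite IH // d_FK ?size_map ?sz //; last by rewrite k0.
have -> : act k (comp_arr (arr_of n a)) = comp_arr (arr_of n (k :: a)).
  by case: k k0 {kn nd} => // k _; rewrite /comp_arr /arr_of /= map_swp.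
suff -> : des k (comp_arr (arr_of n a)) by [].
case: k k0 kn nd => // k _ kn /=; rewrite -leNgt /comp_arr.
rewrite !(nth_map (0 : int)) ?sz //; last exact: ltnW.
have ne : k != k.+1 by rewrite neq_ltn ltnSn.
by have /eqP := signed_neq sa (ltnW kn) kn ne; lia.
Qed.
End FominKirillov.

(** * The signs of the perfect matchings add up to one *)

Section Matching.
Variable m : nat.
Implicit Types (s : 'S_m.*2) (i j q : 'I_m) (p : 'I_m.*2).

(** Every position is an even or an odd one. *)
Lemma posP p : exists q, p = even_pos q \/ p = odd_pos q.
Proof.
have h : (p./2 < m)%N by rewrite -ltn_double; have := ltn_ord p; lia.
exists (Ordinal h); case: (boolP (odd p)) => op; [right|left]; apply: val_inj => /=; lia.
Qed.

Lemma matching_lt s i : matching s -> (s (even_pos i) < s (odd_pos i))%N.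
Proof. by case/andP => /forallP h _; apply: h. Qed.

Lemma matching_mono s i j : matching s -> (i < j)%N -> (s (even_pos i) < s (even_pos j))%N.
Proof. by case/andP => _ /forallP/(_ i)/forallP/(_ j)/implyP h; apply: h. Qed.

(** The pair [i] closes at the same letter as in the matching of consecutive letters, which is the identity. *)
Definition fixed_odd s i := s (odd_pos i) == odd_pos i.

(** As long as the pairs close as in the identity, they also open as in the identity. *)
Lemma matching_even s i : matching s -> (forall j, (j < i)%N -> fixed_odd s j) ->
  s (even_pos i) = even_pos i.
Proof.
move=> ms; have [k] := ubnP (val i); elim: k i => // k IH i ik fo.
have ev j : (j < i)%N -> s (even_pos j) = even_pos j.
  by move=> ji; apply: IH => [|l lj]; [move: ik ji => /=; lia | apply: fo; lia].
have small p : (s p < i.*2)%N -> s p = p.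
  move=> h; have [q [e|e]] := posP (s p); rewrite e /= in h.
    have qi : (q < i)%N by lia.
    by have := ev _ qi; rewrite -e => /perm_inj.
  have qi : (q < i)%N by lia.
  by have /eqP := fo _ qi; rewrite -e => /perm_inj.
pose p := (s^-1)%g (even_pos i); have ep : s p = even_pos i by rewrite permKV.
have [q [e|e]] := posP p; rewrite e in ep.
  case: (ltngtP q i) => qi.
  - by have := ev _ qi; rewrite ep => /(congr1 val) /=; lia.
  - have := matching_mono ms qi; rewrite ep => h.
    have := small _ h; move/(congr1 val) => /= e1.
    by move: h; rewrite e1 /=; lia.
  - by move: ep; rewrite (val_inj qi).
have := matching_lt q ms; rewrite ep => h.
have := small _ h; move/(congr1 val) => /= e1.
have qi : (q < i)%N by move: h; rewrite e1 /=; lia.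
by have /eqP := fo _ qi; rewrite ep => /(congr1 val) /=; lia.
Qed.

(** The first pair that does not close as in the identity. *)
Definition first_bad s i := ~~ fixed_odd s i && [forall j : 'I_m, (j < i)%N ==> fixed_odd s j].

Lemma first_bad_uniq s i i' : first_bad s i -> first_bad s i' -> i = i'.
Proof.
move=> /andP[n1 /forallP h1] /andP[n2 /forallP h2]; apply: val_inj.
case: (ltngtP i i') => // h.
  by have := h2 i; rewrite h (negPf n1).
by have := h1 i'; rewrite h (negPf n2).
Qed.

(** The letter after the opening of the first bad pair opens another pair. *)
Lemma first_bad_next s i : matching s -> first_bad s i ->
  exists q, [/\ (i < q)%N, s (even_pos q) = odd_pos i &
    (i.*2.+1 < s (odd_pos i))%N && (i.*2.+1 < s (odd_pos q))%N].
Proof.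
move=> ms /andP[ni /forallP fo].
have fo' j : (j < i)%N -> fixed_odd s j by move=> ji; have := fo j; rewrite ji.
have ev j : (j <= i)%N -> s (even_pos j) = even_pos j.
  by move=> ji; apply: matching_even => // l lj; apply: fo'; lia.
have small p : (s p < i.*2.+1)%N -> s p = p.
  move=> h; have [q [e|e]] := posP (s p); rewrite e /= in h.
    have qi : (q <= i)%N by lia.
    by have := ev _ qi; rewrite -e => /perm_inj.
  have qi : (q < i)%N by lia.
  by have /eqP := fo' _ qi; rewrite -e => /perm_inj.
pose p := (s^-1)%g (odd_pos i); have ep : s p = odd_pos i by rewrite permKV.
have [q [e|e]] := posP p; rewrite e in ep; last first.
  have := matching_lt q ms; rewrite ep => h.
  have := small _ h; move/(congr1 val) => /= e1.
  have qi : (q <= i)%N by move: h; rewrite e1 /=; lia.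
  have [qi'|qi'] := ltnP q i.
    by have /eqP := fo' _ qi'; rewrite ep => /(congr1 val) /=; lia.
  have eqi : q = i by apply: val_inj => /=; lia.
  by move: ni; rewrite /fixed_odd -eqi ep eqi eqxx.
have iq : (i < q)%N.
  rewrite ltnNge; apply/negP => qi; have := ev _ qi.
  by rewrite ep => /(congr1 val) /=; lia.
exists q; split=> //; apply/andP; split.
  rewrite ltn_neqAle; apply/andP; split.
    by apply: contraNneq ni => h; rewrite /fixed_odd; apply/eqP/val_inj; rewrite /= -h.
  rewrite ltnNge -ltnS; apply/negP => h; have := small _ h.
  by move/(congr1 val) => /= e1; move: h; rewrite e1 /=; lia.
by have := matching_lt q ms; rewrite ep.
Qed.

(** The sign-reversing involution on the matchings other than the identity:
the first bad pair and the pair opening at the next letter exchange their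
closing letters. *)
Definition swap_pairs s : 'S_m.*2 :=
  if [pick i | first_bad s i] is Some i then
    if [pick q | s (even_pos q) == odd_pos i] is Some q then (tperm (odd_pos i) (odd_pos q) * s)%g
    else s
  else s.

Lemma even_odd_neq i q : odd_pos i != even_pos q.
Proof. by rewrite -val_eqE /=; lia. Qed.

Lemma odd_pos_inj : injective (@odd_pos m).
Proof. by move=> i j /(congr1 val) /= h; apply: val_inj => /=; lia. Qed.

Lemma even_pos_inj : injective (@even_pos m).
Proof. by move=> i j /(congr1 val) /= h; apply: val_inj => /=; lia. Qed.

Lemma swap_pairsE s i q : first_bad s i -> s (even_pos q) = odd_pos i ->
  swap_pairs s = (tperm (odd_pos i) (odd_pos q) * s)%g.
Proof.
move=> fi eq; rewrite /swap_pairs; case: pickP => [i' fi'|/(_ i)]; last by rewrite fi.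
rewrite -(first_bad_uniq fi fi'); case: pickP => [q' /eqP|/(_ q)]; last by rewrite eq eqxx.
by rewrite -eq => /perm_inj/even_pos_inj ->.
Qed.

Lemma nobad s : matching s -> (forall i, ~~ first_bad s i) -> s = 1%g.
Proof.
move=> ms nb.
have fo i : fixed_odd s i.
  have [k] := ubnP (val i); elim: k i => // k IH i ik.
  have := nb i; rewrite negb_and negbK => /orP[//|/forallPn[j]].
  by rewrite negb_imply => /andP[ji]; rewrite IH //; move: ik ji => /=; lia.
apply/permP => p; rewrite perm1; have [q [->|->]] := posP p; last exact/eqP/fo.
by apply: matching_even.
Qed.

Lemma swap_pairs_facts s : matching s -> s != 1%g ->
  [/\ matching (swap_pairs s), swap_pairs s != 1%g, swap_pairs (swap_pairs s) = s &
   (swap_pairs s : bool) = ~~ s].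
Proof.
move=> ms s1.
have [i fi] : exists i, first_bad s i.
  apply/existsP; apply: contraT => /existsPn nb.
  by rewrite (nobad ms nb) eqxx in s1.
have [q [iq eq /andP[h1 h2]]] := first_bad_next ms fi.
rewrite (swap_pairsE fi eq); set t := (_ * s)%g.
have te j : t (even_pos j) = s (even_pos j) by rewrite permM tpermD // even_odd_neq.
have ti : t (odd_pos i) = s (odd_pos q) by rewrite permM tpermL.
have tq : t (odd_pos q) = s (odd_pos i) by rewrite permM tpermR.
have tj j : j != i -> j != q -> t (odd_pos j) = s (odd_pos j).
  by move=> ji jq; rewrite permM tpermD // (inj_eq odd_pos_inj) eq_sym.
have iqn : i != q by rewrite -val_eqE /=; lia.
case/andP: (fi) => ni /forallP fo.
have fit : first_bad t i.
  apply/andP; split.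
    by rewrite /fixed_odd ti -eq (inj_eq perm_inj) even_odd_neq.
  apply/forallP => j; apply/implyP => ji; have := fo j; rewrite ji /= /fixed_odd tj //.
    by rewrite -val_eqE /=; lia.
  by rewrite -val_eqE /=; lia.
have teq : t (even_pos q) = odd_pos i by rewrite te.
have evi : s (even_pos i) = even_pos i.
  by apply: matching_even => // j ji; have := fo j; rewrite ji.
split.
- apply/andP; split; apply/forallP => j; last first.
    by apply/forallP => l; apply/implyP => jl; rewrite !te; apply: matching_mono.
  rewrite te; case: (eqVneq j i) => [->|ji]; first by rewrite ti evi /=; lia.
  case: (eqVneq j q) => [->|jq]; first by rewrite tq eq /=; lia.
  by rewrite tj //; apply: matching_lt.
- by apply: contraTneq fit => ->; rewrite /first_bad /fixed_odd perm1 eqxx.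
- by rewrite (swap_pairsE fit teq) /t mulgA tperm2 mul1g.
by rewrite odd_permM odd_tperm (inj_eq odd_pos_inj) iqn.
Qed.

Lemma matching1 : matching (1 : 'S_m.*2)%g.
Proof.
apply/andP; split; apply/forallP => j; first by rewrite !perm1 /=.
by apply/forallP => l; apply/implyP => jl; rewrite !perm1 /= ltn_double.
Qed.

Lemma matching_sign_int : \sum_(s : 'S_m.*2 | matching s) (-1) ^+ (s : bool) = 1 :> int.
Proof.
rewrite (bigD1 1%g) ?matching1 //= odd_perm1 expr0.
(* the remaining matchings cancel in pairs *)
set X := \sum_(_ | _) _; suff : X = - X by move=> h; have -> : X = 0 by lia.
rewrite {1}/X (reindex_onto swap_pairs swap_pairs) /=; last first.
  by move=> s /andP[ms s1]; have [] := swap_pairs_facts ms s1.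
rewrite -sumrN; apply: eq_big => [s|s /andP[/andP[ms s1] /eqP e]].
  apply/idP/idP => [/andP[/andP[ms s1] /eqP e]|/andP[ms s1]].
    by have [] := swap_pairs_facts ms s1; rewrite e => -> ->.
  by have [-> -> -> _] := swap_pairs_facts ms s1; rewrite eqxx.
have [_ _ _] := swap_pairs_facts ms s1; rewrite e => ->.
by case: (odd_perm _) => //=; rewrite ?expr0 ?expr1 ?opprK.
Qed.

(** The Pfaffian of the matrix with all entries 1 above the diagonal is 1. *)
Lemma matching_sign (R : comNzRingType) :
  \sum_(s : 'S_m.*2 | matching s) (-1) ^+ (s : bool) = 1 :> R.
Proof.
have := congr1 (fun z : int => z%:~R : R) matching_sign_int.
rewrite rmorph_sum rmorph1 => e; rewrite -[RHS]e; apply: eq_bigr => s _.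
by rewrite /= rmorph_sign.
Qed.
End Matching.

(** * The functional on Q-tilde polynomials *)

(** A product over the positions of a matching, grouped in pairs. *)
Lemma big_pairs (T : Type) (idx : T) (op : Monoid.com_law idx) m (F : 'I_m.*2 -> T) :
  \big[op/idx]_(p < m.*2) F p =
  \big[op/idx]_(i < m) op (F (even_pos i)) (F (odd_pos i)).
Proof.
have lt (p : 'I_m.*2) : (p./2 < m)%N by rewrite -ltn_double; have := ltn_ord p; lia.
pose half (p : 'I_m.*2) := Ordinal (lt p).
rewrite (bigID (fun p : 'I_m.*2 => ~~ odd p)) /= big_split; congr (op _ _).
  rewrite (reindex (@even_pos m)) /=; last first.
    by exists half => [i _|p]; [|rewrite inE => po]; apply: val_inj => /=; lia.
  by apply: eq_bigl => i; rewrite odd_double.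
rewrite (reindex (@odd_pos m)) /=; last first.
  by exists half => [i _|p]; [|rewrite inE negbK => po]; apply: val_inj => /=; lia.
by apply: eq_bigl => i; rewrite odd_double.
Qed.

(** Padding a word with zeros does not matter. *)
Lemma big_pad (T : Type) (idx : T) (op : Monoid.com_law idx) (F : nat -> T) la N :
  (size la <= N)%N -> F 0%N = idx ->
  \big[op/idx]_(p < N) F (nth 0%N la p) = \big[op/idx]_(k <- la) F k.
Proof.
move=> le F0; rewrite (big_nth 0%N) -(big_mkord xpredT (fun p => F (nth 0%N la p))).
rewrite (big_cat_nat (n := size la)) //= [X in op _ X]big_nat_cond [X in op _ X]big1 ?Monoid.mulm1 //.
by move=> i /andP[/andP[h _] _]; rewrite nth_default.
Qed.

Section Pfaffian.
Variables (P : idomainType) (n : nat) (x : nat -> P).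
Variables (s : nat -> {rmorphism P -> P}) (d : nat -> P -> P).
Hypothesis ds : divdiff_system n x s d.
Variable y : nat -> P.
Hypothesis hy : forall j, fixed_upto s n (y j).
Variable iota_X : {rmorphism {mpoly rat[n]} -> P}.
Hypothesis iota_mesym : forall k, iota_X (mesym n rat k) = elem x n k.
Local Notation phi := (phi x d y n).
Local Notation elems := (elems x n).
Local Notation e := (elem x n).

(** The coefficients of [Qt2 a b] as a combination of the [e_(a+k) e_(b-k)],
extended by zero to all [k]. *)
Definition qcoef (b k : nat) : P :=
  if k == 0%N then 1 else if (k <= b)%N then 2%:R * (-1) ^+ k else 0.

Lemma qcoef_fixed b k : fixed_upto s n (qcoef b k).
Proof.
move=> j _; rewrite /qcoef; case: ifP => _; first by rewrite rmorph1.
by case: ifP => _; rewrite ?rmorph0 // rmorphM rmorph_nat rmorph_sign.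
Qed.

Lemma iota_Qt2 a b : (b <= n)%N ->
  iota_X (Qt2 n a b) = \sum_(k < n.+1) qcoef b k * (e (a + k) * e (b - k)).
Proof.
move=> bn; rewrite /Qt2 rmorphD rmorphM !iota_mesym big_ord_recl /qcoef /= mul1r addn0 subn0.
congr (_ + _); rewrite rmorphM rmorph_nat rmorph_sum /= big_add1 big_mkord.
rewrite (big_ord_widen n (fun k => iota_X ((-1) ^+ k.+1 * (mesym n rat (a + k.+1) * mesym n rat (b - k.+1))))) //.
rewrite mulr_sumr big_mkcond /=; apply: eq_bigr => k _.
rewrite /bump /= add1n; case: ifP => _; last by rewrite mul0r.
by rewrite !rmorphM rmorph_sign !iota_mesym mulrA.
Qed.

Section Partition.
Variable la : seq nat.
Hypothesis la_sorted : sorted gtn la.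
Hypothesis la_bound : all (fun k => 0 < k <= n)%N la.
Let m := uphalf (size la).
Local Notation pt p := (nth 0%N la p).

Lemma la_le p : (pt p <= n)%N.
Proof.
case: (ltnP p (size la)) => h; last by rewrite nth_default.
by have /andP[] := allP la_bound _ (mem_nth 0%N h).
Qed.

Lemma size_la_le : (size la <= m.*2)%N.
Proof. by rewrite /m; lia. Qed.

Lemma la_lt p q : (p < q)%N -> (q < m.*2)%N -> (pt q < pt p)%N.
Proof.
move=> pq qm; have pr : (p < size la)%N by move: qm; rewrite /m; lia.
case: (ltnP q (size la)) => h; last first.
  by rewrite [pt q]nth_default //; have /andP[] := allP la_bound _ (mem_nth 0%N pr).
have tr : transitive gtn by move=> a b c /= h1 h2; apply: ltn_trans h2 h1.
exact: (sorted_ltn_nth tr 0%N la_sorted p q pr h pq).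
Qed.

(** The indices of the elementary symmetric polynomials in the term given by the
matching [t] and by the choice [f] of a summand in each factor [Qt2]. *)
Definition term_seq (t : 'S_m.*2) (f : {ffun 'I_m -> 'I_n.+1}) : seq nat :=
  flatten [seq [:: (pt (t (even_pos i)) + f i)%N; (pt (t (odd_pos i)) - f i)%N] | i <- enum 'I_m].

(** The full expansion of the Pfaffian. *)
Lemma iota_Qt : iota_X (Qt n la) =
  \sum_(t : 'S_m.*2 | matching t) \sum_(f : {ffun 'I_m -> 'I_n.+1})
    ((-1) ^+ (t : bool) * \prod_i qcoef (pt (t (odd_pos i))) (f i)) * elems (term_seq t f).
Proof.
rewrite /Qt /pfaffian rmorph_sum; apply: eq_bigr => t mt.
rewrite rmorphM rmorph_sign rmorph_prod /=.
under eq_bigr => i _ do rewrite iota_Qt2 ?la_le //.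
rewrite bigA_distr_bigA /= mulr_sumr; apply: eq_bigr => f _.
rewrite big_split /= mulrA; congr (_ * _).
rewrite /elems /term_seq big_flatten /= big_map big_enum /=.
by apply: eq_bigr => i _; rewrite !big_cons big_nil mulr1.
Qed.

Lemma sum_term (g : nat -> nat) t f :
  sumn [seq g k | k <- term_seq t f] =
  (\sum_(i < m) (g (pt (t (even_pos i)) + f i)%N + g (pt (t (odd_pos i)) - f i)%N))%N.
Proof.
rewrite sumnE big_map /term_seq big_flatten /= big_map big_enum /=.
by apply: eq_bigr => i _; rewrite !big_cons big_nil addn0.
Qed.

Lemma sum_pt (g : nat -> nat) (t : 'S_m.*2) : g 0%N = 0%N ->
  (\sum_(i < m) (g (pt (t (even_pos i))) + g (pt (t (odd_pos i)))))%N = sumn [seq g k | k <- la].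
Proof.
move=> g0; rewrite sumnE big_map -(big_pad _ size_la_le g0) /=.
by rewrite [RHS](reindex_inj (@perm_inj _ t)) /= big_pairs.
Qed.

Lemma nzc_sum a : nzc a = sumn [seq (k != 0)%N : nat | k <- a].
Proof. by elim: a => //= k a ->. Qed.

Lemma pair_lt (t : 'S_m.*2) i : matching t -> (pt (t (odd_pos i)) < pt (t (even_pos i)))%N.
Proof. by move=> mt; apply: la_lt; [apply: matching_lt | apply: ltn_ord]. Qed.

Lemma nzc_term t f : matching t -> (nzc (term_seq t f) <= size la)%N.
Proof.
move=> mt; rewrite nzc_sum sum_term.
have -> : size la = sumn [seq (k != 0)%N : nat | k <- la].
  by elim: (la) la_bound => //= k r IH /andP[k0 /IH <-]; case: k k0.
rewrite -(sum_pt (g := fun k => (k != 0)%N) t) //; apply: leq_sum => i _.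
have := pair_lt i mt; case: (pt _) => [|b]; case: (pt _) => [|a] //= _.
by case: (_ != 0)%N.
Qed.

(** Every choice of a summand other than the main ones raises the sum of squares. *)
Lemma sqsum_term (t : 'S_m.*2) (f : {ffun 'I_m -> 'I_n.+1}) : matching t -> (forall i, f i <= pt (t (odd_pos i)))%N ->
  (sqsum la + \sum_i f i <= sqsum (term_seq t f))%N.
Proof.
move=> mt fle; rewrite /sqsum (sum_term (fun k => k ^ 2)%N) -(sum_pt (g := fun k => (k ^ 2)%N) t) //.
rewrite -big_split /=; apply: leq_sum => i _; have := pair_lt i mt; have := fle i.
move: (pt (t (even_pos i))) (pt (t (odd_pos i))) (nat_of_ord (f i)) => a b k kb ab.
have [c eb] : exists c, b = (c + k)%N by exists (b - k)%N; lia.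
by subst b; rewrite addnK; nia.
Qed.

Lemma coef_zero (t : 'S_m.*2) (f : {ffun 'I_m -> 'I_n.+1}) :
  ~~ [forall i, f i <= pt (t (odd_pos i))]%N -> \prod_i qcoef (pt (t (odd_pos i))) (f i) = 0.
Proof.
case/forallPn => i; rewrite -ltnNge => h; rewrite (bigD1 i) //= /qcoef.
have -> : (f i == 0%N :> nat) = false by lia.
by rewrite leqNgt h /= mul0r.
Qed.

Lemma coef_fixed (t : 'S_m.*2) (f : {ffun 'I_m -> 'I_n.+1}) :
  fixed_upto s n ((-1) ^+ (t : bool) * \prod_i qcoef (pt (t (odd_pos i))) (f i)).
Proof.
move=> j jn; rewrite rmorphM rmorph_sign rmorph_prod; congr (_ * _).
by apply: eq_bigr => i _; apply: qcoef_fixed.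
Qed.

Lemma phi_iota_Qt : phi (iota_X (Qt n la)) =
  \sum_(t : 'S_m.*2 | matching t) \sum_(f : {ffun 'I_m -> 'I_n.+1})
    ((-1) ^+ (t : bool) * \prod_i qcoef (pt (t (odd_pos i))) (f i)) * phi (elems (term_seq t f)).
Proof.
rewrite iota_Qt (phi_sum ds) //; apply: eq_bigr => t _.
rewrite (phi_sum ds) //; apply: eq_bigr => f _.
by rewrite (phiZ ds _ _ (leqnn n) (coef_fixed t f)).
Qed.

(** Partitions with fewer than [n] parts are killed. *)
Lemma phi_Qt_small : (size la < n)%N -> phi (iota_X (Qt n la)) = 0.
Proof.
move=> lt; rewrite phi_iota_Qt big1 // => t mt; rewrite big1 // => f _.
by rewrite (phi_few ds) ?mulr0 //; apply: leq_ltn_trans (nzc_term f mt) lt.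
Qed.

(** For the staircase partition only the main summands survive, by [phi_zero], and
each matching contributes its sign. *)
Lemma phi_Qt_rho : perm_eq la (iota 1 n) ->
  phi (iota_X (Qt n la)) = phi (elems (iota 1 n)).
Proof.
move=> pla; rewrite phi_iota_Qt.
have szla : size la = n by rewrite (perm_size pla) size_iota.
(* the right-hand side is multiplied by the sum of the signs of the matchings, which is 1 *)
rewrite -[RHS]mul1r -[X in _ = X * _](matching_sign m) mulr_suml; apply: eq_bigr => t mt.
rewrite (bigD1 [ffun=> ord0]) //= [X in _ + X]big1 ?addr0 => [|f f0].
  rewrite [\prod_i qcoef _ _]big1 ?mulr1 => [|i _]; last by rewrite ffunE.
  congr (_ * phi _); rewrite -(elems_perm _ _ pla) /elems -(big_pad _ size_la_le (elem0 x n)) /=.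
  rewrite [RHS](reindex_inj (@perm_inj _ t)) /= big_pairs /= /term_seq big_flatten /= big_map big_enum /=.
  by apply: eq_bigr => i _; rewrite !big_cons big_nil mulr1 ffunE addn0 subn0.
have [/forallP fle|] := boolP [forall i, f i <= pt (t (odd_pos i))]%N; last first.
  by move/coef_zero => ->; rewrite mulr0 mul0r.
rewrite (phi_zero ds) ?mulr0 //; first by apply: leq_trans (nzc_term f mt) _; rewrite szla.
right; apply: leq_trans (sqsum_term mt fle).
rewrite (sqsum_perm pla) -[X in (X < _)%N]addn0 ltn_add2l lt0n.
apply: contra_neq f0 => /eqP; rewrite sum_nat_eq0 => /forallP h.
by apply/ffunP => i; rewrite ffunE; apply/val_inj/eqP; have := h i.
Qed.
End Partition.
End Pfaffian.

(** * Signed permutations and their integer words *)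

(** Letters as nonzero integers. *)
Definition letter_val n (u : letter n) : int :=
  if u.1 then - (u.2.+1)%:Z else (u.2.+1)%:Z.

(** The one-line notation of the inverse of [w]. *)
Definition arr n (w : {perm letter n}) : seq int :=
  [seq letter_val ((w^-1)%g (false, i)) | i <- enum 'I_n].

Lemma letter_val_inj n : injective (@letter_val n).
Proof.
move=> [b i] [c j]; rewrite /letter_val /= => e.
have [eb ei] : b = c /\ i = j :> nat by case: b c e => [] [] e; split=> //; lia.
by rewrite eb (val_inj ei).
Qed.

Lemma letter_val_bar n (u : letter n) : letter_val (bar u) = - letter_val u.
Proof. by case: u => [[] i]; rewrite /letter_val /= ?opprK. Qed.

Lemma size_arr n (w : {perm letter n}) : size (arr w) = n.
Proof. by rewrite size_map size_enum_ord. Qed.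

Lemma nth_arr n (w : {perm letter n}) (i : 'I_n) :
  nth (0 : int) (arr w) i = letter_val ((w^-1)%g (false, i)).
Proof. by rewrite (nth_map i) ?size_enum_ord // nth_ord_enum. Qed.

Lemma is_signed_inv n (w : {perm letter n}) : is_signed w -> is_signed (w^-1)%g.
Proof. by move=> h u; apply: (@perm_inj _ w); rewrite h !permKV. Qed.

Lemma is_signed_mul n (u w : {perm letter n}) :
  is_signed u -> is_signed w -> is_signed (u * w)%g.
Proof. by move=> hu hw y; rewrite !permM hu hw. Qed.

Lemma arr_inj n (u w : {perm letter n}) :
  is_signed u -> is_signed w -> arr u = arr w -> u = w.
Proof.
move=> hu hw e; apply: invg_inj; apply/permP => [[b i]].
have ei : (u^-1)%g (false, i) = (w^-1)%g (false, i).
  by apply: letter_val_inj; rewrite -!nth_arr e.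
case: b => //; rewrite -[(true, i)]/(bar (false, i)).
by rewrite !is_signed_inv // ei.
Qed.

Lemma opred_neq n (i : 'I_n) : val i != 0%N -> opred i != i.
Proof. by rewrite -val_eqE /= -lt0n => i0; rewrite neq_ltn prednK ?leqnn. Qed.

Lemma simple_pos n (i : 'I_n) b j : val i != 0%N ->
  simple i (b, j) = (b, tperm (opred i) i j).
Proof.
move=> i0; have pi := opred_neq i0; rewrite /simple (negPf i0) permM.
case: (tpermP (opred i) i j) => [->|->|/eqP ji /eqP jpi]; case: b.
- by rewrite (tpermD (x := (false, _))) ?tpermL.
- by rewrite tpermL tpermD.
- by rewrite (tpermD (x := (false, _))) ?tpermR.
- by rewrite tpermR tpermD.
- by rewrite !tpermD ?xpair_eqE //= 1?eq_sym.
- by rewrite !tpermD ?xpair_eqE //= 1?eq_sym.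
Qed.

Lemma simple_zero n (i : 'I_n) b j : val i = 0%N ->
  simple i (b, j) = (if j == i then ~~ b else b, j).
Proof.
move=> i0; rewrite /simple i0 /=; case: (eqVneq j i) => [->|ji].
  by case: b; rewrite ?tpermL ?tpermR.
by rewrite tpermD // xpair_eqE (eq_sym i) (negPf ji) andbF.
Qed.

Lemma is_signed_simple n (i : 'I_n) : is_signed (simple i).
Proof.
move=> [b j]; case: (eqVneq (val i) 0%N) => i0.
  by rewrite /bar /= !simple_zero //=; case: eqP.
by rewrite /bar /= !simple_pos.
Qed.

Lemma simple2 n (i : 'I_n) : (simple i * simple i)%g = 1%g.
Proof.
apply/permP => [[b j]]; rewrite permM perm1.
case: (eqVneq (val i) 0%N) => i0; last by rewrite !simple_pos // tpermK.
by rewrite !simple_zero //; case: eqP; rewrite ?negbK.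
Qed.

Lemma simpleV n (i : 'I_n) : ((simple i)^-1)%g = simple i.
Proof. by apply/eqP; rewrite eq_invg_mul simple2. Qed.

Lemma is_signed_word n (a : seq 'I_n) : is_signed (word_prod a).
Proof.
elim: a => [|i a IH] /=; first by move=> u; rewrite !perm1.
exact/is_signed_mul/is_signed_simple.
Qed.

(** Left multiplication by a generator acts on positions of the inverse. *)
Lemma arr_simple n (i : 'I_n) (w : {perm letter n}) : is_signed w ->
  arr (wmul (simple i) w) = act i (arr w).
Proof.
move=> hw; apply: (@eq_from_nth _ 0); first by rewrite size_act !size_arr.
suff H (j : 'I_n) : nth (0 : int) (arr (wmul (simple i) w)) j = nth 0 (act i (arr w)) j.
  by move=> j; rewrite size_arr => jn; apply: (H (Ordinal jn)).
rewrite nth_arr /wmul invMg simpleV permM.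
case: (eqVneq (val i) 0%N) => i0.
  rewrite simple_zero // i0 /=.
  case: (eqVneq j i) => [->|ji] /=.
    rewrite -[(true, i)]/(bar (false, i)) is_signed_inv // letter_val_bar -nth_arr i0.
    by case: (arr w) (size_arr w) => //= e; move: (ltn_ord i); rewrite -e.
  have j0 : (j : nat) != 0%N by move: ji; rewrite -val_eqE /= i0.
  rewrite -nth_arr /=; case: (arr w) => //= z r.
  by case: (nat_of_ord j) j0.
rewrite simple_pos // -nth_arr; case: i i0 => [[|i] iN] //= _.
rewrite nth_swp ?size_arr //.
case: tpermP => [->|->|] /=.
- by rewrite eqxx.
- by rewrite eqxx; case: eqP => //; lia.
by move=> /eqP; rewrite -val_eqE /= => /negPf -> /eqP; rewrite -val_eqE /= => /negPf ->.
Qed.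

Lemma arr_one n : arr (1 : {perm letter n})%g = idarr n.
Proof.
apply: (@eq_from_nth _ 0); first by rewrite size_arr size_idarr.
move=> j; rewrite size_arr => jn; rewrite -[j]/(val (Ordinal jn)) nth_arr invg1 perm1.
by rewrite (nth_map 0%N) ?size_iota // nth_iota.
Qed.

Lemma arr_word n (a : seq 'I_n) : arr (word_prod a) = arr_of n (map val a).
Proof.
elim: a => [|i a IH] /=; first exact: arr_one.
by rewrite -/(word_prod a) arr_simple ?IH //; apply: is_signed_word.
Qed.

Lemma letters_val n (a : seq 'I_n) : letters n (map val a).
Proof. by apply/allP => k /mapP[i _ ->] /=. Qed.

Lemma letters_ord n (a : seq nat) : letters n a -> exists b : seq 'I_n, map val b = a.
Proof.
elim: a => [|k a IH] /=; first by exists [::].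
by case/andP => kn /IH[b <-]; exists (Ordinal kn :: b).
Qed.

(** A word of minimal size has the size given by the length function, because
[signed_word_exists] provides a word of this size. *)
Lemma reduced_redword n (w : {perm letter n}) (a : seq 'I_n) : reduced w a ->
  redword n (map val a) /\ arr_of n (map val a) = arr w.
Proof.
case=> aw amin; have e : arr_of n (map val a) = arr w by rewrite -arr_word aw.
split=> //; rewrite /redword letters_val /=; apply/eqP/anti_leq/andP; split; last first.
  exact/invs_arr_le/letters_val.
have [c [cl ec szc]] := signed_word_exists (signed_arr n (map val a)).
have [b eb] := letters_ord cl; rewrite -szc -eb !size_map; apply: amin.
rewrite -aw; apply: arr_inj; try exact: is_signed_word.
by rewrite !arr_word eb.
Qed.

Lemma word_prod_eq n (a b : seq 'I_n) :
  arr_of n (map val a) = arr_of n (map val b) -> word_prod a = word_prod b.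
Proof. by rewrite -!arr_word => /arr_inj; apply; apply: is_signed_word. Qed.

(** * The divided differences on polynomials in X and Y *)

HB.instance Definition _ n gx gy := GRing.LRMorphism.copy (@substXY n gx gy)
  (comp_mpoly [tuple match split k with inl i => gx i | inr j => gy j end | k < n + n]).
HB.instance Definition _ n w := GRing.LRMorphism.copy (@wact n w)
  (substXY (fun i => letterX (w (false, i))) (@varY n)).

(** Morphisms of algebras that agree on the variables are equal. *)
Lemma lrmorph_mpoly_eq m (S : comAlgType rat) (F G : {lrmorphism {mpoly rat[m]} -> S}) :
  (forall i, F 'X_i = G 'X_i) -> F =1 G.
Proof.
move=> e f; rewrite (mpolyE f) !linear_sum; apply: eq_bigr => k _.
rewrite !linearZ mpolyXE_id !rmorph_prod; congr (_ *: _).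
by apply: eq_bigr => i _; rewrite !rmorphXn; congr (_ ^+ _); apply: e.
Qed.

Lemma lrmorph_XYpoly_eq n (S : comAlgType rat) (F G : {lrmorphism XYpoly n -> S}) :
  (forall i, F (varX i) = G (varX i)) -> (forall j, F (varY j) = G (varY j)) -> F =1 G.
Proof.
move=> eX eY; apply: lrmorph_mpoly_eq => k.
by rewrite -(splitK k); case: (split k) => j; [apply: eX | apply: eY].
Qed.

Lemma wact_letterX n (w : {perm letter n}) u : is_signed w ->
  wact w (letterX u) = letterX (w u).
Proof.
move=> hw; case: u => b j; rewrite /letterX rmorphM /= [wact w (varX j)]substXY_X.
case: b; last by rewrite !rmorph_sign /letterX /= expr0 !mul1r.
rewrite -[(true, j)]/(bar (false, j)) hw /letterX /=.
by rewrite rmorph_sign; case: (w _) => [[] k]; rewrite /= ?expr0 !expr1 ?mulNr ?mul1r ?opprK.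
Qed.

Lemma wact_mul n (u w : {perm letter n}) f : is_signed u ->
  wact u (wact w f) = wact (w * u)%g f.
Proof.
move=> hu; pose F : {lrmorphism XYpoly n -> XYpoly n} := wact u \o wact w.
rewrite -[LHS]/(F f); apply: lrmorph_XYpoly_eq => i /=.
  by rewrite ![wact _ (varX _)]substXY_X wact_letterX // permM.
by rewrite ![wact _ (varY _)]substXY_Y.
Qed.

Lemma wact1 n f : wact (1 : {perm letter n})%g f = f.
Proof.
rewrite -[RHS]/((idfun : {lrmorphism XYpoly n -> XYpoly n}) f).
apply: lrmorph_XYpoly_eq => i /=; rewrite ?[wact _ _]substXY_X ?[wact _ _]substXY_Y //.
by rewrite perm1 /letterX expr0 mul1r.
Qed.

Section Concrete.
Variable n' : nat.
Local Notation n := n'.+1.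
Local Notation P := (XYpoly n).

(** The variables, generators and divided differences, indexed by natural numbers; [inord] is only used below [n]. *)
Definition xv (k : nat) : P := varX (inord k : 'I_n).
Definition yv (k : nat) : P := varY (inord k : 'I_n).
Definition sv (k : nat) : {rmorphism P -> P} := wact (simple (inord k : 'I_n)).
Definition dv (k : nat) : P -> P := divdiff (inord k : 'I_n).

Lemma opred_inord k : (k.+1 < n)%N -> opred (inord k.+1 : 'I_n) = inord k.
Proof. by move=> kn; apply: val_inj; rewrite /= !inordK //; lia. Qed.

Lemma sroot_inord k : (k < n)%N -> sroot (inord k : 'I_n) = root_of xv k.
Proof.
move=> kn; rewrite /sroot [val _]inordK //; case: k kn => [|k] kn //=.
by rewrite opred_inord.
Qed.

Lemma sv_y k j : sv k (yv j) = yv j.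
Proof. exact: substXY_Y. Qed.

Lemma sv_word a f : foldr (fun k g => sv k g) f a =
  wact (word_prod [seq (inord k : 'I_n) | k <- a]) f.
Proof.
elim: a => [|k a IH] /=; first by rewrite wact1.
rewrite IH wact_mul //; exact: is_signed_simple.
Qed.

Lemma map_inordK a : letters n a -> map val [seq (inord k : 'I_n) | k <- a] = a.
Proof.
by elim: a => //= k a IH /andP[kn /IH ->]; rewrite inordK.
Qed.

(** The action of a word of generators depends only on its element. *)
Lemma sv_word_eq a b f : letters n a -> letters n b -> arr_of n a = arr_of n b ->
  foldr (fun k g => sv k g) f a = foldr (fun k g => sv k g) f b.
Proof.
move=> la lb e; rewrite !sv_word; congr wact; apply: word_prod_eq.
by rewrite !map_inordK.
Qed.

Lemma sv_x k j : sv k (xv j) = letterX (simple (inord k) (false, inord j : 'I_n)).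
Proof. exact: substXY_X. Qed.

Lemma eq_inord i j : (i < n)%N -> (j < n)%N -> (inord i == inord j :> 'I_n) = (i == j).
Proof. by move=> hi hj; rewrite -val_eqE /= !inordK. Qed.

Lemma val_inord k : (k < n)%N -> val (inord k : 'I_n) = k.
Proof. exact: inordK. Qed.

Lemma concrete_system : divdiff_system n xv sv dv.
Proof.
split.
- by move=> k f kn; rewrite -sroot_inord //; apply: divdiffE.
- by move=> k kn; rewrite -sroot_inord //; apply: sroot_neq0.
- by move=> k f kn; rewrite /= wact_mul ?simple2 ?wact1 //; apply: is_signed_simple.
- by rewrite sv_x simple_zero ?val_inord // eqxx /letterX /= expr1 mulN1r.
- move=> k kn; rewrite sv_x simple_pos ?val_inord // opred_inord // tpermL.
  by rewrite /letterX expr0 mul1r.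
- move=> k kn; rewrite sv_x simple_pos ?val_inord // opred_inord // tpermR.
  by rewrite /letterX expr0 mul1r.
- move=> k j kn jn jk jk1; rewrite sv_x.
  case: k kn jk jk1 => [|k] kn jk jk1.
    by rewrite simple_zero ?val_inord // eq_inord // (negPf jk) /letterX expr0 mul1r.
  rewrite simple_pos ?val_inord // opred_inord // tpermD /letterX ?expr0 ?mul1r // eq_inord //; lia.
- move=> i j f ij jn; have iN : (i < n)%N by lia.
  apply: (@sv_word_eq [:: i; j] [:: j; i]); rewrite /letters /= ?iN ?jn //.
  rewrite /arr_of /=; case: j i ij jn iN => [|j] [|i] //= ij jn iN.
    by case: j ij jn.
  by rewrite swpC.
- move=> i f i0 iN; case: i i0 iN => [|i] i0 iN; first (by exfalso; rewrite ltnn in i0).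
  have iN' : (i.+1 < n)%N by lia.
  have := @sv_word_eq [:: i.+1; i.+2; i.+1] [:: i.+2; i.+1; i.+2] f.
  rewrite /letters [all _ _]/= [all _ [:: i.+2; _; _]]/= iN iN' => /(_ isT isT); apply.
  rewrite /arr_of; set a := idarr n; have sz : size a = n by apply: size_idarr.
  by clearbody a; rewrite /= swp_braid // sz.
- move=> f n1; apply: (@sv_word_eq [:: 0; 1; 0; 1]%N [:: 1; 0; 1; 0]%N).
  - by rewrite /letters /= n1.
  - by rewrite /letters /= n1.
  by rewrite /arr_of; case: (n) n1 => [|[|k]].
Qed.
End Concrete.

(** * The two Schubert polynomials *)

(** Nonnegative integer coefficients. *)
Definition nat_coefs N (f : {mpoly rat[N]}) : Prop := forall m, f@_m \is a Num.nat.

Lemma nat_coefsD N (f g : {mpoly rat[N]}) : nat_coefs f -> nat_coefs g -> nat_coefs (f + g).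
Proof. by move=> hf hg m; rewrite mcoeffD rpredD. Qed.

Lemma nat_coefsM N (f g : {mpoly rat[N]}) : nat_coefs f -> nat_coefs g -> nat_coefs (f * g).
Proof.
move=> hf hg m; rewrite mcoeffM rpred_sum // => i _.
by rewrite rpredM.
Qed.

Lemma nat_coefs_nat N k : nat_coefs (k%:R : {mpoly rat[N]}).
Proof.
move=> m; rewrite -[k%:R]mulr_natl mulr1 -mpolyC_nat mcoeffC.
by rewrite rpredM // rpred_nat.
Qed.

Lemma nat_coefs_X N (i : 'I_N) : nat_coefs ('X_i : {mpoly rat[N]}).
Proof. by move=> m; rewrite mcoeffX rpred_nat. Qed.

Lemma nat_coefs_hops N (l : seq (nat * {mpoly rat[N]})) F w :
  (forall p, p \in l -> nat_coefs p.2) -> (forall u, nat_coefs (F u)) ->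
  nat_coefs (hops l F w).
Proof.
elim/last_ind: l w => // l p IH w hl hF; rewrite hops_rcons /hop.
have hl' q : q \in l -> nat_coefs q.2.
  by move=> ql; apply: hl; rewrite mem_rcons in_cons ql orbT.
apply: nat_coefsD; first exact: IH.
case: ifP => _; last by move=> m; rewrite mcoeff0.
by apply: nat_coefsM; [apply: hl; rewrite mem_rcons mem_head | apply: IH].
Qed.

Section StrictPart.
Variable n : nat.
Implicit Type A : {set 'I_n}.

Lemma perm_strict_part A : perm_eq (strict_part A) [seq (val i).+1 | i in A].
Proof. exact/permEl/perm_sort. Qed.

Lemma size_strict_part A : size (strict_part A) = #|A|.
Proof. by rewrite size_sort size_image. Qed.

Lemma strict_part_bound A : all (fun k => 0 < k <= n)%N (strict_part A).
Proof.
rewrite (perm_all _ (perm_strict_part A)); apply/allP => k /mapP[i _ ->] /=.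
exact: ltn_ord.
Qed.

Lemma strict_part_sorted A : sorted gtn (strict_part A).
Proof.
rewrite gtn_sorted_uniq_geq sort_sorted ?andbT; last by move=> a b; apply: leq_total.
rewrite sort_uniq map_inj_uniq ?enum_uniq // => i j [/val_inj].
by [].
Qed.

Lemma strict_partT : perm_eq (strict_part [set: 'I_n]) (iota 1 n).
Proof.
apply: perm_trans (perm_strict_part _) _.
rewrite /image_mem enum_setT -enumT.
by rewrite -[1%N]/(1 + 0)%N iotaDl -val_enum_ord -map_comp.
Qed.

Lemma strict_part0 : strict_part (set0 : {set 'I_n}) = [::].
Proof. by rewrite /strict_part /image_mem enum_set0. Qed.
End StrictPart.

Lemma eq_foldr_val (T : Type) n (F : 'I_n -> T -> T) (G : nat -> T -> T) f a :
  (forall i g, F i g = G i g) -> foldr F f a = foldr G f (map val a).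
Proof. by move=> h; elim: a => //= i a ->. Qed.

Section SignedDivdiff.
Variables (P : idomainType) (n : nat) (x : nat -> P).
Variables (s : nat -> {rmorphism P -> P}) (d : nat -> P -> P).
Hypothesis ds : divdiff_system n x s d.

(** The divided differences [divdiff'], with the sign changed for [k > 0]. *)
Definition dsgn (k : nat) (f : P) : P := if k == 0%N then d k f else - d k f.

Lemma dsgn_matsumoto a b f : redword n a -> redword n b ->
  arr_of n a = arr_of n b -> foldr dsgn f a = foldr dsgn f b.
Proof.
apply: matsumoto => [i j g ij jn|i g i0 iN|g n1]; rewrite /dsgn.
- have iN : (i < n)%N by lia.
  have -> : (j == 0)%N = false by lia.
  by case: ifP => _; rewrite !(dN ds) // (dC ds).
- have iN' : (i < n)%N by lia.
  have -> : (i == 0)%N = false by lia.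
  by rewrite /= !(dN ds) // (d_braid3 ds).
have n0 : (0 < n)%N by lia.
by rewrite /= !(dN ds) // (d_braid4 ds).
Qed.

Lemma foldr_dsgn a f : letters n a ->
  foldr dsgn f a = (-1) ^+ count (fun k => k != 0)%N a * dword d a f.
Proof.
elim: a => [|k a IH] /=; first by rewrite expr0 mul1r.
case/andP => kn la; rewrite IH // /dsgn (dZ ds) //; last by rewrite rmorph_sign.
by case: eqP => _ /=; rewrite ?add0n // add1n exprS !mulNr mul1r.
Qed.

(** The number of sign changes in the operator of [v]. *)
Lemma count_vword m : count (fun k => k != 0)%N (vword m) = 'C(m, 2).
Proof.
elim: m => // m IH; rewrite binS bin1 [vword _]/= /= count_cat IH add0n addnC; congr (_ + _)%N.
by apply/eqP; rewrite -{2}(size_iota 1 m) -all_count; apply/allP => k; rewrite mem_iota; lia.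
Qed.

Lemma foldr_dsgn_vword m f : (m <= n)%N ->
  foldr dsgn f (vword m) = (-1) ^+ (m * m.-1)./2 * dword d (vword m) f.
Proof.
move=> mn; rewrite foldr_dsgn ?count_vword ?bin2 //.
exact: letters_le (letters_vword m).
Qed.
Variable psi : {rmorphism P -> P}.
Hypothesis psi_x : forall k, (k < n)%N -> psi (x k) = x (n - k.+1)%N.

(** The reversal of the variables intertwines [s_k] and [s_(n-k)]. *)
Lemma reversal_x k i : (0 < k < n)%N -> (i < n)%N ->
  s (n - k)%N (psi (x i)) = psi (s k (x i)).
Proof.
move=> kn iN; rewrite psi_x //.
case: (eqVneq i k) => [->|ik].
  have [l el] : exists l, k = l.+1 by exists k.-1; lia.
  have ln : (l.+1 < n)%N by lia.
  have l1 : ((n - l.+2).+1 < n)%N by lia.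
  have e1 : (n - l.+1 = (n - l.+2).+1)%N by lia.
  have ln' : (l < n)%N by lia.
  by rewrite el (ds_sr ds ln) (psi_x ln') e1 (ds_sl ds l1).
case: (eqVneq i.+1 k) => [ik1|ik1].
  have i1 : (i.+1 < n)%N by lia.
  have i2 : ((n - i.+2).+1 < n)%N by lia.
  have e1 : (n - i.+1 = (n - i.+2).+1)%N by lia.
  by rewrite -ik1 (ds_sl ds i1) (psi_x i1) e1 (ds_sr ds i2).
have kn' : (k < n)%N by lia.
have nk : (n - k < n)%N by lia.
have ni : (n - i.+1 < n)%N by lia.
have h1 : (n - i.+1 != n - k)%N by lia.
have h2 : ((n - i.+1).+1 != n - k)%N by lia.
by rewrite (ds_sx ds nk ni h1 h2) (ds_sx ds kn' iN ik ik1) psi_x.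
Qed.

Hypothesis psi_s : forall k f, (0 < k < n)%N -> s (n - k)%N (psi f) = psi (s k f).

Lemma psi_root k : (0 < k < n)%N -> psi (root_of x k) = - root_of x (n - k)%N.
Proof.
case: k => // k kn /=; rewrite rmorphB !psi_x; try lia.
have -> : (n - k.+1 = (n - k.+2).+1)%N by lia.
by rewrite /= opprB.
Qed.

(** The change of sign of the roots under the reversal cancels the sign in [dsgn]. *)
Lemma psi_d k f : (0 < k < n)%N -> dsgn (n - k)%N (psi f) = psi (d k f).
Proof.
move=> kn; have kn' : (k < n)%N by lia.
have nk : (n - k < n)%N by lia.
rewrite /dsgn; have -> : (n - k == 0)%N = false by lia.
apply: oppr_inj; rewrite opprK; apply: (d_uniq ds nk).
rewrite (psi_s f kn) -rmorphB -(ds_dE ds f kn') rmorphM (psi_root kn).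
by rewrite mulNr mulrN.
Qed.

Lemma psi_dword a f : letters n a -> all (fun k => 0 < k)%N a ->
  foldr (dsgn) (psi f) (flip n a) = psi (dword d a f).
Proof.
elim: a => //= k a IH /andP[kn la] /andP[k0 pa].
by rewrite IH // psi_d // k0.
Qed.

End SignedDivdiff.

Section Assembly.
Variable n' : nat.
Local Notation n := n'.+1.
Local Notation P := (XYpoly n).
Let ds := concrete_system n'.
Local Notation x := (@xv n').
Local Notation y := (@yv n').
Local Notation s := (@sv n').
Local Notation d := (@dv n').

Lemma yv_fixed j : fixed_upto s n (y j).
Proof. by move=> k _; apply: sv_y. Qed.

Lemma xv_ord (i : 'I_n) : x i = varX i. Proof. by rewrite /xv inord_val. Qed.
Lemma yv_ord (i : 'I_n) : y i = varY i. Proof. by rewrite /yv inord_val. Qed.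

Lemma Delta_stair : Delta n = stair x y n.
Proof.
apply: eq_bigr => i _.
rewrite (big_ord_widen n (fun j => x i - y j)); last by rewrite leq_subr.
apply: eq_big => [j|j _]; last by rewrite xv_ord yv_ord.
by have := ltn_ord i; lia.
Qed.

(** The substitution of the variables X, respectively Y, in polynomials in [n] variables. *)
Definition iotaX : {rmorphism {mpoly rat[n]} -> P} := comp_mpoly [tuple varX i | i < n].
Definition iotaY : {rmorphism {mpoly rat[n]} -> P} := comp_mpoly [tuple varY i | i < n].

Lemma iotaX_mesym k : iotaX (mesym n rat k) = elem x n k.
Proof.
have := congr1 (fun p : {poly P} => p`_k) (elem_poly x 1 n).
rewrite coef_poly expr1n mul1r => e.
have -> : elem x n k = if (k < n.+1)%N then elem x n k else 0.
  by case: ltnP => // h; rewrite elem_gt.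
rewrite -e; under eq_bigr do rewrite addrC.
rewrite bigA_distr coef_sum rmorph_sum /= big_mkcond /=; apply: eq_bigr => A _.
have -> : \prod_(i < n) (if i \in A then (1 * x i)%:P * 'X else 1) = (\prod_(i in A) x i)%:P * 'X^(#|A|).
  rewrite -big_mkcond big_split /= prodr_const rmorph_prod; congr (_ * _).
  by apply: eq_bigr => i _; rewrite mul1r.
rewrite coefCM coefXn eq_sym; case: eqP => _; last by rewrite mulr0.
rewrite mulr1 rmorph_prod; apply: eq_bigr => i _.
by rewrite /= comp_mpolyXU -tnth_nth tnth_mktuple xv_ord.
Qed.

Lemma iotaY_fixed f : fixed_upto s n (iotaY f).
Proof.
move=> k _; pose F : {lrmorphism {mpoly rat[n]} -> P} :=
  wact (simple (inord k)) \o comp_mpoly [tuple varY i | i < n].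
rewrite -[LHS]/(F f); apply: lrmorph_mpoly_eq => i /=.
by rewrite comp_mpolyXU -tnth_nth tnth_mktuple; apply: substXY_Y.
Qed.

Lemma C_fixed c : fixed_upto s n (c%:MP : P).
Proof. by move=> k _; rewrite /= /wact /substXY comp_mpolyC. Qed.

Lemma Pt_nil : Pt n [::] = 1.
Proof.
rewrite /Pt /= expr0 invr1 scale1r /Qt /pfaffian -[RHS](@matching_sign 0).
by apply: eq_bigr => t _; rewrite big_ord0 mulr1.
Qed.

(** Among the terms of [PtXY] only the one with the full staircase in X contributes. *)
Lemma phi_Pt (A : {set 'I_n}) f : phi x d y n (iotaX (Pt n (strict_part A)) * iotaY f) =
  if A == setT then stairT x y n * iotaY f else 0.
Proof.
rewrite mulrC (phiZ ds _ _ (leqnn n) (iotaY_fixed f)) /Pt /= comp_mpolyZ -mul_mpolyC.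
rewrite (phiZ ds _ _ (leqnn n) (C_fixed _)) -/(iotaX _).
have so := strict_part_sorted A; have bo := strict_part_bound A.
case: eqP => [AT|/eqP AT].
  have pA : perm_eq (strict_part A) (iota 1 n) by rewrite AT strict_partT.
  rewrite (phi_Qt_rho ds yv_fixed iotaX_mesym so bo pA) (phi_rho ds (leqnn n) yv_fixed).
  have -> : count (fun k => k != 0)%N (strict_part A) = n.
    rewrite -[RHS](card_ord n) -cardsT -AT -size_strict_part; apply/eqP.
    rewrite -all_count; apply: sub_all bo => k; lia.
  have e2 : (2%:R ^- n)%:MP * 2%:R ^+ n = 1 :> P.
    have -> : 2%:R ^+ n = (2%:R ^+ n)%:MP :> P by rewrite rmorphXn rmorph_nat.
    by rewrite -mpolyCM mulVf // expf_neq0 // pnatr_eq0.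
  by rewrite [_ * (2%:R ^+ n * _)]mulrA e2 mul1r mulrC.
rewrite (phi_Qt_small ds yv_fixed iotaX_mesym so bo) ?mulr0 //.
rewrite size_strict_part -[X in (_ < X)%N](card_ord n) -cardsT; apply: proper_card.
by rewrite properEneq AT subsetT.
Qed.

(** The key identity [d_v (Delta P_n) = prod_(j < k) (x_k + y_j)]. *)
Lemma phi_PtXY : phi x d y n (PtXY n) = stairT x y n.
Proof.
rewrite /PtXY (phi_sum ds _ _ _ _ (leqnn n)).
under eq_bigr do rewrite phi_Pt.
by rewrite -big_mkcond big_pred1_eq setCT strict_part0 Pt_nil rmorph1 mulr1.
Qed.

Lemma divdiff'_inord k f : (k < n)%N -> @divdiff' n (inord k) f = dsgn d k f.
Proof. by move=> kn; rewrite /divdiff' val_inord. Qed.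

Lemma dsgn_vword_Delta :
  foldr (dsgn d) (Delta n * PtXY n) (vword n) = (-1) ^+ (n * n.-1)./2 * stairT x y n.
Proof.
rewrite (foldr_dsgn_vword ds) // Delta_stair.
by congr (_ * _); apply: phi_PtXY.
Qed.

Local Notation psi := (@subst_omega0X_negY n).

HB.instance Definition _ := GRing.LRMorphism.copy psi
  (substXY (fun i => varX (omega0 n i)) (fun j => - varY j)).

Lemma psi_x k : (k < n)%N -> psi (x k) = x (n - k.+1)%N.
Proof.
move=> kn; rewrite [LHS]substXY_X /omega0 permE; congr varX.
by apply: val_inj; rewrite /= !inordK //; lia.
Qed.

Lemma psi_y k : psi (y k) = - y k.
Proof. exact: substXY_Y. Qed.

Lemma psi_Delta : psi (Delta n) = stairT x y n.
Proof.
rewrite Delta_stair /stair /stairT [RHS](reindex_inj rev_ord_inj) rmorph_prod.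
apply: eq_bigr => i _; rewrite rmorph_prod; apply: eq_bigr => j _ /=.
transitivity (psi (x i) - psi (y j)); first exact: rmorphB.
by rewrite psi_x // psi_y opprK.
Qed.

Lemma psi_s k f : (0 < k < n)%N -> s (n - k)%N (psi f) = psi (s k f).
Proof.
move=> kn.
pose F : {lrmorphism P -> P} := wact (simple (inord (n - k) : 'I_n)) \o psi.
pose G : {lrmorphism P -> P} := psi \o wact (simple (inord k : 'I_n)).
rewrite -[LHS]/(F f) -[RHS]/(G f); apply: lrmorph_XYpoly_eq => i; last first.
  change (s (n - k)%N (psi (varY i)) = psi (s k (varY i))).
  by rewrite -yv_ord psi_y sv_y psi_y rmorphN sv_y.
change (s (n - k)%N (psi (varX i)) = psi (s k (varX i))).
rewrite -xv_ord; exact: (reversal_x ds psi_x kn (ltn_ord i)).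
Qed.

(** The elements of the two sides are related by the conjugation and the factor [v]. *)
Lemma arr_schub (p : 'S_n) :
  arr (schubB_perm (embed p)) = negrev (arr (schubA_perm (pstar p))).
Proof.
apply: (@eq_from_nth _ (0 : int)); first by rewrite size_negrev !size_arr.
rewrite size_arr => i iN; rewrite -[i]/(val (Ordinal iN)); set j := Ordinal iN.
rewrite /negrev (nth_map (0 : int)) ?size_rev ?size_arr // nth_rev ?size_arr //.
rewrite -[(n - _)%N]/(val (rev_ord j)) !nth_arr -letter_val_bar; congr letter_val.
rewrite /schubB_perm /schubA_perm /wmul !invMg !invgK !permM.
apply: (@perm_inj _ (w0 n)); rewrite permKV ![w0 n _]permE.
have embE (q : 'S_n) k : embed q (false, k) = (false, q k) by rewrite permE.
have pE : pstar p (rev_ord j) = omega0 n (p j).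
  by rewrite /pstar !permM [omega0 n (rev_ord j)]permE rev_ordK.
by rewrite !embE pE -[(false, omega0 n (p j))](embE (omega0 n)) permK /bar.
Qed.

Lemma arr_schubA_pos (q : 'S_n) : all (fun z => 0 < z) (arr (schubA_perm q)).
Proof.
apply/(all_nthP (0 : int)) => i; rewrite size_arr => iN.
rewrite -[i]/(val (Ordinal iN)) nth_arr /schubA_perm /wmul invMg invgK permM.
have -> (r : 'S_n) k : embed r (false, k) = (false, r k) by rewrite permE.
set k := q _; have -> : (false, k) = embed (omega0 n) (false, ((omega0 n)^-1)%g k).
  by rewrite permE /= permKV.
by rewrite permK.
Qed.

Lemma nat_coefs_psi_FK w : nat_coefs (psi (FK n x y w)).
Proof.
rewrite /FK rmorph_hops; apply: nat_coefs_hops => [q /mapP[[k c] hk ->]|u] /=; last first.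
  by rewrite rmorph_nat; apply: nat_coefs_nat.
move: hk => /flatten_mapP[i]; rewrite mem_iota => hi /mapP[j _ [_ ->]].
have iN : (i.-1 < n)%N by lia.
have -> : psi (x i.-1 - y (j - i)) = x (n - i.-1.+1) + y (j - i).
  by transitivity (psi (x i.-1) - psi (y (j - i))); [exact: rmorphB | rewrite psi_x // psi_y opprK].
by apply: nat_coefsD; apply: nat_coefs_X.
Qed.

(** The theorem for [n] of the form [n' + 1]. *)
Theorem schubB_embed_nat (p : 'S_n)
    (a : reduced_word (schubB_perm (embed p)))
    (b : reduced_word (schubA_perm (pstar p))) :
  schubB a = psi (schubA b) /\ nat_coefs (schubB a).
Proof.
case: a b => [a ra] [b rb]; rewrite /schubB /schubA /divdiff'_perm /divdiff_perm /=.
have [ra' ea] := reduced_redword ra; have [rb' eb] := reduced_redword rb.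
have pos : all (fun k => 0 < k)%N (map val b).
  by apply: (redword_unsigned rb'); rewrite eb arr_schubA_pos.
have [rf ef] := redword_flip_vword rb' pos.
have fa f : foldr (@divdiff' n) f a = foldr (dsgn d) f (map val a).
  apply: eq_foldr_val => i g; rewrite -[in LHS](inord_val i).
  exact/divdiff'_inord/ltn_ord.
have fb f : foldr (@divdiff n) f b = dword d (map val b) f.
  by apply: eq_foldr_val => i g; rewrite /dv inord_val.
have lb : letters n (map val b) by apply: letters_val.
have main : (-1) ^+ (n * n.-1)./2 * foldr (@divdiff' n) (Delta n * PtXY n) a
    = psi (foldr (@divdiff n) (Delta n) b).
  rewrite fa (dsgn_matsumoto ds _ ra' rf); last by rewrite ea ef eb arr_schub.
  rewrite foldr_cat dsgn_vword_Delta -psi_Delta fb -(psi_dword ds psi_x psi_s _ lb pos).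
  have lf : letters n (flip n (map val b)).
    by case/andP: rf => h _; move: h; rewrite /letters all_cat => /andP[].
  rewrite !(foldr_dsgn ds) // (dwordZ ds) //; last by move=> k _; rewrite rmorph_sign.
  by rewrite mulrCA; congr (_ * _); rewrite mulrA -exprMn mulrNN mulr1 expr1n mul1r.
split=> //; rewrite main fb Delta_stair -FK_top (dword_FK ds yv_fixed rb' pos).
exact: nat_coefs_psi_FK.
Qed.
End Assembly.

Theorem theorem5 (n : nat) (n_ge1 : (1 <= n)%N) (p : {perm 'I_n})
    (a : reduced_word (schubB_perm (embed p)))
    (b : reduced_word (schubA_perm (pstar p))) :
  schubB a = subst_omega0X_negY (schubA b) /\
  (forall m : 'X_{1..n + n}, ((schubB a)@_m)%R \is a Num.nat).
Proof. by case: n n_ge1 p a b => // n' _ p a b; apply: schubB_embed_nat. Qed.
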